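(* Let $0<\alpha\leq 1$, let $n\geq 2$, and let $D$ be a bounded domain in $\mathbb R^n$ with $\partial D\in C^{1,\alpha}$. If $p\geq 1$ and $$ p\leq 1+\frac{(n-1)\alpha}{n+\alpha}, $$ then $1_D\notin A_p(\mathbb R^n)$.
   Context: A domain is a (nonempty) open connected set. $1_D$ denotes the characteristic function of $D$. The Fourier transform is $\widehat f(\xi)=\int_{\mathbb R^n} f(t)e^{-i(\xi,t)}\,dt$ for integrable $f$, where $(\cdot,\cdot)$ is the inner product in $\mathbb R^n$, and is extended to tempered distributions as usual. For $1\leq p\leq\infty$, $A_p(\mathbb R^n)$ is the space of tempered distributions $f$ on $\mathbb R^n$ such that $\widehat f\in L^p(\mathbb R^n)$, with norm $\|f\|_{A_p(\mathbb R^n)}=\|\widehat f\|_{L^p(\mathbb R^n)}$. The boundary $\partial D$ is $C^1$-smooth if in an appropriate neighborhood of each of its points $\partial D$ is (after a suitable choice of orthonormal coordinates) the graph of a real function of class $C^1$. For $D$ with $C^1$-smooth boundary let $\nu_D(x)\in S^{n-1}$ be the outer unit normal vector to $\partial D$ at $x\in\partial D$, and let $$ \omega(\nu_D,\delta)=\sup_{x,y\in\partial D;\ |x-y|\leq\delta}|\nu_D(x)-\nu_D(y)|,\qquad \delta\geq 0. $$ The notation $\partial D\in C^{1,\alpha}$ means that $\partial D$ is $C^1$-smooth and $\omega(\nu_D,\delta)=O(\delta^\alpha)$ as $\delta\to+0$. *)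

(* Defs.v *)
(* R^n is 'rV[R]_n over an arbitrary R : realType. *)
From HB Require Import structures.
From mathcomp Require Import all_boot all_order all_algebra.
From mathcomp Require Import all_classical all_reals all_analysis.
From mathcomp Require Import complex.

Set Implicit Arguments.
Unset Strict Implicit.
Unset Printing Implicit Defensive.
Import Order.TTheory GRing.Theory Num.Theory.
Import numFieldTopology.Exports numFieldNormedType.Exports.

Local Open Scope classical_set_scope.
Local Open Scope ring_scope.
Local Open Scope complex_scope.

Section euclidean.
Context {R : realType} {n : nat}.
Implicit Types x y : 'rV[R]_n.

Definition dotp x y : R := \sum_(i < n) x 0 i * y 0 i.

(* The library norm `|x| on 'rV[R]_n is the sup norm. *)
Definition enorm x : R := Num.sqrt (dotp x x).

End euclidean.

(* The sigma-algebra on 'rV[T]_n is generated by the coordinates, as the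
   library does for n.-tuple T; for T = R it is the Borel sigma-algebra. *)
Section measurable_rV.
Context {d} {T : measurableType d} {n : nat}.

Definition rV_coord (i : 'I_n) (x : 'rV[T]_n) : T := x 0 i.

Let rV_set0 : g_sigma_preimage rV_coord set0.
Proof. exact: sigma_algebra0. Qed.

Let rV_setC A : g_sigma_preimage rV_coord A -> g_sigma_preimage rV_coord (~` A).
Proof. exact: sigma_algebraC. Qed.

Let rV_bigcup (F : (set 'rV[T]_n)^nat) :
  (forall i, g_sigma_preimage rV_coord (F i)) ->
  g_sigma_preimage rV_coord (\bigcup_i (F i)).
Proof. exact: sigma_algebra_bigcup. Qed.

HB.instance Definition _ := @isMeasurable.Build (measure_tuple_display d)
  'rV[T]_n (g_sigma_preimage rV_coord) rV_set0 rV_setC rV_bigcup.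

Lemma measurable_rV_coord (i : 'I_n) : measurable_fun setT (rV_coord i).
Proof.
move=> _ Y mY; rewrite setTI; apply: sub_sigma_algebra => /=.
rewrite -bigcup_seq/=; exists i => /=; first by rewrite mem_index_enum.
by exists Y => //; rewrite setTI.
Qed.

Lemma measurable_fun_rVP {d'} {S : measurableType d'} (f : S -> 'rV[T]_n) :
  (forall i, measurable_fun setT (rV_coord i \o f)) -> measurable_fun setT f.
Proof.
move=> mf _ A mA; rewrite setTI.
have : preimage_set_system setT f (g_sigma_preimage rV_coord) (f @^-1` A).
  by exists A => //; rewrite setTI.
rewrite -g_sigma_preimage_comp; apply: smallest_sub.
  exact: sigma_algebra_measurable.
rewrite -bigcup_seq; apply: bigcup_sub => i _.
by move=> B [C mC <-]; exact: mf.
Qed.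

End measurable_rV.

Section lebesgue_rV.
Context {R : realType}.

Definition rV_cons n (z : measurableTypeR R * 'rV[R]_n) : 'rV[R]_n.+1 :=
  row_mx (const_mx z.1 : 'rV_1) z.2.

Definition rV_uncons n (x : 'rV[R]_n.+1) : measurableTypeR R * 'rV[R]_n :=
  (x 0 ord0, rsubmx (x : 'rV_(1 + n))).

Lemma rV_consK n : cancel (@rV_cons n) (@rV_uncons n).
Proof.
move=> [a x]; rewrite /rV_uncons /rV_cons row_mxKr; congr pair.
by rewrite mxE; case: (@split_ordP 1 n ord0) => [j _|j /(congr1 val)]; rewrite ?mxE.
Qed.

Lemma measurable_rV_cons n : measurable_fun setT (@rV_cons n).
Proof.
apply: measurable_fun_rVP => i; rewrite /rV_coord /rV_cons /comp/=.
case: (@split_ordP 1 n i) => j ->.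
  rewrite (_ : (fun _ => _) = fst); first exact: measurable_fst.
  by apply/funext => z; rewrite [LHS]row_mxEl mxE.
rewrite (_ : (fun _ => _) = rV_coord j \o snd); last first.
  by apply/funext => z; rewrite [LHS]row_mxEr.
exact: (measurableT_comp (measurable_rV_coord j) measurable_snd).
Qed.

Lemma measurable_rV_uncons n : measurable_fun setT (@rV_uncons n).
Proof.
apply: measurable_fun_pair; first exact: (measurable_rV_coord ord0).
apply: measurable_fun_rVP => i; rewrite /rV_coord /comp/=.
under eq_fun do rewrite mxE.
exact: measurable_rV_coord.
Qed.

Section step.
Variables (n : nat) (m : {sigma_finite_measure set 'rV[R]_n -> \bar R}).

Definition lebesgue_rVS : set 'rV[R]_n.+1 -> \bar R :=
  pushforward (@lebesgue_measure R \x m)%E (@rV_cons n).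

Let lebesgue_rVS0 : lebesgue_rVS set0 = 0%E.
Proof. by rewrite /lebesgue_rVS /pushforward preimage_set0 measure0. Qed.

Let lebesgue_rVS_ge0 A : (0 <= lebesgue_rVS A)%E.
Proof. by rewrite /lebesgue_rVS /pushforward measure_ge0. Qed.

Let lebesgue_rVS_sigma_additive : semi_sigma_additive lebesgue_rVS.
Proof.
move=> F mF tF mUF; rewrite /lebesgue_rVS /pushforward preimage_bigcup.
have mcF k : measurable (@rV_cons n @^-1` F k).
  by rewrite -[X in measurable X]setTI; exact: measurable_rV_cons.
apply: measure_semi_sigma_additive => //.
- apply/trivIsetP => i j _ _ ij; rewrite -preimage_setI.
  by move/trivIsetP : tF => ->//; rewrite preimage_set0.
- by apply: bigcup_measurable => k _.
Qed.

HB.instance Definition _ := isMeasure.Build _ _ _ lebesgue_rVS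
  lebesgue_rVS0 lebesgue_rVS_ge0 lebesgue_rVS_sigma_additive.

Let lebesgue_rVS_sigma_finite : sigma_finite setT lebesgue_rVS.
Proof.
have /sigma_finiteP[F [FT ndF Foo]] := sigma_finiteT (@lebesgue_measure R).
have /sigma_finiteP[G [GT ndG Goo]] := sigma_finiteT m.
exists (fun k => @rV_uncons n @^-1` (F k `*` G k)).
  apply/esym; rewrite -subTset => x _.
  have [i _ Fi] : (\bigcup_i F i) (rV_uncons x).1 by rewrite -FT.
  have [j _ Gj] : (\bigcup_j G j) (rV_uncons x).2 by rewrite -GT.
  exists (maxn i j) => //; split.
    by move: Fi; exact/subsetPset/ndF/leq_maxl.
  by move: Gj; exact/subsetPset/ndG/leq_maxr.
move=> k; have [mF Fkoo] := Foo k; have [mG Gkoo] := Goo k; split.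
  rewrite -[X in measurable X]setTI.
  by apply: measurable_rV_uncons => //; exact: measurableX.
rewrite /lebesgue_rVS /pushforward -comp_preimage.
rewrite (_ : _ \o _ = id); last by apply/funext => z; exact: rV_consK.
by rewrite preimage_id product_measure1E// lte_mul_pinfty// ge0_fin_numE.
Qed.

HB.instance Definition _ := @Measure_isSigmaFinite.Build _ _ _ lebesgue_rVS
  lebesgue_rVS_sigma_finite.

End step.

(* n-fold product of the Lebesgue measure on R, along R^(n+1) = R x R^n. *)
Fixpoint lebesgue_rV n : {sigma_finite_measure set 'rV[R]_n -> \bar R} :=
  if n is n'.+1 then lebesgue_rVS (lebesgue_rV n') else \d_(0 : 'rV[R]_0).

End lebesgue_rV.

Section fourier.
Context {R : realType} {n : nat}.
Local Notation E := ('rV[R]_n).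
Local Notation mu := (@lebesgue_rV R n).
Local Notation Re := (@complex.Re R).
Local Notation Im := (@complex.Im R).
Local Notation normc := (@complex.ComplexField.Normc.normc R).

Definition cintegral (f : E -> R[i]) : R[i] :=
  (\int[mu]_x Re (f x)) +i* (\int[mu]_x Im (f x)).

(* e^{-is} *)
Definition cexpN (s : R) : R[i] := cos s -i* sin s.

Definition fourier (f : E -> R[i]) (xi : E) : R[i] :=
  cintegral (fun t => f t * cexpN (dotp xi t)).

Definition partials (s : seq 'I_n) (f : E -> R) : E -> R :=
  foldr (fun i (g : E -> R) x => 'D_(delta_mx 0 i : E) g x) f s.

Definition cpartials (s : seq 'I_n) (phi : E -> R[i]) (x : E) : R[i] :=
  partials s (Re \o phi) x +i* partials s (Im \o phi) x.

(* R[i] carries no normed R-module structure, hence the real and imaginary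
   parts; differentiability of all iterated partials is C^oo. *)
Definition smooth (phi : E -> R[i]) :=
  forall (s : seq 'I_n) (x : E),
    differentiable (partials s (Re \o phi)) x /\
    differentiable (partials s (Im \o phi)) x.

Definition schwartz (phi : E -> R[i]) := smooth phi /\
  forall (s : seq 'I_n) (N : nat), exists C : R, forall x : E,
    (1 + enorm x) ^+ N * normc (cpartials s phi x) <= C.

(* Tempered distributions are the functionals T : (E -> R[i]) -> R[i] that are
   linear and continuous on the Schwartz space; values of T elsewhere are
   irrelevant.  Continuity: T is bounded by a multiple of one of the norms
   sup_{|s| <= N, x} (1 + |x|)^N |d^s phi(x)|. *)
Definition tempered_distribution (T : (E -> R[i]) -> R[i]) :=
  (forall (a : R[i]) (phi psi : E -> R[i]), schwartz phi -> schwartz psi ->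
     T (fun x => a * phi x + psi x) = a * T phi + T psi) /\
  exists (C : R) (N : nat), forall (phi : E -> R[i]) (M : R), schwartz phi ->
    (forall (s : seq 'I_n) (x : E), (size s <= N)%N ->
       (1 + enorm x) ^+ N * normc (cpartials s phi x) <= M) ->
    normc (T phi) <= C * M.

Definition distribution_of (f : E -> R[i]) (phi : E -> R[i]) : R[i] :=
  cintegral (fun x => f x * phi x).

Definition dfourier (T : (E -> R[i]) -> R[i]) (phi : E -> R[i]) : R[i] :=
  T (fourier phi).

Definition Lp (p : \bar R) (g : E -> R[i]) :=
  [/\ measurable_fun setT (Re \o g), measurable_fun setT (Im \o g) &
      (Lnorm mu p (fun x => (normc (g x))%:E) < +oo)%E].

Definition Ap (p : \bar R) : set ((E -> R[i]) -> R[i]) :=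
  [set T | tempered_distribution T /\
    exists g : E -> R[i], Lp p g /\
      forall phi, schwartz phi -> dfourier T phi = distribution_of g phi].

End fourier.

Section domains.
Context {R : realType} {n : nat}.
Local Notation E := ('rV[R]_n).
Implicit Types (D : set E) (x v w : E).

Definition is_domain D := [/\ D !=set0, open D & connected D].

Definition boundary D : set E := closure D `\` D°.

Definition C1_on m (V : set 'rV[R]_m) (f : 'rV[R]_m -> R) :=
  forall (i : 'I_m) (y : 'rV[R]_m), V y ->
    derivable f y (delta_mx 0 i) /\
    {for y, continuous (fun z => 'D_(delta_mx 0 i : 'rV[R]_m) f z)}.

(* y *m Q lists the coordinates of y in the orthonormal basis formed by the
   columns of Q; the j-th one is a function of the n - 1 others. *)
Definition C1_boundary D :=
  forall x, boundary D x ->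
  exists (U : set E) (Q : 'M[R]_n) (j : 'I_n)
         (V : set 'rV[R]_n.-1) (f : 'rV[R]_n.-1 -> R),
    [/\ open_nbhs x U, Q^T *m Q = 1%:M, open V, C1_on V f &
        boundary D `&` U =
          [set y | V (col' j (y *m Q)) /\ (y *m Q) 0 j = f (col' j (y *m Q))]].

(* w is the velocity at x of a curve lying in the boundary of D. *)
Definition tangent D x w :=
  exists gamma : R -> E, [/\ gamma 0 = x,
    \forall t \near (0 : R), boundary D (gamma t) &
    is_derive (0 : R) 1 gamma w].

Definition is_outer_unit_normal D x v :=
  [/\ enorm v = 1, forall w, tangent D x w -> dotp v w = 0 &
      \forall t \near (0 : R)^'+, D (x - t *: v) /\ ~ D (x + t *: v)].

(* For a bounded domain with C^1 boundary there is exactly one such vector at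
   every boundary point. *)
Definition outer_normal D x : E := xget 0 [set v | is_outer_unit_normal D x v].

Definition normal_modulus D (delta : R) : R :=
  sup [set enorm (outer_normal D z.1 - outer_normal D z.2) |
       z in [set z : E * E | [/\ boundary D z.1, boundary D z.2 &
                                 enorm (z.1 - z.2) <= delta]]].

Definition C1alpha_boundary (alpha : R) D :=
  C1_boundary D /\
  (normal_modulus D : R -> R) =O_ ((0 : R)^'+) (fun delta => delta `^ alpha).

End domains.

(* Main.v *)
(* Fix a frequency xi in a box of size L around a point far out on the first axis,
   and let x0 maximize (xi,.) on the closure of D, so that xi is an outer normal
   direction at x0. Localize 1_D by a Gaussian of width d centred at x0, where
   d^(1+alpha) ~ 1/L. Since the normal is alpha-Hoelder, D fills its tangent
   half-space at x0 up to a gap of volume << d^(n-1)/L inside the Gaussian window,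
   so the transform of the localized indicator at xi is comparable with that of a
   half-space, >> d^(n-1)/L. It is also a Gaussian average, at scale 1/d, of the
   Fourier transform g of 1_D around xi. Integrating t <= M + M^(1-p) t^p over the
   box, of volume ~ L^n, turns this into a lower bound
   L^n (d^(n-1)/L)^p for Gaussian averages of |g|^p over the box, and this stays
   bounded below exactly when p <= 1 + (n-1)alpha/(n+alpha). When g is in L^p those
   averages tend to 0 by dominated convergence as the boxes escape to infinity. *)
Require Import Defs.
From mathcomp Require Import all_boot all_order all_algebra.
From mathcomp Require Import all_classical all_reals all_analysis.
From mathcomp Require Import complex.
From mathcomp Require Import measurable_realfun ring lra.

Set Implicit Arguments.
Unset Strict Implicit.
Unset Printing Implicit Defensive.
Import Order.TTheory GRing.Theory Num.Theory.
Import numFieldTopology.Exports numFieldNormedType.Exports.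

Local Open Scope classical_set_scope.
Local Open Scope ring_scope.
Local Open Scope complex_scope.

(** * Integration on row vectors *)

(** The support point depends on the frequency with no measurability at hand. This is harmless: the
    pairing bound eliminates it and keeps only a Gaussian average of a power of |g| around the
    frequency, and only then is the frequency integrated. Gaussians serve as cutoffs because they
    are Schwartz, have explicit transforms and factor over the coordinates, so every integral
    reduces to lines parallel to the first axis. On such a line the contributions of successive half
    periods of the sine alternate in sign; adding a copy of the Gaussian moved by half a period
    makes them telescope and leaves a single positive term. With L ~ d^(-1-alpha) the box bound is a
    constant times d to the power (n + alpha) p - n (1 + alpha). At the endpoint this exponent is 0,
    so nothing blows up there and the contradiction has to come from averages that tend to 0. *)

Lemma open_measurable_rV (R : realType) n (A : set 'rV[R]_n) :
  open A -> measurable A.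
Proof.
move=> oA.
(* Cubes with rational centre and radius 1/(k+1): measurable through the coordinates, countably
   many, and those contained in [A] cover it. *)
pose B (z : 'rV[rat]_n * nat) : set 'rV[R]_n :=
  \bigcap_(i in [set: 'I_n]) (rV_coord i @^-1` ball (ratr (z.1 0 i) : R) z.2.+1%:R^-1).
have mB z : measurable (B z).
  apply: fin_bigcap_measurable => // i _.
  rewrite -[X in measurable X]setTI; apply: measurable_rV_coord => //.
  exact: measurable_ball.
have -> : A = \bigcup_(z in [set: 'rV[rat]_n * nat])
    (if `[< B z `<=` A >] then B z else set0).
  apply/seteqP; split => [x Ax|x [z _]]; last first.
    by case: ifPn => // /asboolP; exact.
  have /nbhs_ballP[e e0 eA] := open_nbhs_nbhs (conj oA Ax).
  have e20 : 0 < e / 2 by rewrite divr_gt0.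
  pose k := Num.truncn ((e / 2)^-1).
  have ke : k.+1%:R^-1 < e / 2 :> R.
    by rewrite invf_plt ?posrE//; exact: truncnS_gt.
  have [f fP] : exists f : 'I_n -> rat, forall i,
      `|x 0 i - ratr (f i)| < k.+1%:R^-1.
    apply: (@fin_all_exists 'I_n (fun=> rat)
        (fun i q => is_true (`|x 0 i - ratr q| < k.+1%:R^-1))) => i.
    have k0 : x 0 i - k.+1%:R^-1 < x 0 i + k.+1%:R^-1.
      by rewrite ltrD2l; apply: (@lt_trans _ _ 0); rewrite ?oppr_lt0 ?invr_gt0.
    have [q] := rat_in_itvoo k0.
    rewrite in_itv/= => /andP[q1 q2]; exists q.
    rewrite ltr_distl; apply/andP; split; [rewrite ltrBlDr|rewrite -ltrBlDr] => //.
  exists (\row_i f i, k) => //.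
  have BA : B (\row_i f i, k) `<=` A.
    move=> y By; apply: eA.
    split => // i j; rewrite (ord1 i) -ball_normE /=.
    have := By j I; rewrite /rV_coord /= -ball_normE /= mxE => yj.
    have -> : x 0 j - y 0 j = (x 0 j - ratr (f j)) + (ratr (f j) - y 0 j) by ring.
    apply: le_lt_trans (ler_normD _ _) _.
    by apply: lt_trans (ltrD (fP j) yj) _; rewrite [e]splitr ltrD.
  have -> : `[< B (\row_i f i, k) `<=` A >] by apply/asboolP.
  by move=> i _; rewrite /rV_coord /= -ball_normE /= mxE distrC.
apply: countable_bigcupT_measurable; first exact: countableP.
by move=> z; case: ifPn.
Qed.

Lemma continuous_measurable_rV (R : realType) n (f : 'rV[R]_n -> R) :
  continuous f -> measurable_fun setT f.
Proof.
move=> cf; apply: (measurability _ (RGenOpens.measurableE R)).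
move=> _ [_ [a [b ->] <-]]; rewrite setTI.
by apply: open_measurable_rV; apply: open_comp => // x _; exact: cf.
Qed.

Section integral_rVS.
Context {R : realType} (n : nat).
Local Notation mu := (@lebesgue_measure R).
Local Notation nu := (@lebesgue_rV R).
Local Open Scope ereal_scope.

Lemma ge0_integral_rVS (f : 'rV[R]_n.+1 -> \bar R) :
  measurable_fun setT f -> (forall x, 0 <= f x) ->
  \int[nu n.+1]_x f x = \int[nu n]_y \int[mu]_t f (rV_cons (t, y)).
Proof.
move=> mf f0.
rewrite (ge0_integral_pushforward (@measurable_rV_cons R n))//.
rewrite fubini_tonelli2//.
  by apply: measurableT_comp => //; exact: measurable_rV_cons.
by move=> ?; exact: f0.
Qed.

Lemma integrable_rV_cons (f : 'rV[R]_n.+1 -> \bar R) :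
  (nu n.+1).-integrable setT f ->
  (mu \x nu n).-integrable setT (f \o @rV_cons R n).
Proof.
move=> /integrableP[mf fi]; apply/integrableP; split.
  by apply: measurableT_comp => //; exact: measurable_rV_cons.
have := fi; rewrite (ge0_integral_pushforward (@measurable_rV_cons R n))//.
exact: measurableT_comp.
Qed.

Lemma integral_rVS (f : 'rV[R]_n.+1 -> \bar R) :
  (nu n.+1).-integrable setT f ->
  \int[nu n.+1]_x f x = \int[nu n]_y \int[mu]_t f (rV_cons (t, y)).
Proof.
move=> fi; have fi' := integrable_rV_cons fi.
rewrite (integral_pushforward (@measurable_rV_cons R n))//.
  by rewrite -(integral21_prod_meas1 fi').
exact: measurable_int fi.
Qed.

End integral_rVS.

Section integral_translation.
Context {R : realType}.
Local Notation mu := (@lebesgue_measure R).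
Local Open Scope ereal_scope.

Lemma measurable_shift (c : R) :
  measurable_fun setT ((fun t => t + c)%R : measurableTypeR R -> measurableTypeR R).
Proof. exact: measurable_funD. Qed.

Lemma lebesgue_measure_shift (c : R) (A : set (measurableTypeR R)) :
  measurable A ->
  pushforward mu ((fun t => t + c)%R : measurableTypeR R -> measurableTypeR R) A = mu A.
Proof.
move=> mA; apply/esym/lebesgue_measure_unique => //=.
  exact: measurable_shift.
move=> ? _ [[a b] _ <-]; rewrite /= /pushforward /=.
have -> : (fun t => t + c)%R @^-1` `]a, b] = `](a - c)%R, (b - c)%R]%classic.
  by apply/seteqP; split => x /=; rewrite !in_itv/= ltrBlDr lerBrDr.
rewrite !lebesgue_measure_itv/= !lte_fin ltrD2r.
by case: ifPn => // _; rewrite -!EFinB; congr EFin; ring.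
Qed.

Lemma ge0_integral_shift (c : R) (f : R -> \bar R) :
  measurable_fun setT f -> (forall x, 0 <= f x) ->
  \int[mu]_t f (t + c)%R = \int[mu]_t f t.
Proof.
move=> mf f0.
rewrite [RHS](eq_measure_integral (pushforward mu (fun t : measurableTypeR R => t + c : measurableTypeR R)%R)).
- exact: measurable_shift.
- by move=> ?; rewrite (ge0_integral_pushforward (measurable_shift c)).
- by move=> ? A mA _; apply/esym; exact: lebesgue_measure_shift.
Qed.

Lemma integrable_shift (c : R) (f : R -> \bar R) :
  mu.-integrable setT f -> mu.-integrable setT (fun t => f (t + c)%R).
Proof.
move=> /integrableP[mf fi]; apply/integrableP; split.
  apply: (measurableT_comp mf); exact: measurable_shift.
rewrite (ge0_integral_shift c (f := abse \o f))//.
  exact: measurableT_comp.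
by move=> x; exact: abse_ge0.
Qed.

Lemma integral_shift (c : R) (f : R -> \bar R) :
  mu.-integrable setT f ->
  \int[mu]_t f (t + c)%R = \int[mu]_t f t.
Proof.
move=> fi.
rewrite [RHS](eq_measure_integral (pushforward mu (fun t : measurableTypeR R => t + c : measurableTypeR R)%R)).
- exact: measurable_shift.
- move=> ?; rewrite (integral_pushforward (measurable_shift c))//.
    exact: measurable_int fi.
  exact: integrable_shift.
- by move=> ? A mA _; apply/esym; exact: lebesgue_measure_shift.
Qed.

End integral_translation.

(** * One-dimensional Gaussians *)

Section gauss1.
Context {R : realType}.
Local Notation mu := (@lebesgue_measure R).

Definition gauss1 (a c t : R) : R := expR (- (a * (t - c) ^+ 2)).

Lemma gauss1_ge0 a c t : 0 <= gauss1 a c t. Proof. exact: expR_ge0. Qed.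

Lemma measurable_gauss1 a c : measurable_fun setT (gauss1 a c).
Proof.
apply: measurableT_comp => //; apply: measurableT_comp => //.
by apply: measurable_funM => //; apply: measurable_funX; exact: measurable_funB.
Qed.

Lemma integral_gauss1 a c : 0 < a ->
  (\int[mu]_t (gauss1 a c t)%:E)%E = (Num.sqrt (pi / a))%:E.
Proof.
(* The standard deviation for which the normal density is a multiple of [gauss1 a c]. *)
move=> a0; pose s := Num.sqrt ((2 * a)^-1).
have s2 : s ^+ 2 = (2 * a)^-1 by rewrite sqr_sqrtr// invr_ge0 mulr_ge0// ltW.
have s0 : s != 0 by rewrite gt_eqF// sqrtr_gt0 invr_gt0 mulr_gt0.
have pk0 : 0 < normal_peak s by exact: normal_peak_gt0.
have E t : gauss1 a c t = (normal_peak s)^-1 * normal_pdf c s t.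
  rewrite normal_pdfE// mulKf ?gt_eqF// /normal_fun s2.
  by rewrite /gauss1; congr expR; field; rewrite gt_eqF.
under eq_integral do rewrite E EFinM.
rewrite integralZl//; last exact: integrable_normal_pdf.
rewrite integral_normal_pdf mule1 /normal_peak invrK s2; congr (Num.sqrt _)%:E.
by field; rewrite gt_eqF.
Qed.

Lemma integrable_gauss1 a c : 0 < a ->
  mu.-integrable setT (fun t => (gauss1 a c t)%:E).
Proof.
move=> a0; apply/integrableP; split.
  by apply/measurable_EFinP; exact: measurable_gauss1.
under eq_integral do rewrite gee0_abs ?lee_fin ?gauss1_ge0//.
by rewrite integral_gauss1// ltry.
Qed.

Lemma integrable_gauss1_bound a c C (f : R -> R) : 0 < a ->
  measurable_fun setT f -> (forall t, `|f t| <= C * gauss1 a c t) ->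
  mu.-integrable setT (EFin \o f).
Proof.
move=> a0 mf fC; apply: (@le_integrable _ _ _ mu setT measurableT (EFin \o f)
    (fun t => (C%:E * (gauss1 a c t)%:E)%E)) => //.
- exact/measurable_EFinP.
- move=> t _; rewrite /= lee_fin; apply: le_trans (fC t) _; exact: ler_norm.
- by apply: integrableZl => //; exact: integrable_gauss1.
Qed.

(** Half of the exponent absorbs the factor [t], through e^u >= 1 + u. This is the domination needed
    to differentiate the cosine transform under the integral. *)
Lemma id_gauss1_bound a t : 0 < a ->
  `|t * gauss1 a 0 t| <= (1 + 2 / a) * gauss1 (a / 2) 0 t.
Proof.
move=> a0; rewrite normrM (ger0_norm (gauss1_ge0 _ _ _)).
have -> : gauss1 a 0 t = gauss1 (a / 2) 0 t * gauss1 (a / 2) 0 t.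
  by rewrite /gauss1 -expRD; congr expR; field.
rewrite mulrA ler_wpM2r ?gauss1_ge0// /gauss1 expRN -ler_pdivlMr ?invr_gt0 ?expR_gt0// invrK.
have h : 1 + a / 2 * (t - 0) ^+ 2 <= expR (a / 2 * (t - 0) ^+ 2) by exact: expR_ge1Dx.
have a20 : 0 <= 1 + 2 / a by rewrite addr_ge0// divr_ge0// ltW.
apply: le_trans (ler_wpM2l a20 h); rewrite subr0.
have -> : (1 + 2 / a) * (1 + a / 2 * t ^+ 2) = 1 + t ^+ 2 + (2 / a + a / 2 * t ^+ 2).
  by field; rewrite gt_eqF.
have p1 : 0 <= 2 / a + a / 2 * t ^+ 2.
  by have a1 := ltW a0; apply: addr_ge0; [apply: divr_ge0|apply: mulr_ge0; [apply: divr_ge0|exact: sqr_ge0]].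
have p2 : `|t| <= 1 + t ^+ 2.
  have n2 : `|t| ^+ 2 = t ^+ 2 by rewrite real_normK ?num_real.
  have := sqr_ge0 (`|t| - 1); have := normr_ge0 t.
  by rewrite sqrrB expr1n mulr1 n2; lra.
by apply: (le_trans p2); rewrite lerDl.
Qed.

(** Fundamental theorem of calculus on growing symmetric intervals, then dominated convergence. It
    serves as integration by parts on the line, without boundary terms. *)
Lemma integral_derivative_eq0 (F f : R -> R) :
  (forall t : R, is_derive t (1 : R) F (f t)) -> continuous f ->
  mu.-integrable setT (EFin \o f) ->
  F x @[x --> +oo] --> 0 -> F x @[x --> -oo] --> 0 ->
  (\int[mu]_t (f t)%:E)%E = 0%E.
Proof.
move=> dF cf fi Fp Fn.
pose I n : set R := `[- n.+1%:R, n.+1%:R]%classic.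
have c1 : (\int[mu]_(t in I n) (f t)%:E)%E @[n --> \oo] --> (\int[mu]_t (f t)%:E)%E.
  rewrite (_ : (fun n => _) = fun n => \int[mu]_t ((EFin \o f) \_ (I n)) t)%E; last first.
    by apply/funext => n; rewrite integral_mkcond.
  apply: (@dominated_cvg _ _ _ mu _ measurableT _ _ (fun t => `|(f t)%:E|%E)) => //.
  - move=> n; apply/(measurable_restrict _ _ _).1 => //; rewrite ?setTI; first exact: measurable_itv.
    apply: measurable_funS (measurable_int _ fi) => //.
  - move=> t _; apply: cvg_near_cst.
    exists (Num.truncn `|t|) => // n /= tn.
    rewrite patchE mem_set// /I/= in_itv/= -ler_norml ltW//.
    by apply: lt_le_trans (truncnS_gt _) _; rewrite ler_nat.
  - exact: (integrable_abse fi).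
  - move=> n t _; rewrite patchE; case: ifPn => // _.
    by rewrite abse0.
have c2 : (\int[mu]_(t in I n) (f t)%:E)%E @[n --> \oo] --> 0%E.
  have E n : (\int[mu]_(t in I n) (f t)%:E)%E = (F n.+1%:R - F (- n.+1%:R))%:E.
    rewrite (@continuous_FTC2 _ f F) ?EFinB//.
    - by rewrite gtrN.
    - exact: continuous_subspaceT.
    - have cF t : F x @[x --> t] --> F t.
        by apply: differentiable_continuous; apply/derivable1_diffP; exact: ex_derive.
      split => [t _||]; first exact: ex_derive.
        exact: cvg_at_right_filter.
      exact: cvg_at_left_filter.
    - by move=> t _; rewrite derive1E; apply: derive_val.
  under eq_cvg do rewrite E.
  apply: cvg_EFin; first exact: nearW.
  rewrite -[X in _ --> X](subr0 0); apply: cvgB.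
    by rewrite (cvg_shiftS (fun n => F n%:R)); apply: (cvg_comp _ _ cvgr_idn Fp).
  rewrite (cvg_shiftS (fun n => F (- n%:R))).
  by apply: (cvg_comp _ (F \o -%R) cvgr_idn); apply/cvgNy_compNP.
exact: (cvg_unique _ c1 c2).
Qed.

End gauss1.

Lemma integrableMl_EFin (d : measure_display) (T : measurableType d) (R : realType)
    (mu : {measure set T -> \bar R}) (k : R) (f : T -> R) :
  mu.-integrable setT (EFin \o f) ->
  mu.-integrable setT (EFin \o (fun t => k * f t)).
Proof.
move=> fi; rewrite (_ : _ \o _ = fun t => (k%:E * (EFin \o f) t)%E).
  exact: integrableZl.
by apply/funext => t; rewrite /= EFinM.
Qed.

(** * Cosine and sine transforms of one-dimensional Gaussians *)

Section gauss1_fourier.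
Context {R : realType}.
Local Notation mu := (@lebesgue_measure R).

Lemma measurable_cosZ (s : R) : measurable_fun setT (fun t => cos (s * t)).
Proof.
apply: (@measurableT_comp _ _ _ _ _ _ (@cos R)); last exact: measurable_funM.
by apply: continuous_measurable_fun; exact: continuous_cos.
Qed.

Lemma measurable_sinZ (s : R) : measurable_fun setT (fun t => sin (s * t)).
Proof.
apply: (@measurableT_comp _ _ _ _ _ _ (@sin R)); last exact: measurable_funM.
by apply: continuous_measurable_fun; exact: continuous_sin.
Qed.

Lemma normr_cos_le1 (x : R) : `|cos x| <= 1.
Proof. by rewrite ler_norml cos_geN1 cos_le1. Qed.

Lemma normr_sin_le1 (x : R) : `|sin x| <= 1.
Proof. by rewrite ler_norml sin_geN1 sin_le1. Qed.

Lemma gauss1M_bound a c (x u : R) : `|u| <= 1 -> `|gauss1 a c x * u| <= 1 * gauss1 a c x.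
Proof.
move=> u1; rewrite normrM (ger0_norm (gauss1_ge0 _ _ _)) mulrC.
by rewrite ler_wpM2r ?gauss1_ge0.
Qed.

Lemma integrable_gauss1_cos a c s : 0 < a ->
  mu.-integrable setT (fun t => (gauss1 a c t * cos (s * t))%:E).
Proof.
move=> a0; apply: (@integrable_gauss1_bound _ a c 1 (fun t => gauss1 a c t * cos (s * t))) => //.
  apply: measurable_funM; first exact: measurable_gauss1.
  exact: measurable_cosZ.
by move=> t; apply: gauss1M_bound; exact: normr_cos_le1.
Qed.

Lemma integrable_gauss1_sin a c s : 0 < a ->
  mu.-integrable setT (fun t => (gauss1 a c t * sin (s * t))%:E).
Proof.
move=> a0; apply: (@integrable_gauss1_bound _ a c 1 (fun t => gauss1 a c t * sin (s * t))) => //.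
  apply: measurable_funM; first exact: measurable_gauss1.
  exact: measurable_sinZ.
by move=> t; apply: gauss1M_bound; exact: normr_sin_le1.
Qed.

Lemma integrable_id_gauss1_sin a s : 0 < a ->
  mu.-integrable setT (fun t => (t * gauss1 a 0 t * sin (s * t))%:E).
Proof.
move=> a0; have a20 : 0 < a / 2 by rewrite divr_gt0.
apply: (@integrable_gauss1_bound _ (a / 2) 0 (1 + 2 / a)
  (fun t => t * gauss1 a 0 t * sin (s * t))) => //.
  apply: measurable_funM; last exact: measurable_sinZ.
  apply: measurable_funM => //; exact: measurable_gauss1.
move=> t; rewrite normrM -[leRHS]mulr1; apply: ler_pM => //.
- exact: id_gauss1_bound.
- exact: normr_sin_le1.
Qed.

Lemma is_derive_gauss1 a (t : R) :
  is_derive t (1 : R) (gauss1 a 0) (- (2 * a * (t * gauss1 a 0 t))).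
Proof.
rewrite /gauss1.
have h : is_derive t (1 : R) (fun t : R => - (a * (t - 0) ^+ 2)) (- (2 * a * t)).
  apply: is_derive_eq; rewrite /GRing.scale/= !subr0; ring.
apply: is_derive_eq; rewrite /GRing.scale/= !subr0; ring.
Qed.

Lemma gauss1_cvgy (a : R) : 0 < a -> gauss1 a 0 x @[x --> +oo] --> (0 : R).
Proof.
move=> a0; rewrite /gauss1; under eq_fun do rewrite subr0.
apply: (cvg_comp (fun x : R => a * x ^+ 2) (fun x => expR (- x))).
  by apply: gt0_cvgMry => //; exact: cvgr_expr2.
exact: cvgr_expR.
Qed.

Lemma gauss1_sin_cvg0 (a s : R) : 0 < a ->
  (gauss1 a 0 x * sin (s * x) @[x --> +oo] --> (0 : R)) /\
  (gauss1 a 0 x * sin (s * x) @[x --> -oo] --> (0 : R)).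
Proof.
move=> a0.
have h s' : gauss1 a 0 x * sin (s' * x) @[x --> +oo] --> (0 : R).
  apply: norm_cvg0; apply: (@squeeze_cvgr _ _ _ _ (cst 0) (gauss1 a 0)).
  - near=> x; rewrite normr_ge0/=; apply: (le_trans (gauss1M_bound _ _ _ (normr_sin_le1 _))).
    by rewrite mul1r.
  - exact: cvg_cst.
  - exact: gauss1_cvgy.
split => //; apply/cvgNy_compNP.
rewrite (_ : _ \o _ = fun x => gauss1 a 0 x * sin (- s * x)); first exact: h.
by apply/funext => x /=; rewrite /gauss1 !subr0 sqrrN mulrN mulNr.
Unshelve. all: by end_near. Qed.

(** Integration by parts: the derivative of [gauss1 a 0 t * sin (s * t)] has integral 0. It turns
    the derivative of the cosine transform in [s] back into the transform itself. *)
Lemma integral_id_gauss1_sin a s : 0 < a ->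
  \int[mu]_t (t * gauss1 a 0 t * sin (s * t)) =
  s / (2 * a) * \int[mu]_t (gauss1 a 0 t * cos (s * t)).
Proof.
move=> a0.
pose F t := gauss1 a 0 t * sin (s * t).
pose f t := s * (gauss1 a 0 t * cos (s * t)) - 2 * a * (t * gauss1 a 0 t * sin (s * t)).
have i1 := integrable_gauss1_cos 0 s a0.
have i2 := integrable_id_gauss1_sin s a0.
have i1' : mu.-integrable setT (fun t => (s * (gauss1 a 0 t * cos (s * t)))%:E).
  exact: integrableMl_EFin.
have i2' : mu.-integrable setT (fun t => (2 * a * (t * gauss1 a 0 t * sin (s * t)))%:E).
  exact: integrableMl_EFin.
have dg := is_derive_gauss1 a.
have dF (t : R) : is_derive t (1 : R) F (f t).
  have hs : is_derive t (1 : R) (fun t => sin (s * t)) (s * cos (s * t)).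
    have hm : is_derive t (1 : R) (fun t => s * t) s.
      by apply: is_derive_eq; rewrite /GRing.scale/=; ring.
    by apply: is_derive_eq; rewrite /GRing.scale/=; ring.
  by apply: is_derive_eq; rewrite /f /GRing.scale/=; ring.
have [c1 c2] := gauss1_sin_cvg0 s a0.
have := @integral_derivative_eq0 R F f dF.
have cg : continuous (gauss1 a 0).
  move=> t; apply: differentiable_continuous; apply/derivable1_diffP; exact: ex_derive.
have cs : continuous (fun t => sin (s * t)).
  by move=> t; apply: continuous_comp; [exact: mulrl_continuous|exact: continuous_sin].
have cc : continuous (fun t => cos (s * t)).
  by move=> t; apply: continuous_comp; [exact: mulrl_continuous|exact: continuous_cos].
have cf : continuous f.
  move=> t; apply: cvgB; apply: cvgM; try exact: cvg_cst; apply: cvgM.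
  - exact: cg.
  - exact: cc.
  - by apply: cvgM; [exact: cvg_id|exact: cg].
  - exact: cs.
move=> /(_ cf).
have fi : mu.-integrable setT (EFin \o f).
  rewrite (_ : EFin \o f = ((fun t => (s * (gauss1 a 0 t * cos (s * t)))%:E) \-
    (fun t => (2 * a * (t * gauss1 a 0 t * sin (s * t)))%:E))%E); last by apply/funext.
  exact: integrableB.
move=> /(_ fi c1 c2) /(congr1 fine) /=.
rewrite -/(Rintegral mu setT f) /f RintegralB// !RintegralZl//.
move/eqP; rewrite subr_eq0 => /eqP h.
apply: (mulfI (x := 2 * a)); first by rewrite gt_eqF// mulr_gt0.
by rewrite -h; field; rewrite gt_eqF.
Qed.

(** As a function of [s] the transform [F] solves F' = - s / (2a) F, so multiplying it by e^(s^2 /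
    (4a)) gives a constant, which is read off at s = 0. *)
Lemma Rintegral_gauss1_cos0 a s : 0 < a ->
  \int[mu]_t (gauss1 a 0 t * cos (s * t)) =
  Num.sqrt (pi / a) * expR (- (s ^+ 2 / (4 * a))).
Proof.
move=> a0; have a20 : 0 < a / 2 by rewrite divr_gt0.
pose F s := \int[mu]_t (gauss1 a 0 t * cos (s * t)).
have dcos (u t : R) : is_derive u (1 : R) (fun s => gauss1 a 0 t * cos (s * t))
    (- (t * gauss1 a 0 t * sin (u * t))).
  have hs : is_derive u (1 : R) (fun s => cos (s * t)) (- (t * sin (u * t))).
    have hm : is_derive u (1 : R) (fun s => s * t) t.
      by apply: is_derive_eq; rewrite /GRing.scale/=; ring.
    by apply: is_derive_eq; rewrite /GRing.scale/=; ring.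
  by apply: is_derive_eq; rewrite /GRing.scale/=; ring.
have dF (u : R) : is_derive u (1 : R) F (- (u / (2 * a) * F u)).
  pose f (s t : R) := gauss1 a 0 t * cos (s * t).
  pose G (t : R) := (1 + 2 / a) * gauss1 (a / 2) 0 t.
  have C0 : 0 <= 1 + 2 / a by rewrite addr_ge0// divr_ge0// ltW.
  have uI : `](u - 1), (u + 1)[%classic u.
    by rewrite /= in_itv/= ltrBlDr ltrDl ltr01.
  have fi x : `](u - 1), (u + 1)[%classic x -> mu.-integrable setT (EFin \o f x).
    by move=> _; exact: integrable_gauss1_cos.
  have fd (x t : R) : `](u - 1), (u + 1)[%classic x -> setT t -> derivable (f^~ t) x 1.
    by move=> _ _; exact: ex_derive.
  have G0 t : 0 <= G t by rewrite mulr_ge0 ?gauss1_ge0.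
  have Gi : mu.-integrable setT (EFin \o G).
    by apply: integrableMl_EFin; exact: integrable_gauss1.
  have p1 (x t : R) : partial1of2 f x t = - (t * gauss1 a 0 t * sin (x * t)).
    by rewrite partial1of2E; apply: derive_val.
  have fG (x t : R) : `](u - 1), (u + 1)[%classic x -> setT t -> `|partial1of2 f x t| <= G t.
    move=> _ _; rewrite p1 normrN normrM -[leRHS]mulr1; apply: ler_pM => //.
    - exact: id_gauss1_bound.
    - exact: normr_sin_le1.
  have h1 := differentiation_under_integral measurableT uI fi fd G0 Gi fG.
  have h2 := derivable_under_integral measurableT uI fi fd G0 Gi fG.
  apply: DeriveDef => //.
  rewrite -derive1E h1.
  under eq_Rintegral do rewrite p1.
  rewrite -integral_id_gauss1_sin//.
  rewrite -[RHS]mulN1r -RintegralZl//; last exact: integrable_id_gauss1_sin.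
  by apply: eq_Rintegral => t _; rewrite mulN1r.
pose H s := F s * expR (s ^+ 2 / (4 * a)).
have dH (u : R) : is_derive u (1 : R) H 0.
  have he : is_derive u (1 : R) (fun s => expR (s ^+ 2 / (4 * a)))
      (u / (2 * a) * expR (u ^+ 2 / (4 * a))).
    have h : is_derive u (1 : R) (fun s : R => s ^+ 2 / (4 * a)) (u / (2 * a)).
      apply: is_derive_eq; rewrite /GRing.scale/= ; field; by rewrite gt_eqF.
    by apply: is_derive_eq; rewrite /GRing.scale/=; ring.
  by apply: is_derive_eq; rewrite /GRing.scale/=; ring.
have := is_derive_0_is_cst s 0 dH.
rewrite /H expr0n/= mul0r expR0 mulr1 => Hs.
rewrite expRN -[LHS](mulfK (x := expR (s ^+ 2 / (4 * a)))) ?gt_eqF ?expR_gt0//.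
congr (_ / _); rewrite -[LHS]/(F s * _) Hs /F.
rewrite /Rintegral; under eq_integral do rewrite mul0r cos0 mulr1.
by rewrite integral_gauss1.
Qed.

Lemma Rintegral_gauss1_sin0 a s : 0 < a ->
  \int[mu]_t (gauss1 a 0 t * sin (s * t)) = 0.
Proof.
move=> a0; have fi := integrable_gauss1_sin 0 s a0.
pose f t := (gauss1 a 0 t * sin (s * t))%:E.
have mN : measurable_fun setT (-%R : measurableTypeR R -> measurableTypeR R).
  exact: measurable_funN.
have fN t : f (- t) = (- f t)%E.
  by rewrite /f /gauss1 !subr0 sqrrN mulrN sinN mulrN EFinN.
have : (\int[mu]_t f t = \int[mu]_t f (- t)%R)%E.
  rewrite [LHS](eq_measure_integral
    (pushforward mu (-%R : measurableTypeR R -> measurableTypeR R))).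
  - rewrite (integral_pushforward mN)//; first exact: measurable_int fi.
    rewrite (_ : _ \o _ = fun t => - f t)%E; first exact: (integrableN fi).
    by apply/funext => t; rewrite -fN.
  - by move=> A mA _; apply/esym; exact: lebesgue_measureN.
under [RHS]eq_integral do rewrite fN.
rewrite integralN; last by apply: (integrable_add_def measurableT fi).
move=> h; have ifin : (\int[mu]_t f t)%E \is a fin_num by exact: integrable_fin_num.
have : fine (\int[mu]_t f t)%E = - fine (\int[mu]_t f t)%E.
  by rewrite {1}h fineN.
by rewrite -[\int[mu]_t _]/(fine (\int[mu]_t f t)%E); lra.
Qed.

Lemma Rintegral_gauss1_cos a c s : 0 < a ->
  \int[mu]_t (gauss1 a c t * cos (s * t)) =
  Num.sqrt (pi / a) * expR (- (s ^+ 2 / (4 * a))) * cos (s * c).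
Proof.
move=> a0.
rewrite /Rintegral -(integral_shift c (integrable_gauss1_cos c s a0)).
rewrite -[LHS]/(\int[mu]_t (gauss1 a c (t + c) * cos (s * (t + c)))).
have -> : (fun t => gauss1 a c (t + c) * cos (s * (t + c))) =
    (fun t => cos (s * c) * (gauss1 a 0 t * cos (s * t)) -
      sin (s * c) * (gauss1 a 0 t * sin (s * t))).
  by apply/funext => t; rewrite /gauss1 subr0 addrK mulrDr cosD; ring.
have i1 := integrable_gauss1_cos 0 s a0; have i2 := integrable_gauss1_sin 0 s a0.
rewrite RintegralB//; first last.
- exact: integrableMl_EFin.
- exact: integrableMl_EFin.
by rewrite !RintegralZl// Rintegral_gauss1_cos0// Rintegral_gauss1_sin0//; ring.
Qed.

Lemma Rintegral_gauss1_sin a c s : 0 < a ->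
  \int[mu]_t (gauss1 a c t * sin (s * t)) =
  Num.sqrt (pi / a) * expR (- (s ^+ 2 / (4 * a))) * sin (s * c).
Proof.
move=> a0.
rewrite /Rintegral -(integral_shift c (integrable_gauss1_sin c s a0)).
rewrite -[LHS]/(\int[mu]_t (gauss1 a c (t + c) * sin (s * (t + c)))).
have -> : (fun t => gauss1 a c (t + c) * sin (s * (t + c))) =
    (fun t => cos (s * c) * (gauss1 a 0 t * sin (s * t)) +
      sin (s * c) * (gauss1 a 0 t * cos (s * t))).
  by apply/funext => t; rewrite /gauss1 subr0 addrK mulrDr sinD; ring.
have i1 := integrable_gauss1_cos 0 s a0; have i2 := integrable_gauss1_sin 0 s a0.
rewrite RintegralD//; first last.
- exact: integrableMl_EFin.
- exact: integrableMl_EFin.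
by rewrite !RintegralZl// Rintegral_gauss1_cos0// Rintegral_gauss1_sin0//; ring.
Qed.

End gauss1_fourier.

(** * Euclidean structure and Gaussians on row vectors *)

Section dotp_theory.
Context {R : realType} {n : nat}.
Implicit Types x y z : 'rV[R]_n.

Lemma dotpC x y : dotp x y = dotp y x.
Proof. by apply: eq_bigr => i _; rewrite mulrC. Qed.

Lemma dotpDl x y z : dotp (x + y) z = dotp x z + dotp y z.
Proof. by rewrite -big_split; apply: eq_bigr => i _; rewrite mxE mulrDl. Qed.

Lemma dotpZl k x y : dotp (k *: x) y = k * dotp x y.
Proof. by rewrite /dotp mulr_sumr; apply: eq_bigr => i _; rewrite mxE mulrA. Qed.

Lemma dotpDr x y z : dotp z (x + y) = dotp z x + dotp z y.
Proof. by rewrite dotpC dotpDl !(dotpC z). Qed.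

Lemma dotpZr k x y : dotp x (k *: y) = k * dotp x y.
Proof. by rewrite dotpC dotpZl dotpC. Qed.

Lemma dotpNl x y : dotp (- x) y = - dotp x y.
Proof. by rewrite -scaleN1r dotpZl mulN1r. Qed.

Lemma dotpNr x y : dotp x (- y) = - dotp x y.
Proof. by rewrite dotpC dotpNl dotpC. Qed.

Lemma dotpBl x y z : dotp (x - y) z = dotp x z - dotp y z.
Proof. by rewrite dotpDl dotpNl. Qed.

Lemma dotpBr x y z : dotp z (x - y) = dotp z x - dotp z y.
Proof. by rewrite dotpDr dotpNr. Qed.

Lemma dotp0l x : dotp 0 x = 0.
Proof. by rewrite -(scale0r 0) dotpZl mul0r. Qed.

Lemma dotp0r x : dotp x 0 = 0. Proof. by rewrite dotpC dotp0l. Qed.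

Lemma dotp_ge0 x : 0 <= dotp x x.
Proof. by apply: sumr_ge0 => i _; rewrite -expr2 sqr_ge0. Qed.

Lemma dotp_delta i x : dotp (delta_mx 0 i) x = x 0 i.
Proof.
rewrite /dotp (bigD1 i)//= mxE !eqxx mul1r big1 ?addr0// => j ji.
by rewrite mxE eqxx/= (negbTE ji) mul0r.
Qed.

Lemma enorm_ge0 x : 0 <= enorm x. Proof. exact: sqrtr_ge0. Qed.

Lemma enorm2 x : enorm x ^+ 2 = dotp x x.
Proof. by rewrite sqr_sqrtr ?dotp_ge0. Qed.

Lemma enorm_coord x i : `|x 0 i| <= enorm x.
Proof.
rewrite -sqrtr_sqr ler_wsqrtr// /dotp (bigD1 i)//= -expr2 lerDl.
by apply: sumr_ge0 => j _; rewrite -expr2 sqr_ge0.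
Qed.

Lemma enorm_eq0 x : enorm x = 0 -> x = 0.
Proof.
move=> x0; apply/rowP => i; apply/eqP; rewrite mxE -normr_le0 -x0.
exact: enorm_coord.
Qed.

Lemma enorm0 : enorm (0 : 'rV[R]_n) = 0.
Proof. by rewrite /enorm dotp0l sqrtr0. Qed.

Lemma enormZ k x : enorm (k *: x) = `|k| * enorm x.
Proof. by rewrite /enorm dotpZl dotpZr mulrA -expr2 sqrtrM ?sqr_ge0// sqrtr_sqr. Qed.

Lemma enormN x : enorm (- x) = enorm x.
Proof. by rewrite -scaleN1r enormZ normrN1 mul1r. Qed.

Lemma CauchySchwarz_dotp x y : `|dotp x y| <= enorm x * enorm y.
Proof.
have [x0|x0] := eqVneq (enorm x) 0.
  by rewrite (enorm_eq0 x0) dotp0l normr0 enorm0 mul0r.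
have [y0|y0] := eqVneq (enorm y) 0.
  by rewrite (enorm_eq0 y0) dotp0r normr0 enorm0 mulr0.
have x1 : 0 < enorm x by rewrite lt_neqAle eq_sym x0 enorm_ge0.
have y1 : 0 < enorm y by rewrite lt_neqAle eq_sym y0 enorm_ge0.
have xy : 0 < 2 * (enorm x * enorm y) by rewrite !mulr_gt0.
(* Only s = 1 and s = -1 are used: the two scaled vectors have equal norm, and the nonnegative
   squared norms of their sum and difference give the two bounds. *)
have E s : dotp (enorm y *: x + s *: (enorm x *: y)) (enorm y *: x + s *: (enorm x *: y)) =
    enorm y ^+ 2 * enorm x ^+ 2 * (1 + s ^+ 2) + s * (2 * (enorm x * enorm y)) * dotp x y.
  rewrite !(dotpDl, dotpDr, dotpZl, dotpZr) (dotpC y x) -!enorm2; ring.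
rewrite ler_norml; apply/andP; split; rewrite -(ler_pM2l xy).
  by have := dotp_ge0 (enorm y *: x + 1 *: (enorm x *: y)); rewrite E expr1n; lra.
by have := dotp_ge0 (enorm y *: x + (-1) *: (enorm x *: y)); rewrite E sqrrN expr1n; lra.
Qed.

Lemma enormD x y : enorm (x + y) <= enorm x + enorm y.
Proof.
rewrite -ler_sqr ?nnegrE ?addr_ge0 ?enorm_ge0// enorm2 !(dotpDl, dotpDr) (dotpC y x).
rewrite sqrrD !enorm2; have := ler_norm (dotp x y); have := CauchySchwarz_dotp x y.
lra.
Qed.

Lemma continuous_dotp x : continuous (dotp x).
Proof.
apply: continuous_big => [|i _ z]; first exact: add_continuous.
by apply: (@continuousM _ _ (fun=> x 0 i) (fun z => z 0 i)) => ?; [exact: cst_continuous|exact: coord_continuous].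
Qed.

Lemma continuous_dotp_sub c : continuous (fun x => dotp (x - c) (x - c)).
Proof.
apply: continuous_big => [|i _]; first exact: add_continuous.
have h : continuous (fun x => (x - c) 0 i).
  under eq_fun do rewrite !mxE.
  move=> z; apply: (@continuousB _ _ _ (fun z => z 0 i) (fun=> c 0 i)); first exact: coord_continuous.
  exact: cst_continuous.
by move=> z; apply: (@continuousM _ _ (fun x => (x - c) 0 i) (fun x => (x - c) 0 i) z); exact: h.
Qed.

Lemma continuous_enorm_sub c : continuous (fun x => enorm (x - c)).
Proof.
move=> x; apply: (continuous_comp (f := fun x => dotp (x - c) (x - c))).
  exact: continuous_dotp_sub.
exact: sqrt_continuous.
Qed.

End dotp_theory.

Section rV_cons_theory.
Context {R : realType} {n : nat}.

Definition rtail (x : 'rV[R]_n.+1) : 'rV[R]_n := rsubmx (x : 'rV_(1 + n)).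

Lemma rtailE x i : rtail x 0 i = x 0 (lift ord0 i).
Proof. by rewrite mxE; congr (x _ _); exact/val_inj. Qed.

Lemma dotp_rVS (x y : 'rV[R]_n.+1) :
  dotp x y = x 0 ord0 * y 0 ord0 + dotp (rtail x) (rtail y).
Proof. by rewrite /dotp big_ord_recl; under [in RHS]eq_bigr do rewrite !rtailE. Qed.

Lemma rV_cons0 t (y : 'rV[R]_n) : rV_cons (t, y) 0 ord0 = t.
Proof. by have [] := rV_consK (t, y). Qed.

Lemma rtail_cons t (y : 'rV[R]_n) : rtail (rV_cons (t, y)) = y.
Proof. by have [] := rV_consK (t, y). Qed.

Lemma rtailB x y : rtail (x - y) = rtail x - rtail y.
Proof. by apply/rowP => i; rewrite !(rtailE, mxE). Qed.

End rV_cons_theory.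

Section gauss.
Context {R : realType}.
Local Notation mu := (@lebesgue_measure R).
Local Notation nu := (@lebesgue_rV R).

Definition gauss n (a : R) (c x : 'rV[R]_n) : R := expR (- (a * dotp (x - c) (x - c))).

Lemma gauss_ge0 n a (c x : 'rV[R]_n) : 0 <= gauss a c x. Proof. exact: expR_ge0. Qed.

Lemma gaussC n a (c x : 'rV[R]_n) : gauss a c x = gauss a x c.
Proof. by rewrite /gauss -[x - c]opprB dotpNl dotpNr opprK. Qed.

Lemma continuous_gauss n a (c : 'rV[R]_n) : continuous (gauss a c).
Proof.
rewrite (_ : gauss a c = (fun u => expR (- (a * u))) \o (fun x => dotp (x - c) (x - c)))//.
move=> x; apply: continuous_comp; first exact: continuous_dotp_sub.
apply: continuous_comp; last exact: continuous_expR.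
by apply: cvgN; apply: cvgM; [exact: cvg_cst|exact: cvg_id].
Qed.

Lemma measurable_gauss n a (c : 'rV[R]_n) : measurable_fun setT (gauss a c).
Proof. by apply: continuous_measurable_rV; exact: continuous_gauss. Qed.

Lemma gauss_rVS n a (c x : 'rV[R]_n.+1) :
  gauss a c x = gauss1 a (c 0 ord0) (x 0 ord0) * gauss a (rtail c) (rtail x).
Proof. by rewrite /gauss /gauss1 -expRD dotp_rVS rtailB !mxE; congr expR; ring. Qed.

Lemma gauss_cons n a (c : 'rV[R]_n.+1) t y :
  gauss a c (rV_cons (t, y)) = gauss1 a (c 0 ord0) t * gauss a (rtail c) y.
Proof. by rewrite gauss_rVS rV_cons0 rtail_cons. Qed.

Lemma integral_rV0 (f : 'rV[R]_0 -> \bar R) :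
  measurable_fun setT f -> (\int[nu 0%N]_x f x = f 0%R)%E.
Proof. by move=> mf; rewrite integral_dirac// diracT mul1e. Qed.

Lemma integral_gauss n a (c : 'rV[R]_n) : 0 < a ->
  (\int[nu n]_x (gauss a c x)%:E)%E = (Num.sqrt (pi / a) ^+ n)%:E.
Proof.
move=> a0; elim: n c => [c|n IH c].
  rewrite integral_rV0; last by apply/measurable_EFinP; exact: measurable_gauss.
  by rewrite /gauss /dotp big_ord0 mulr0 oppr0 expR0 expr0.
rewrite ge0_integral_rVS; first last.
- by move=> x; rewrite lee_fin gauss_ge0.
- by apply/measurable_EFinP; exact: measurable_gauss.
under eq_integral.
  move=> y _.
  under eq_integral do rewrite gauss_cons mulrC EFinM.
  rewrite ge0_integralZl//=; first last.
  - exact: gauss_ge0.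
  - by move=> t _; exact: gauss1_ge0.
  - by apply/measurable_EFinP; exact: measurable_gauss1.
  rewrite integral_gauss1// muleC.
  over.
rewrite ge0_integralZl//=; first last.
- by move=> t _; exact: gauss_ge0.
- by apply/measurable_EFinP; exact: measurable_gauss.
by rewrite IH exprS EFinM.
Qed.

Lemma integrable_gauss n a (c : 'rV[R]_n) : 0 < a ->
  (nu n).-integrable setT (EFin \o gauss a c).
Proof.
move=> a0; apply/integrableP; split.
  by apply/measurable_EFinP; exact: measurable_gauss.
under eq_integral do rewrite /= ger0_norm ?gauss_ge0//.
by rewrite integral_gauss// ltry.
Qed.

Lemma integrable_gauss_bound n a (c : 'rV[R]_n) C (f : 'rV[R]_n -> R) : 0 < a ->
  measurable_fun setT f -> (forall t, `|f t| <= C * gauss a c t) ->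
  (nu n).-integrable setT (EFin \o f).
Proof.
move=> a0 mf fC; apply: (@le_integrable _ _ _ (nu n) setT measurableT (EFin \o f)
    (EFin \o (fun t => C * gauss a c t))) => //.
- exact/measurable_EFinP.
- move=> t _; rewrite /= lee_fin; apply: le_trans (fC t) _; exact: ler_norm.
- by apply: integrableMl_EFin; exact: integrable_gauss.
Qed.

Lemma Rintegral_rVS n (f : 'rV[R]_n.+1 -> R) :
  (nu n.+1).-integrable setT (EFin \o f) ->
  (forall y, mu.-integrable setT (EFin \o (fun t => f (rV_cons (t, y))))) ->
  \int[nu n.+1]_x f x = \int[nu n]_y \int[mu]_t f (rV_cons (t, y)).
Proof.
move=> fi fyi; rewrite /Rintegral integral_rVS//; congr fine.
apply: eq_integral => y _; rewrite fineK//.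
exact: integrable_fin_num (fyi y).
Qed.

End gauss.

(** * Fourier transform of a modulated Gaussian *)

Section gauss_fourier.
Context {R : realType}.
Local Notation mu := (@lebesgue_measure R).
Local Notation nu := (@lebesgue_rV R).

Lemma measurable_cosT : measurable_fun setT (@cos R).
Proof. by apply: continuous_measurable_fun; exact: continuous_cos. Qed.

Lemma integrable_gauss1_cosD a c s th : 0 < a ->
  mu.-integrable setT (EFin \o (fun t => gauss1 a c t * cos (s * t + th))).
Proof.
move=> a0; apply: (@integrable_gauss1_bound _ a c 1 (fun t => gauss1 a c t * cos (s * t + th))) => //.
  apply: measurable_funM; first exact: measurable_gauss1.
  apply: (measurableT_comp measurable_cosT); apply: measurable_funD => //.
by move=> t; apply: gauss1M_bound; exact: normr_cos_le1.
Qed.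

Lemma Rintegral_gauss1_cosD a c s th : 0 < a ->
  \int[mu]_t (gauss1 a c t * cos (s * t + th)) =
  Num.sqrt (pi / a) * expR (- (s ^+ 2 / (4 * a))) * cos (s * c + th).
Proof.
move=> a0.
have -> : (fun t => gauss1 a c t * cos (s * t + th)) =
    (fun t => cos th * (gauss1 a c t * cos (s * t)) -
      sin th * (gauss1 a c t * sin (s * t))).
  by apply/funext => t; rewrite cosD; ring.
have i1 := integrable_gauss1_cos c s a0; have i2 := integrable_gauss1_sin c s a0.
rewrite RintegralB//; first last.
- exact: integrableMl_EFin.
- exact: integrableMl_EFin.
rewrite !RintegralZl// Rintegral_gauss1_cos// Rintegral_gauss1_sin// cosD; ring.
Qed.

Lemma measurable_dotp n (s : 'rV[R]_n) : measurable_fun setT (dotp s).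
Proof. by apply: continuous_measurable_rV; exact: continuous_dotp. Qed.

Lemma measurable_gauss_cosD n a (c s : 'rV[R]_n) th :
  measurable_fun setT (fun x => gauss a c x * cos (dotp s x + th)).
Proof.
apply: measurable_funM; first exact: measurable_gauss.
apply: (measurableT_comp measurable_cosT); apply: measurable_funD => //.
exact: measurable_dotp.
Qed.

Lemma integrable_gauss_cosD n a (c s : 'rV[R]_n) th : 0 < a ->
  (nu n).-integrable setT (EFin \o (fun x => gauss a c x * cos (dotp s x + th))).
Proof.
move=> a0; apply: (@integrable_gauss_bound _ n a c 1 (fun x => gauss a c x * cos (dotp s x + th))) => //.
  exact: measurable_gauss_cosD.
move=> x; rewrite normrM (ger0_norm (gauss_ge0 _ _ _)) mulrC.
by rewrite ler_wpM2r ?gauss_ge0 ?normr_cos_le1.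
Qed.

(* The phase [th] lets the induction treat the first coordinate and the remaining
   ones one after the other, and gives the sine transform as a special case. *)
Lemma Rintegral_gauss_cosD n a (c s : 'rV[R]_n) th : 0 < a ->
  \int[nu n]_x (gauss a c x * cos (dotp s x + th)) =
  Num.sqrt (pi / a) ^+ n * gauss (4 * a)^-1 0 s * cos (dotp s c + th).
Proof.
move=> a0; elim: n c s th => [c s th|n IH c s th].
  rewrite /Rintegral integral_rV0/=; last first.
    by apply/measurable_EFinP; exact: measurable_gauss_cosD.
  by rewrite /gauss /dotp !big_ord0 !mulr0 !oppr0 !expR0 expr0 !mul1r.
have E y t : gauss a c (rV_cons (t, y)) * cos (dotp s (rV_cons (t, y)) + th) =
    gauss a (rtail c) y * (gauss1 a (c 0 ord0) t *
      cos (s 0 ord0 * t + (dotp (rtail s) y + th))).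
  by rewrite gauss_cons dotp_rVS rV_cons0 rtail_cons addrA; ring.
rewrite Rintegral_rVS; first last.
- move=> y; rewrite (_ : (fun t => _) = fun t => gauss a (rtail c) y * (gauss1 a (c 0 ord0) t *
      cos (s 0 ord0 * t + (dotp (rtail s) y + th)))); last by apply/funext => t.
  by apply: integrableMl_EFin; exact: integrable_gauss1_cosD.
- exact: integrable_gauss_cosD.
pose k := Num.sqrt (pi / a) * expR (- (s 0 ord0 ^+ 2 / (4 * a))).
transitivity (\int[nu n]_y (k * (gauss a (rtail c) y *
    cos (dotp (rtail s) y + (s 0 ord0 * c 0 ord0 + th))))).
  apply: eq_Rintegral => y _; under eq_Rintegral do rewrite E.
  rewrite RintegralZl//; last exact: integrable_gauss1_cosD.
  rewrite Rintegral_gauss1_cosD// /k.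
  rewrite [X in cos X](_ : _ = dotp (rtail s) y + (s 0 ord0 * c 0 ord0 + th)); first by ring.
  by ring.
rewrite RintegralZl//; last exact: integrable_gauss_cosD.
rewrite IH /k (exprS _ n) gauss_rVS /gauss1 dotp_rVS.
rewrite [in X in _ * (X * _) * _](_ : expR _ = expR (- (s 0 ord0 ^+ 2 / (4 * a)))); last first.
  by rewrite mxE subr0; congr expR; field; rewrite gt_eqF.
have -> : rtail (0 : 'rV[R]_n.+1) = 0 by apply/rowP => i; rewrite rtailE !mxE.
rewrite [X in cos X](_ : _ = s 0 ord0 * c 0 ord0 + dotp (rtail s) (rtail c) + th).
  by ring.
by ring.
Qed.

(** The wave packet e^(i (c, eta)) times a Gaussian around the frequency [xi]. Its transform is, up
    to a constant, a Gaussian centred at [c] oscillating with frequency [xi], so testing with it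
    localizes at [c] in space and at [xi] in frequency. *)
Definition gauss_wave n (a : R) (xi c eta : 'rV[R]_n) : R[i] :=
  (gauss a xi eta * cos (dotp c eta)) +i* (gauss a xi eta * sin (dotp c eta)).

Lemma fourier_gauss_wave n a (xi c x : 'rV[R]_n) : 0 < a ->
  fourier (gauss_wave a xi c) x =
  (Num.sqrt (pi / a) ^+ n * gauss (4 * a)^-1 c x * cos (dotp xi (c - x))) +i*
  (Num.sqrt (pi / a) ^+ n * gauss (4 * a)^-1 c x * sin (dotp xi (c - x))).
Proof.
move=> a0; rewrite /fourier /cintegral.
have sc (u : R) : sin u = cos (u + - (pi / 2)).
  by rewrite cosD cosN sinN cos_pihalf sin_pihalf; ring.
congr (_ +i* _).
  transitivity (\int[nu n]_t (gauss a xi t * cos (dotp (c - x) t + 0))).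
    by apply: eq_Rintegral => t _ /=; rewrite addr0 dotpBl cosB; ring.
  rewrite Rintegral_gauss_cosD// addr0 [gauss _ c x]/gauss -[x - c]opprB dotpNl dotpNr opprK.
  by rewrite /gauss subr0 (dotpC _ xi).
transitivity (\int[nu n]_t (gauss a xi t * cos (dotp (c - x) t + - (pi / 2)))).
  by apply: eq_Rintegral => t _ /=; rewrite -sc dotpBl sinB; ring.
rewrite Rintegral_gauss_cosD// [gauss _ c x]/gauss -[x - c]opprB dotpNl dotpNr opprK.
by rewrite -sc /gauss subr0 (dotpC _ xi).
Qed.

End gauss_fourier.

(** * Wave packets are Schwartz functions *)

Section schwartz_gauss_wave.
Context {R : realType} {n : nat}.
Local Notation E := ('rV[R]_n).

Lemma differentiable_comp_real (f : E -> R) (g : R -> R) g' x :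
  differentiable f x -> is_derive (f x) (1 : R) g g' ->
  differentiable (g \o f) x /\ forall v, 'D_v (g \o f) x = g' * 'D_v f x.
Proof.
move=> df dg; have g1 : derivable g (f x) 1 by exact: ex_derive.
have dg' : differentiable g (f x) by exact/derivable1_diffP.
have dgf : differentiable (g \o f) x by exact: differentiable_comp.
split => // v; rewrite !deriveE// diff_comp//= deriv1E//.
by rewrite derive1E derive_val /GRing.scale/= mulrC.
Qed.

Lemma derive_coord (i : 'I_n) (x v : E) : 'D_v (fun y : E => y 0 i) x = v 0 i.
Proof.
apply: cvg_lim => //; apply: cvg_near_cst; near=> h.
have h0 : h != 0 by near: h; exact: nbhs_dnbhs_neq.
by rewrite /= !mxE addrK /GRing.scale/= mulKf.
Unshelve. all: by end_near. Qed.

(** A syntactic class that contains all factors multiplying the Gaussian in the iterated partials of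
    a wave packet. It is stable under partial derivatives and its members grow polynomially, both by
    induction on the construction. *)
Inductive tempered_fun : (E -> R) -> Prop :=
| tempered_cst k : tempered_fun (fun=> k)
| tempered_coord i : tempered_fun (fun x => x 0 i)
| temperedD f g : tempered_fun f -> tempered_fun g -> tempered_fun (f + g)
| temperedM f g : tempered_fun f -> tempered_fun g -> tempered_fun (f * g)
| tempered_cos f : tempered_fun f -> tempered_fun (cos \o f)
| tempered_sin f : tempered_fun f -> tempered_fun (sin \o f).

Lemma tempered_derive f : tempered_fun f ->
  (forall x, differentiable f x) /\
  forall i, exists g, tempered_fun g /\ forall x, 'D_(delta_mx 0 i) f x = g x.
Proof.
elim=> [k|i|{}f g _ [df Df] _ [dg Dg]|{}f g tf [df Df] tg [dg Dg]|{}f tf [df Df]|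
    {}f tf [df Df]].
- split=> [x|i]; first exact: differentiable_cst.
  by exists (fun=> 0); split=> [|x]; [exact: tempered_cst|rewrite derive_cst].
- split=> [x|j]; first exact: differentiable_coord.
  exists (fun=> (delta_mx 0 j : E) 0 i); split=> [|x]; first exact: tempered_cst.
  exact: derive_coord.
- split=> [x|i]; first exact: differentiableD.
  have [f' [tf' f'E]] := Df i; have [g' [tg' g'E]] := Dg i.
  exists (f' + g'); split=> [|x]; first exact: temperedD.
  by rewrite deriveD ?f'E ?g'E//; exact: diff_derivable.
- split=> [x|i]; first exact: differentiableM.
  have [f' [tf' f'E]] := Df i; have [g' [tg' g'E]] := Dg i.
  exists (f * g' + g * f'); split=> [|x].
    by apply: temperedD; exact: temperedM.
  by rewrite deriveM ?f'E ?g'E//; exact: diff_derivable.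
- split=> [x|i]; first by have [] := differentiable_comp_real (df x) (is_derive_cos (f x)).
  have [f' [tf' f'E]] := Df i.
  exists (cst (-1) * (sin \o f) * f'); split=> [|x].
    apply: temperedM => //; apply: temperedM; first exact: tempered_cst.
    exact: tempered_sin.
  have [_ ->] := differentiable_comp_real (df x) (is_derive_cos (f x)).
  by rewrite f'E /GRing.mul/= mulN1r.
- split=> [x|i]; first by have [] := differentiable_comp_real (df x) (is_derive_sin (f x)).
  have [f' [tf' f'E]] := Df i.
  exists ((cos \o f) * f'); split=> [|x].
    by apply: temperedM => //; exact: tempered_cos.
  have [_ ->] := differentiable_comp_real (df x) (is_derive_sin (f x)).
  by rewrite f'E.
Qed.

Lemma tempered_growth f : tempered_fun f ->
  exists C N, 0 <= C /\ forall x, `|f x| <= C * (1 + enorm x) ^+ N.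
Proof.
have e1 (x : E) : 1 <= 1 + enorm x by rewrite lerDl enorm_ge0.
have eX N M (x : E) : (1 + enorm x) ^+ N <= (1 + enorm x) ^+ (N + M).
  by rewrite exprD ler_peMr ?exprn_ege1// exprn_ge0// (le_trans ler01).
elim=> [k|i|{}f g _ [C [N [C0 fC]]] _ [D [M [D0 gD]]]|
  {}f g _ [C [N [C0 fC]]] _ [D [M [D0 gD]]]|{}f _ _|{}f _ _].
- by exists `|k|, 0%N; split=> // x; rewrite expr0 mulr1.
- exists 1, 1%N; split=> // x; rewrite mul1r expr1.
  by apply: le_trans (enorm_coord _ _) _; rewrite lerDr.
- exists (C + D), (N + M)%N; split=> [|x]; first exact: addr_ge0.
  apply: le_trans (ler_normD _ _) _; rewrite mulrDl; apply: lerD.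
    by apply: le_trans (fC x) _; rewrite ler_wpM2l.
  by apply: le_trans (gD x) _; rewrite ler_wpM2l// addnC.
- exists (C * D), (N + M)%N; split=> [|x]; first exact: mulr_ge0.
  by rewrite [leLHS]normrM exprD mulrACA; apply: ler_pM.
- exists 1, 0%N; split=> // x; rewrite expr0 mulr1; exact: normr_cos_le1.
- exists 1, 0%N; split=> // x; rewrite expr0 mulr1; exact: normr_sin_le1.
Qed.

Lemma tempered_sum (F : 'I_n -> E -> R) : (forall i, tempered_fun (F i)) ->
  tempered_fun (fun x => \sum_i F i x).
Proof.
move=> tF; rewrite (_ : (fun x => _) = \sum_i F i); last first.
  by apply/funext => x; rewrite fct_sumE.
elim/big_ind : _ => //; first exact: tempered_cst.
exact: temperedD.
Qed.

Lemma tempered_dotp (c : E) : tempered_fun (dotp c).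
Proof.
apply: tempered_sum => i; apply: (@temperedM (fun=> c 0 i) (fun x => x 0 i)).
  exact: tempered_cst.
exact: tempered_coord.
Qed.

Lemma tempered_gauss_exponent a (c : E) :
  tempered_fun (fun x => - (a * dotp (x - c) (x - c))).
Proof.
rewrite (_ : (fun x => _) = cst (- a) * (fun x => dotp (x - c) (x - c))); last first.
  by apply/funext => x; rewrite -mulNr.
apply: temperedM; first exact: tempered_cst.
have h i : tempered_fun (fun x : E => (x - c) 0 i).
  rewrite (_ : (fun x => _) = (fun x : E => x 0 i) + cst (- c 0 i)); last first.
    by apply/funext => x; rewrite !mxE.
  by apply: temperedD; [exact: tempered_coord|exact: tempered_cst].
by apply: tempered_sum => i; exact: (temperedM (h i) (h i)).
Qed.

(** Differentiating g e^q gives (g q' + g') e^q, so the Gaussian survives and only the tempered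
    factor changes. *)
Lemma tempered_gauss_partials a (c : E) h (s : seq 'I_n) : tempered_fun h ->
  exists g, tempered_fun g /\ partials s (h * gauss a c) = g * gauss a c.
Proof.
move=> th; elim: s => [|i s [g [tg IH]]]; first by exists h.
pose q x := - (a * dotp (x - c) (x - c)).
have tq : tempered_fun q by exact: tempered_gauss_exponent.
have [dq Dq] := tempered_derive tq; have [q' [tq' q'E]] := Dq i.
have [dg Dg] := tempered_derive tg; have [g' [tg' g'E]] := Dg i.
exists (g * q' + g'); split; first by apply: temperedD => //; exact: temperedM.
rewrite /= IH; apply/funext => x.
have [dG DG] := differentiable_comp_real (dq x) (is_derive_expR (q x)).
rewrite -[gauss a c]/(expR \o q) deriveM; [|exact: diff_derivable..].
rewrite DG q'E g'E /GRing.scale/= -[RHS]/((g x * q' x + g' x) * expR (q x)).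
by ring.
Qed.

Lemma differentiable_tempered_gauss a (c : E) h x : tempered_fun h ->
  differentiable (h * gauss a c) x.
Proof.
move=> th; have [dh _] := tempered_derive th.
have [dq _] := tempered_derive (tempered_gauss_exponent a c).
apply: differentiableM => //.
by have [] := differentiable_comp_real (dq x) (is_derive_expR (- (a * dotp (x - c) (x - c)))).
Qed.

Lemma gauss_decay a (c : E) N : 0 < a ->
  exists C, 0 <= C /\ forall x, (1 + enorm x) ^+ N * gauss a c x <= C.
Proof.
move=> a0.
have [->|N0] := eqVneq N 0%N.
  exists 1; split=> // x; rewrite expr0 mul1r -expR0 ler_expR oppr_le0.
  by rewrite mulr_ge0 ?dotp_ge0// ltW.
have Nr : 0 < N%:R :> R by rewrite ltr0n lt0n.
(* (1 + |x|) <= A + (a/N)|x - c|^2 <= A e^{(a/(NA))|x-c|^2} with A >= 1 *)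
pose A := 2 + enorm c + N%:R / a.
have A1 : 1 <= A.
  rewrite /A; have := enorm_ge0 c; have : 0 <= N%:R / a by rewrite divr_ge0// ltW.
  lra.
have A0 : 0 < A by exact: lt_le_trans A1.
exists (A ^+ N); split=> [|x]; first by rewrite exprn_ge0// ltW.
have key : 1 + enorm x <= A * expR (a * dotp (x - c) (x - c) / N%:R).
  apply: (@le_trans _ _ (A * (1 + a * dotp (x - c) (x - c) / N%:R))); last first.
    by rewrite ler_pM2l// expR_ge1Dx.
  set u := enorm (x - c).
  have xu : enorm x <= u + enorm c.
    by rewrite -[in leLHS](subrK c x); exact: enormD.
  have u0 : 0 <= u by exact: enorm_ge0.
  rewrite -enorm2 -/u.
  have -> : A * (1 + a * u ^+ 2 / N%:R) =
      A + (2 + enorm c) * (a * u ^+ 2 / N%:R) + u ^+ 2.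
    by rewrite /A; field; rewrite !gt_eqF.
  have p1 : 0 <= (2 + enorm c) * (a * u ^+ 2 / N%:R).
    rewrite mulr_ge0 ?addr_ge0 ?enorm_ge0// mulr_ge0 ?invr_ge0 ?ler0n//.
    by rewrite mulr_ge0 ?sqr_ge0// ltW.
  have p2 : 0 <= N%:R / a by rewrite divr_ge0// ltW.
  have p3 := sqr_ge0 (u - 1).
  rewrite sqrrB expr1n mulr1 in p3.
  by rewrite /A; nra.
rewrite /gauss expRN ler_pdivrMr ?expR_gt0//.
have -> : expR (a * dotp (x - c) (x - c)) = expR (a * dotp (x - c) (x - c) / N%:R) ^+ N.
  by rewrite -expRM_natl; congr expR; field; rewrite gt_eqF.
rewrite -exprMn; apply: lerXn2r => //; rewrite nnegrE.
  by rewrite addr_ge0 ?enorm_ge0.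
by rewrite mulr_ge0 ?expR_ge0// ltW.
Qed.

Lemma tempered_gauss_decay a (c : E) h N : 0 < a -> tempered_fun h ->
  exists C, 0 <= C /\ forall x, (1 + enorm x) ^+ N * `|(h * gauss a c) x| <= C.
Proof.
move=> a0 /tempered_growth[C [M [C0 hC]]].
have [D [D0 gD]] := gauss_decay c (N + M) a0.
exists (C * D); split=> [|x]; first exact: mulr_ge0.
rewrite [X in _ * X]normrM (ger0_norm (gauss_ge0 _ _ _)).
have e0 : 0 <= (1 + enorm x) ^+ N by rewrite exprn_ge0// addr_ge0 ?enorm_ge0.
apply: (@le_trans _ _ (C * ((1 + enorm x) ^+ (N + M) * gauss a c x))); last first.
  by rewrite ler_wpM2l.
rewrite exprD mulrA (mulrA C) [leRHS](_ : _ =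
  (1 + enorm x) ^+ N * (C * (1 + enorm x) ^+ M) * gauss a c x); last by ring.
by rewrite ler_wpM2r ?gauss_ge0// ler_wpM2l.
Qed.

Lemma normc_le (u v : R) : ComplexField.Normc.normc (u +i* v) <= `|u| + `|v|.
Proof.
rewrite /= -ler_sqr ?nnegrE ?sqrtr_ge0 ?addr_ge0// sqr_sqrtr ?addr_ge0 ?sqr_ge0//.
by rewrite sqrrD !real_normK ?num_real// -addrA lerD2l lerDr mulrn_wge0 ?mulr_ge0.
Qed.

Lemma schwartz_gauss_wave a (xi c : E) : 0 < a -> schwartz (gauss_wave a xi c).
Proof.
move=> a0.
have ReE : @complex.Re R \o gauss_wave a xi c = (cos \o dotp c) * gauss a xi.
  by apply/funext => x; rewrite /= mulrC.
have ImE : @complex.Im R \o gauss_wave a xi c = (sin \o dotp c) * gauss a xi.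
  by apply/funext => x; rewrite /= mulrC.
have tc := tempered_cos (tempered_dotp c); have ts := tempered_sin (tempered_dotp c).
split=> [s x|s N].
  rewrite ReE ImE.
  have [g [tg ->]] := tempered_gauss_partials a xi s tc.
  have [h [th ->]] := tempered_gauss_partials a xi s ts.
  by split; exact: differentiable_tempered_gauss.
have [g [tg gE]] := tempered_gauss_partials a xi s tc.
have [h [th hE]] := tempered_gauss_partials a xi s ts.
have [C [C0 gC]] := tempered_gauss_decay xi N a0 tg.
have [D [D0 hD]] := tempered_gauss_decay xi N a0 th.
exists (C + D) => x; rewrite /cpartials ReE ImE gE hE.
have e0 : 0 <= (1 + enorm x) ^+ N by rewrite exprn_ge0// addr_ge0 ?enorm_ge0.
apply: le_trans (ler_wpM2l e0 (normc_le _ _)) _.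
by rewrite mulrDr lerD.
Qed.

End schwartz_gauss_wave.

(** * Differentiability and local graphs of the boundary *)

Lemma is_derive_line (R : realType) (W V : normedModType R) (f : V -> W) (v w : V) (h : R) :
  derivable f (h *: v + w) v ->
  is_derive h (1 : R) (fun t : R => f (t *: v + w)) ('D_v f (h *: v + w)).
Proof.
have E : (fun k : R => k^-1 *: (((fun t : R => f (t *: v + w)) \o shift h) (k *: (1 : R)) -
      f (h *: v + w))) =
    (fun k => k^-1 *: ((f \o shift (h *: v + w)) (k *: v) - f (h *: v + w))).
  apply/funext => k; congr (_ *: (f _ - _)) => /=.
  by rewrite addrA -scalerDl [k *: 1]mulr1.
by move=> df; apply: DeriveDef; [rewrite /derivable E|rewrite /derive E].
Qed.

(** A mean value theorem insensitive to the sign of [d], since coordinate increments come with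
    either sign. *)
Lemma MVT_from0 (R : realType) (g dg : R -> R) (d : R) :
  (forall h, `|h| <= `|d| -> is_derive h (1 : R) g (dg h)) ->
  exists2 c, `|c| <= `|d| & g d - g 0 = dg c * d.
Proof.
move=> gd.
have gc (a b : R) : (forall h, h \in `[a, b] -> `|h| <= `|d|) ->
    {within `[a, b], continuous g}.
  move=> ab; apply: derivable_within_continuous => h hab.
  by have := gd h (ab h hab) => ?; exact: ex_derive.
have [d0|d0] := leP 0 d.
  have D h : h \in `[0, d] -> `|h| <= `|d|.
    by rewrite in_itv/= => /andP[h0 hd]; rewrite !ger0_norm.
  have [|c cd ->] := @MVT_segment R g dg 0 d d0 _ (gc 0 d D).
    by move=> x xd; apply/gd/D; exact: subset_itv_oo_cc.
  by exists c; [exact: D|rewrite subr0].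
have D h : h \in `[d, 0] -> `|h| <= `|d|.
  by rewrite in_itv/= => /andP[h0 hd]; rewrite !ler0_norm ?lerN2// ltW.
have [|c cd E] := @MVT_segment R g dg d 0 (ltW d0) _ (gc d 0 D).
  by move=> x xd; apply/gd/D; exact: subset_itv_oo_cc.
exists c; first exact: D.
by rewrite -opprB E sub0r mulrN opprK.
Qed.

(* Only continuity of the partial derivatives is available, hence the telescoping
   along the coordinates. *)
Lemma C1_on_frechet (R : realType) m (V : set 'rV[R]_m) (f : 'rV[R]_m -> R) z (e : R) :
  open V -> C1_on V f -> V z -> 0 < e ->
  exists2 d, 0 < d & forall y, enorm (y - z) < d ->
    `|f y - f z - \sum_k 'D_(delta_mx 0 k) f z * (y - z) 0 k| <= e * enorm (y - z).
Proof.
move=> oV fV Vz e0.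
(* There are [m] telescoping steps; dividing by [m.+1] also covers m = 0. *)
pose e' := e / m.+1%:R.
have e'0 : 0 < e' by rewrite divr_gt0.
have [r r0 rP] : exists2 r, 0 < r & forall x : 'rV[R]_m, (forall i, `|x 0 i - z 0 i| < r) ->
    V x /\ forall k, `|'D_(delta_mx 0 k : 'rV[R]_m) f x - 'D_(delta_mx 0 k : 'rV[R]_m) f z| <= e'.
  have : \forall x \near z, V x /\ forall k, `|'D_(delta_mx 0 k : 'rV[R]_m) f x - 'D_(delta_mx 0 k : 'rV[R]_m) f z| <= e'.
    have h1 : \near z, V z by apply: open_nbhs_nbhs.
    suff h2 : \forall x \near z, forall k, `|'D_(delta_mx 0 k : 'rV[R]_m) f x - 'D_(delta_mx 0 k : 'rV[R]_m) f z| <= e'.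
      by near=> x; split; near: x.
    apply: (filter_forall (nbhs_filter z)) => k.
    have [_ /cvgrPdist_le/(_ _ e'0)] := fV k z Vz.
    by apply: filterS => x; rewrite distrC.
  case/nbhs_ballP => r r0 rP; exists r => // x xr; apply: rP.
  by split=> // i j; rewrite (ord1 i) -ball_normE /= distrC.
exists r => // y yr.
have yri i : `|y 0 i - z 0 i| < r.
  by apply: le_lt_trans yr; have := enorm_coord (y - z) i; rewrite !mxE.
(* A path from [z] to [y] that changes one coordinate at a time. *)
pose w (k : nat) : 'rV[R]_m := \row_i (if (i < k)%N then y 0 i else z 0 i).
have w0 : w 0%N = z by apply/rowP => i; rewrite mxE.
have wm : w m = y by apply/rowP => i; rewrite mxE ltn_ord.
have wS (k : 'I_m) : w k.+1 = (y 0 k - z 0 k) *: delta_mx 0 k + w k.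
  apply/rowP => i; rewrite !mxE eqxx/=; have [->|ik] := eqVneq i k.
    by rewrite ltnSn ltnn mulr1 subrK.
  by rewrite mulr0 add0r ltnS leq_eqVlt (negbTE (ik : val i != val k)).
have wr (k : 'I_m) c : `|c| <= `|y 0 k - z 0 k| ->
    forall i, `|(c *: delta_mx 0 k + w k) 0 i - z 0 i| < r.
  move=> cd i; rewrite !mxE eqxx/=; have [->|ik] := eqVneq i k.
    by rewrite ltnn mulr1 addrK; exact: le_lt_trans (yri k).
  by rewrite mulr0 add0r; case: ifP => // _; rewrite subrr normr0.
have step (k : 'I_m) : `|f (w k.+1) - f (w k) - 'D_(delta_mx 0 k) f z * (y - z) 0 k| <=
    e' * enorm (y - z).
  have [|c cd E] := @MVT_from0 R (fun t => f (t *: delta_mx 0 k + w k))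
      (fun t => 'D_(delta_mx 0 k) f (t *: delta_mx 0 k + w k)) (y 0 k - z 0 k).
    move=> h hd; apply: is_derive_line.
    by have [Vh _] := rP _ (wr k h hd); have [] := fV k _ Vh.
  rewrite scale0r add0r -wS in E; rewrite E !mxE -mulrBl normrM.
  apply: ler_pM => //; first by have [_] := rP _ (wr k c cd); exact.
  by have := enorm_coord (y - z) k; rewrite !mxE.
have -> : f y - f z = \sum_(k < m) (f (w k.+1) - f (w k)).
  by rewrite -(big_mkord xpredT (fun k => f (w k.+1) - f (w k))) telescope_sumr// wm w0.
rewrite -sumrB; apply: le_trans (ler_norm_sum _ _ _) _.
apply: le_trans (ler_sum _ (fun k _ => step k)) _.
rewrite sumr_const card_ord -mulr_natr mulrAC ler_wpM2r ?enorm_ge0//.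
rewrite /e' -mulrA; apply: ler_piMr; first exact: ltW.
by rewrite ler_pdivrMl ?ltr0n// mulr1 ler_nat.
Unshelve. all: by end_near. Qed.

Section orthogonal_coordinates.
Context {R : realType} {m : nat}.
Implicit Types x y w : 'rV[R]_m.+1.

Definition emb (j : 'I_m.+1) (z : 'rV[R]_m) : 'rV[R]_m.+1 :=
  \row_k (if unlift j k is Some k' then z 0 k' else 0).

Lemma emb_lift j z k : emb j z 0 (lift j k) = z 0 k.
Proof. by rewrite mxE liftK. Qed.

Lemma emb_id j z : emb j z 0 j = 0.
Proof. by rewrite mxE unlift_none. Qed.

Lemma col'_emb (j : 'I_m.+1) s z : col' j (s *: delta_mx 0 j + emb j z) = z.
Proof.
apply/rowP => k; rewrite [LHS]mxE [LHS]mxE [X in X + _]mxE mxE emb_lift.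
by rewrite eqxx/= eq_sym (negbTE (neq_lift j k)) mulr0 add0r.
Qed.

Lemma coord_emb (j : 'I_m.+1) s z : (s *: delta_mx 0 j + emb j z) 0 j = s.
Proof. by rewrite [LHS]mxE emb_id !mxE !eqxx mulr1 addr0. Qed.

Lemma emb_coord (j : 'I_m.+1) w : w 0 j *: delta_mx 0 j + emb j (col' j w) = w.
Proof.
apply/rowP => k; rewrite [LHS]mxE [X in X + _]mxE [delta_mx _ _ _ _]mxE eqxx/=.
case: (unliftP j k) => [k' ->|->].
  by rewrite eq_sym (negbTE (neq_lift j k')) mulr0 add0r emb_lift mxE.
by rewrite eqxx mulr1 emb_id addr0.
Qed.

Lemma emb_line (j : 'I_m.+1) t (u v : 'rV[R]_m) : emb j (t *: u + v) = t *: emb j u + emb j v.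
Proof.
apply/rowP => k; rewrite !mxE.
by case: (unlift j k) => [k'|]; rewrite ?mxE// mulr0 addr0.
Qed.

Lemma dotp_coord (j : 'I_m.+1) x y :
  dotp x y = x 0 j * y 0 j + dotp (col' j x) (col' j y).
Proof.
rewrite /dotp (bigD1_ord j)//=; congr (_ + _).
by apply: eq_bigr => k _; rewrite !mxE.
Qed.

Lemma dotp_mulmx (Q : 'M[R]_m.+1) x y :
  Q^T *m Q = 1%:M -> dotp (x *m Q) (y *m Q) = dotp x y.
Proof.
have dE (u v : 'rV[R]_m.+1) : dotp u v = (u *m v^T) 0 0.
  by rewrite mxE; apply: eq_bigr => i _; rewrite mxE.
move=> /mulmx1C QQ; rewrite !dE trmx_mul mulmxA -(mulmxA x) QQ.
by rewrite mulmx1.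
Qed.

Lemma enorm_mulmx (Q : 'M[R]_m.+1) x :
  Q^T *m Q = 1%:M -> enorm (x *m Q) = enorm x.
Proof. by move=> QQ; rewrite /enorm dotp_mulmx. Qed.

Lemma enorm_col' (j : 'I_m.+1) x : enorm (col' j x) <= enorm x.
Proof.
rewrite ler_wsqrtr// (dotp_coord j x x) lerDr -expr2; exact: sqr_ge0.
Qed.

End orthogonal_coordinates.

Section boundary_geometry.
Context {R : realType} {m : nat}.
Variable D : set 'rV[R]_m.+1.
Hypothesis oD : open D.
Hypothesis bD : C1_boundary D.
Implicit Types x y w v : 'rV[R]_m.+1.

Lemma boundaryP y : boundary D y <-> closure D y /\ ~ D y.
Proof. by have /interior_id iD := oD; rewrite /boundary iD. Qed.

(** Connectedness of the segment: its trace on [D] is relatively open, and relatively closed because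
    a limit of points of [D] outside [D] would be a boundary point. *)
Lemma segment_in_domain (a b : 'rV[R]_m.+1) : D a ->
  (forall t : R, 0 <= t <= 1 -> ~ boundary D (a + t *: (b - a))) -> D b.
Proof.
move=> Da nb.
pose S := [set a + t *: (b - a) | t in `[(0 : R), 1]%classic].
have cS : connected S.
  apply: connected_continuous_connected; first exact: segment_connected.
  apply: continuous_subspaceT => t.
  apply: cvgD; first exact: cvg_cst.
  by apply: cvgZl; exact: cvg_id.
have Sa : S a by exists 0; rewrite ?scale0r ?addr0//= in_itv/= lexx ler01.
have Sb : S b by exists 1; rewrite ?scale1r 1?addrC ?subrK//= in_itv/= lexx ler01.
suff /seteqP[_ /(_ b Sb) []//] : S `&` D = S.
apply: cS; first by exists a.
- by exists D.
- exists (closure D); first exact: closed_closure.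
  apply/seteqP; split=> x [Sx Dx]; split => //; first exact: subset_closure.
  apply: contrapT => nDx; case: Sx => t /= t01 tx.
  by apply: (nb t); rewrite ?tx; [move: t01; rewrite in_itv|apply/boundaryP].
Qed.

End boundary_geometry.

Lemma nbhs_enorm (R : realType) n (y : 'rV[R]_n) U : nbhs y U ->
  exists2 d, 0 < d & forall x, enorm (x - y) < d -> U x.
Proof.
move=> /nbhs_ballP[r r0 rU]; exists r => // x xr; apply: rU.
split=> // i k; rewrite (ord1 i) -ball_normE /= distrC; apply: le_lt_trans xr.
by have := enorm_coord (x - y) k; rewrite !mxE.
Qed.

Lemma is_derive_rV (R : realType) n (M : R -> 'rV[R]_n) (t : R) (w : 'rV[R]_n) :
  (forall i, is_derive t (1 : R) (fun s => M s 0 i) (w 0 i)) ->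
  is_derive t (1 : R) M w.
Proof.
move=> Mw.
have dM : derivable M t 1.
  by apply/derivable_mxP => i k; rewrite (ord1 i); have := Mw k => ?; exact: ex_derive.
apply: DeriveDef => //; rewrite derive_mx//; apply/rowP => k; rewrite mxE.
by have := Mw k => ?; rewrite derive_val.
Qed.

Section graph_coordinates.
Context {R : realType} {m : nat}.
Variables (D : set 'rV[R]_m.+1) (y : 'rV[R]_m.+1).
Variables (U : set 'rV[R]_m.+1) (Q : 'M[R]_m.+1) (j : 'I_m.+1).
Variables (V : set 'rV[R]_m) (f : 'rV[R]_m -> R).
Hypothesis Dy : boundary D y.
Hypothesis yU : open_nbhs y U.
Hypothesis QQ : Q^T *m Q = 1%:M.
Hypothesis oV : open V.
Hypothesis fV : C1_on V f.
Hypothesis graphE : boundary D `&` U =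
  [set y | V (col' j (y *m Q)) /\ (y *m Q) 0 j = f (col' j (y *m Q))].

Let z := col' j (y *m Q).

Definition graph_slope (k : 'I_m) : R := 'D_(delta_mx 0 k : 'rV[R]_m) f z.

Lemma graph_base : V z /\ (y *m Q) 0 j = f z.
Proof.
have : (boundary D `&` U) y by split => //; have [_] := yU.
by rewrite graphE.
Qed.

(** Velocity of the boundary curve that moves the [k]-th graph parameter alone. These m vectors are
    all that is needed to pin down a normal. *)
Lemma graph_tangent k :
  tangent D y ((graph_slope k *: delta_mx 0 j + emb j (delta_mx 0 k)) *m Q^T).
Proof.
have [Vz fz] := graph_base.
pose l (t : R) : 'rV[R]_m := t *: delta_mx 0 k + z.
exists (fun t => (f (l t) *: delta_mx 0 j + emb j (l t)) *m Q^T); split.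
- by rewrite /l scale0r add0r -fz emb_coord -mulmxA (mulmx1C QQ) mulmx1.
- have cl : l t @[t --> (0 : R)] --> l 0.
    apply: cvgD; last exact: cvg_cst.
    by apply: cvgZl; exact: cvg_id.
  have : nbhs (l 0) V by apply: open_nbhs_nbhs; split => //; rewrite /l scale0r add0r.
  move=> /cl h; near=> t.
  have Vt : V (l t) by near: t.
  have : [set y | V (col' j (y *m Q)) /\ (y *m Q) 0 j = f (col' j (y *m Q))]
      ((f (l t) *: delta_mx 0 j + emb j (l t)) *m Q^T).
    by rewrite /= -!mulmxA !QQ !mulmx1 col'_emb coord_emb.
  by rewrite -graphE => -[].
- have dl : is_derive (0 : R) (1 : R) (fun t => f (l t)) (graph_slope k).
    have E0 : 0 *: delta_mx 0 k + z = z by rewrite scale0r add0r.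
    have [dfz _] := fV k Vz.
    have := @is_derive_line R _ _ f (delta_mx 0 k) z 0; rewrite E0; exact.
  apply: is_derive_rV => i.
  pose A := (delta_mx 0 j : 'rV[R]_m.+1) *m Q^T; pose B := emb j (delta_mx 0 k) *m Q^T.
  pose C := emb j z *m Q^T.
  rewrite (_ : (fun t => _) = (fun t => A 0 i * f (l t) + (t * B 0 i + C 0 i))); last first.
    by apply/funext => t; rewrite /l emb_line !mulmxDl -!scalemxAl !mxE mulrC.
  apply: is_derive_eq.
  by rewrite mulmxDl -scalemxAl !mxE /GRing.scale/= -/A -/B; ring.
Unshelve. all: by end_near. Qed.

(** Orthogonality to the m graph tangents expresses every other coordinate of [v] through the [j]-th
    one, so [v] is a multiple of the usual graph normal (1, - slopes). *)
Lemma graph_normalE v : (forall w, tangent D y w -> dotp v w = 0) ->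
  forall w, dotp v w = (v *m Q) 0 j *
    ((w *m Q) 0 j - \sum_k graph_slope k * (col' j (w *m Q)) 0 k).
Proof.
move=> vT w.
have E k : (v *m Q) 0 (lift j k) = - ((v *m Q) 0 j * graph_slope k).
  have := vT _ (graph_tangent k).
  rewrite -(dotp_mulmx _ _ QQ) -mulmxA QQ mulmx1 (dotp_coord j) coord_emb col'_emb.
  by rewrite (dotpC _ (delta_mx 0 k)) dotp_delta [col' _ _ _ _]mxE; lra.
rewrite -(dotp_mulmx _ _ QQ) (dotp_coord j) mulrBr mulr_sumr -sumrN; congr (_ + _).
by apply: eq_bigr => k _; rewrite [col' _ (v *m Q) _ _]mxE E; ring.
Qed.

(** By [graph_normalE], the product of [v] with x - y is the [j]-th coordinate of [v], at most 1 in
    absolute value, times the first-order Taylor remainder of the graph function. *)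
Lemma boundary_flat v (e : R) : enorm v = 1 -> (forall w, tangent D y w -> dotp v w = 0) ->
  0 < e ->
  exists2 d, 0 < d & forall x, boundary D x -> enorm (x - y) < d ->
    `|dotp v (x - y)| <= e * enorm (x - y).
Proof.
move=> v1 vT e0; have [Vz fz] := graph_base.
have [d1 d10 d1P] := nbhs_enorm (open_nbhs_nbhs yU).
have [d2 d20 d2P] := C1_on_frechet oV fV Vz e0.
exists (Num.min d1 d2); first by rewrite lt_min d10.
move=> x Dx; rewrite lt_min => /andP[xd1 xd2].
have : (boundary D `&` U) x by split => //; exact: d1P.
rewrite graphE => -[_ fx].
have E : col' j ((x - y) *m Q) = col' j (x *m Q) - z by rewrite mulmxBl raddfB.
have le1 : enorm (col' j (x *m Q) - z) <= enorm (x - y).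
  by rewrite -E -(enorm_mulmx (x - y) QQ); exact: enorm_col'.
have Ej : ((x - y) *m Q) 0 j = f (col' j (x *m Q)) - f z.
  by rewrite mulmxBl [LHS]mxE [X in _ + X]mxE fx fz.
rewrite (graph_normalE vT) E Ej normrM.
rewrite -[leRHS]mul1r; apply: ler_pM => //.
  by rewrite -v1 -(enorm_mulmx v QQ); exact: enorm_coord.
apply: (@le_trans _ _ (e * enorm (col' j (x *m Q) - z))); last by rewrite ler_pM2l.
by apply: d2P; exact: le_lt_trans xd2.
Qed.

Lemma normal_unique v w :
  enorm v = 1 -> (forall u, tangent D y u -> dotp v u = 0) ->
  enorm w = 1 -> (forall u, tangent D y u -> dotp w u = 0) ->
  w = v \/ w = - v.
Proof.
move=> v1 vT w1 wT.
have vE := graph_normalE vT; have wE := graph_normalE wT.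
set a := (v *m Q) 0 j in vE; set b := (w *m Q) 0 j in wE.
have E : a *: w = b *: v.
  apply/rowP => i; rewrite !mxE -!dotp_delta (dotpC _ w) (dotpC _ v) vE wE; ring.
have a0 : a != 0.
  apply: contra_eq_neq v1 => a0; rewrite /enorm vE a0 mul0r sqrtr0.
  by rewrite eq_sym oner_eq0.
have : `|a| = `|b| by have := congr1 enorm E; rewrite !enormZ v1 w1 !mulr1.
move=> /eqP; rewrite eqr_norm2 => /orP[] /eqP ab.
  by left; apply: (scalerI a0); rewrite E ab.
by right; apply: (scalerI a0); rewrite E scalerN -scaleNr ab opprK.
Qed.

End graph_coordinates.

Section normals.
Context {R : realType} {m : nat}.
Variable D : set 'rV[R]_m.+1.
Hypothesis oD : open D.
Hypothesis bD : C1_boundary D.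
Implicit Types x y w v : 'rV[R]_m.+1.

Lemma at_right0_ex (P : R -> Prop) : (\forall t \near (0 : R)^'+, P t) ->
  exists2 r, 0 < r & forall t, 0 < t -> t < r -> P t.
Proof.
move=> /nbhs_ballP[r r0 rP]; exists r => // t t0 tr; apply: rP => //.
by rewrite /ball/= sub0r normrN gtr0_norm.
Qed.

(** An outer normal describes [D] only along its own line. The short segment from y + s v to y + s w
    misses the boundary, since each of its points has a displacement from [y] with too large a
    component along [v] for [boundary_flat]; hence [w] crosses the boundary in the same sense as
    [v]. *)
Lemma transversal_line y v w : boundary D y -> is_outer_unit_normal D y v ->
  0 < dotp v w ->
  exists2 r, 0 < r & forall t, 0 < t -> t < r -> D (y - t *: w) /\ ~ D (y + t *: w).
Proof.
move=> by_ [v1 vT vD] vw.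
have [U [Q [j [V [f [yU QQ oV fV gE]]]]]] := bD by_.
pose c := Num.min 1 (dotp v w); pose L := 1 + enorm w.
have c0 : 0 < c by rewrite lt_min ltr01.
have L0 : 0 < L by rewrite ltr_pwDl ?enorm_ge0.
(* On the segment from [v] to [w], the component along [v] is at least [c] and the norm at most [L];
   flatness with this constant would allow a component of at most c / 2. *)
have e0 : 0 < c / (2 * L) by rewrite divr_gt0 ?mulr_gt0.
have [d d0 dP] := boundary_flat by_ yU QQ oV fV gE v1 vT e0.
pose u (th : R) := (1 - th) *: v + th *: w.
have avoid (s th : R) : s != 0 -> `|s| < d / L -> 0 <= th <= 1 ->
    ~ boundary D (y + s *: u th).
  move=> s0 sd /andP[th0 th1] bs.
  have th1' : 0 <= 1 - th by rewrite subr_ge0.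
  have vu : c <= dotp v (u th).
    rewrite dotpDr !dotpZr -enorm2 v1 expr1n mulr1.
    have c1 : c <= 1 by rewrite ge_min lexx.
    have c2 : c <= dotp v w by rewrite ge_min lexx orbT.
    have := ler_wpM2l th0 c2; have := ler_wpM2l th1' c1; lra.
  have uL : enorm (u th) <= L.
    apply: le_trans (enormD _ _) _; rewrite !enormZ v1 mulr1 !ger0_norm//.
    rewrite /L lerD//; first by rewrite gerBl.
    by rewrite ler_piMl ?enorm_ge0.
  have E : y + s *: u th - y = s *: u th by rewrite addrAC subrr add0r.
  have s1 : 0 < `|s| by rewrite normr_gt0.
  have := dP _ bs; rewrite E enormZ dotpZr normrM.
  have -> : `|s| * enorm (u th) < d.
    apply: le_lt_trans (_ : `|s| * L < d); first by rewrite ler_wpM2l.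
    by rewrite -ltr_pdivlMr.
  move=> /(_ isT); rewrite mulrCA ler_pM2l// leNgt => /negP; apply.
  apply: le_lt_trans (_ : c / (2 * L) * L < _).
    by rewrite ler_wpM2l// ltW.
  apply: lt_le_trans (_ : c <= _).
    rewrite (_ : c / (2 * L) * L = c / 2); last by field; rewrite gt_eqF.
    by rewrite ltr_pdivrMr// ltr_pMr// ltr1n.
  by apply: le_trans vu _; exact: ler_norm.
have [r r0 rP] := at_right0_ex vD.
exists (Num.min r (d / L)); first by rewrite lt_min r0 divr_gt0.
move=> t t0; rewrite lt_min => /andP[tr td].
have [Dm Dp] := rP t t0 tr.
split.
- apply: (segment_in_domain oD Dm) => th th01.
  have -> : y - t *: v + th *: (y - t *: w - (y - t *: v)) = y + (- t) *: u th.
    by apply/rowP => i; rewrite !mxE; ring.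
  by apply: avoid => //; rewrite ?oppr_eq0 ?gt_eqF// normrN gtr0_norm.
- move=> Dw; apply: Dp; apply: (segment_in_domain oD Dw) => th th01.
  have -> : y + t *: w + th *: (y + t *: v - (y + t *: w)) = y + t *: u (1 - th).
    by apply/rowP => i; rewrite !mxE; ring.
  apply: avoid => //; rewrite ?gt_eqF ?gtr0_norm//.
  by move: th01 => /andP[h0 h1]; rewrite subr_ge0 h1 gerBl h0.
Qed.

Variables (x0 om : 'rV[R]_m.+1).
Hypothesis om1 : enorm om = 1.
Hypothesis x0D : boundary D x0.
Hypothesis supp : forall x, D x -> dotp om (x - x0) <= 0.

Lemma support_closure x : closure D x -> dotp om (x - x0) <= 0.
Proof.
pose F : set 'rV[R]_m.+1 := [set x | dotp om x <= dotp om x0].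
have cF : closed F.
  rewrite (_ : F = dotp om @^-1` [set s | s <= dotp om x0])//.
  apply: closed_comp; first by move=> z _; exact: continuous_dotp.
  exact: closed_le.
have DF : D `<=` F by move=> z Dz; have := supp Dz; rewrite dotpBr subr_le0.
move=> cx; rewrite dotpBr subr_le0.
by have := closure_subset DF cx; rewrite closure_id in cF; rewrite -cF.
Qed.

(** Along a boundary curve through [x0] the linear form of [om] is maximal at parameter 0, so its
    derivative vanishes. A negative derivative is refuted by a negative increment, a positive one by
    a positive increment. *)
Lemma support_tangent w : tangent D x0 w -> dotp om w = 0.
Proof.
move=> [g [g0 gD dg]].
have dgi i : is_derive (0 : R) (1 : R) (fun t => g t 0 i) (w 0 i).
  have d : derivable g 0 1 by exact: ex_derive.
  apply: DeriveDef; first by move/derivable_mxP : d; exact.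
  have := derive_mx d; rewrite derive_val => /rowP/(_ i) ->.
  by rewrite mxE.
have [dG dGE] : is_derive (0 : R) (1 : R) (fun t => dotp om (g t)) (dotp om w).
  rewrite (_ : (fun t => _) = \sum_i (fun t => om 0 i * g t 0 i)); last first.
    by apply/funext => t; rewrite fct_sumE.
  apply: (@is_derive_sum _ _ _ _ (fun i t => om 0 i * g t 0 i) _ _ (fun i => om 0 i * w 0 i)).
have q : h^-1 *: (((fun t => dotp om (g t)) \o shift 0) (h *: (1 : R)) - dotp om (g 0))
    @[h --> (0 : R)^'] --> dotp om w by rewrite -dGE; exact: dG.
have gle : \forall h \near (0 : R), dotp om (g h) - dotp om x0 <= 0.
  near=> h; rewrite -dotpBr; apply: support_closure.
  have bg : boundary D (g h) by near: h.
  by have [] := bg.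
have [om0|om0|//] := ltgtP (dotp om w) 0.
- have /nbhs_ballP[r r0 rP] : \forall h \near (0 : R)^',
     h^-1 *: (((fun t => dotp om (g t)) \o shift 0) (h *: (1 : R)) - dotp om (g 0)) < 0.
    exact: (cvgr_lt _ q 0 om0).
  have /nbhs_ballP[s s0 sP] := gle.
  pose h := - (Num.min r s / 2).
  have rs0 : 0 < Num.min r s by rewrite lt_min r0.
  have h0 : h < 0 by rewrite oppr_lt0 divr_gt0.
  have hm : `|h| < Num.min r s.
    by rewrite normrN gtr0_norm ?divr_gt0// ltr_pdivrMr// ltr_pMr// ltr1n.
  move: hm; rewrite lt_min => /andP[hr hs].
  have hb : ball (0 : R) r h by rewrite /ball/= sub0r normrN.
  have := rP h hb; rewrite /= addr0 [h *: 1]mulr1 => /(_ (ltr0_neq0 h0)).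
  rewrite g0 [_ *: _]/(h^-1 * _) nmulr_rlt0 ?invr_lt0// ltNge => /negP[].
  by apply: sP; rewrite /ball/= sub0r normrN.
- have /nbhs_ballP[r r0 rP] : \forall h \near (0 : R)^',
     h^-1 *: (((fun t => dotp om (g t)) \o shift 0) (h *: (1 : R)) - dotp om (g 0)) > 0.
    exact: (cvgr_gt _ q 0 om0).
  have /nbhs_ballP[s s0 sP] := gle.
  pose h := Num.min r s / 2.
  have rs0 : 0 < Num.min r s by rewrite lt_min r0.
  have h0 : 0 < h by rewrite divr_gt0.
  have hm : `|h| < Num.min r s.
    by rewrite gtr0_norm ?divr_gt0// ltr_pdivrMr// ltr_pMr// ltr1n.
  move: hm; rewrite lt_min => /andP[hr hs].
  have hb : ball (0 : R) r h by rewrite /ball/= sub0r normrN.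
  have := rP h hb; rewrite /= addr0 [h *: 1]mulr1 => /(_ (lt0r_neq0 h0)).
  rewrite g0 [_ *: _]/(h^-1 * _) pmulr_rgt0 ?invr_gt0// ltNge => /negP[].
  by apply: sP; rewrite /ball/= sub0r normrN.
Unshelve. all: by end_near. Qed.

Lemma support_out t : 0 < t -> ~ D (x0 + t *: om).
Proof.
move=> t0 /supp; rewrite addrAC subrr add0r dotpZr -enorm2 om1 expr1n mulr1.
by rewrite leNgt t0.
Qed.

End normals.

(** * Support points and outer normals *)

Lemma nbhs_enorm_ball (R : realType) n (y : 'rV[R]_n) (d : R) : 0 < d ->
  nbhs y [set x | enorm (x - y) < d].
Proof.
move=> d0; apply: open_nbhs_nbhs; split; last by rewrite /= subrr enorm0.
apply: (@open_comp _ _ (fun x : 'rV[R]_n => enorm (x - y)) [set s | s < d]).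
  by move=> x _; exact: continuous_enorm_sub.
exact: open_lt.
Qed.

Section support_normal.
Context {R : realType} {m : nat}.
Variable D : set 'rV[R]_m.+1.
Hypothesis oD : open D.
Hypothesis bD : C1_boundary D.
Variables (x0 om : 'rV[R]_m.+1).
Hypothesis om1 : enorm om = 1.
Hypothesis x0D : boundary D x0.
Hypothesis supp : forall x, D x -> dotp om (x - x0) <= 0.

(* A point of [D] close to [x0] is moved away from the boundary graph along the
   vertical direction, then straight to [x0 - t *: om]; neither segment meets the
   boundary, and moving to the outer side is excluded by [supp]. *)
Lemma support_in : exists2 r, 0 < r & forall t, 0 < t -> t < r -> D (x0 - t *: om).
Proof.
have vT := support_tangent supp.
have [U [Q [j [V [f [yU QQ oV fV gE]]]]]] := bD x0D.
pose u : 'rV[R]_m.+1 := delta_mx 0 j *m Q^T.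
have uQ : u *m Q = delta_mx 0 j by rewrite /u -mulmxA QQ mulmx1.
have dd : dotp (delta_mx 0 j : 'rV[R]_m.+1) (delta_mx 0 j) = 1.
  by rewrite dotp_delta mxE !eqxx.
have u1 : enorm u = 1 by rewrite -(enorm_mulmx u QQ) uQ /enorm dd sqrtr1.
pose a := (om *m Q) 0 j.
have aE : dotp om u = a by rewrite -(dotp_mulmx _ _ QQ) uQ dotpC dotp_delta.
have a0 : a != 0.
  apply: contra_eq_neq om1 => a0; rewrite /enorm (graph_normalE x0D yU QQ oV fV gE vT) -/a a0 mul0r sqrtr0.
  by rewrite eq_sym oner_eq0.
have na0 : 0 < `|a| by rewrite normr_gt0.
have na1 : `|a| <= 1.
  by rewrite -aE; apply: le_trans (CauchySchwarz_dotp _ _) _; rewrite om1 u1 mulr1.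
(* On the final segment the inward displacement is at least (1 - th) |a| T + th t, and the distance
   to [x0] at most 2 (1 - th) T + th t. With slope |a| / 4 flatness allows at most half of that
   displacement. *)
have e0 : 0 < `|a| / 4 by rewrite divr_gt0.
have [d d0 dP] := boundary_flat x0D yU QQ oV fV gE om1 vT e0.
have [d1 d10 d1P] := nbhs_enorm (open_nbhs_nbhs yU).
pose dm := Num.min d d1.
have dm0 : 0 < dm by rewrite lt_min d0.
(* All points considered below stay within 2 T of [x0], hence inside both radii. *)
have [T T0 TE] : exists2 T, 0 < T & dm = 4 * T.
  by exists (dm / 4); [rewrite divr_gt0|field].
have eta0 : 0 < `|a| * T / 4 by rewrite divr_gt0// mulr_gt0.
have [x [Dx xx0]] : exists x, D x /\ enorm (x - x0) < `|a| * T / 4.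
  have [cx0 _] := (boundaryP oD x0).1 x0D.
  by have [x [Dx ?]] := cx0 _ (nbhs_enorm_ball x0 eta0); exists x.
have xT : enorm (x - x0) < T.
  apply: lt_le_trans xx0 _; rewrite ler_pdivrMr//; nra.
pose z := col' j (x *m Q).
pose sg : R := if f z <= (x *m Q) 0 j then 1 else -1.
have sg1 : `|sg| = 1 by rewrite /sg; case: ifP; rewrite ?normrN normr1.
pose p := x + (sg * T) *: u.
have Dp : D p.
  apply: (segment_in_domain oD Dx) => th /andP[th0 th1].
  have -> : x + th *: (p - x) = x + (th * sg * T) *: u.
    by apply/rowP => i; rewrite /p !mxE; ring.
  move=> bq; have : (boundary D `&` U) (x + (th * sg * T) *: u).
    split => //; apply: d1P.
    rewrite addrAC; apply: le_lt_trans (enormD _ _) _.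
    rewrite enormZ u1 mulr1 !normrM sg1 mulr1 (ger0_norm th0) (gtr0_norm T0).
    have : dm <= d1 by rewrite ge_min lexx orbT.
    nra.
  rewrite gE /= mulmxDl -scalemxAl uQ => -[_].
  have -> : col' j (x *m Q + (th * sg * T) *: delta_mx 0 j) = z.
    apply/rowP => k; rewrite /z [LHS]mxE [RHS]mxE [LHS]mxE [X in _ + X]mxE.
    rewrite [delta_mx _ _ _ _]mxE eqxx/= eq_sym (negbTE (neq_lift j k)).
    by rewrite mulr0 addr0.
  rewrite [LHS]mxE [X in _ + X]mxE [delta_mx _ _ _ _]mxE !eqxx mulr1 => fz.
  have thT0 : 0 <= th * T by rewrite mulr_ge0// ltW.
  have := boundaryP oD (x + (th * sg * T) *: u) => -[/(_ bq)[_ nD] _].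
  (* When moving away from the graph, it can be met only at displacement 0, that is at [x], which
     lies in [D]. *)
  move: fz; rewrite /sg; case: ifPn => [fzx fz|].
    have tT : th * T = 0 by lra.
    by apply: nD; rewrite mulrAC tT mul0r scale0r addr0.
  by rewrite -ltNge; lra.
have pE : dotp om (p - x0) = dotp om (x - x0) + sg * T * a.
  have -> : p - x0 = (x - x0) + (sg * T) *: u by rewrite /p addrAC.
  by rewrite dotpDr dotpZr aE.
have pn : enorm (p - x0) <= 2 * T.
  rewrite /p addrAC; apply: le_trans (enormD _ _) _.
  by rewrite enormZ u1 mulr1 normrM sg1 mul1r (gtr0_norm T0); lra.
(* The displacement changes the product with [om] by |a| T in absolute value, while the contribution
   of [x] is below |a| T / 4. Moving outwards would thus put [p] beyond the supporting
   hyperplane. *)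
have sga : sg * a = - `|a|.
  have sga2 : `|sg * a| = `|a| by rewrite normrM sg1 mul1r.
  have [sa|sa] := lerP (sg * a) 0; first by rewrite -sga2 ler0_norm// opprK.
  have := supp Dp; rewrite pE mulrAC -[sg * a]gtr0_norm// sga2.
  have := CauchySchwarz_dotp om (x - x0); rewrite om1 mul1r ler_norml => /andP[h _].
  have : 0 < `|a| * T by rewrite mulr_gt0.
  lra.
have pneg : dotp om (p - x0) <= - (`|a| * T).
  by rewrite pE mulrAC sga mulNr -subr_ge0; have := supp Dx; lra.
exists T => // t t0 tT.
apply: (segment_in_domain oD Dp) => th /andP[th0 th1] bq.
set q := _ + _ in bq.
have qE : q - x0 = (1 - th) *: (p - x0) + (- (th * t)) *: om.
  by apply/rowP => i; rewrite /q !mxE; ring.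
have th1' : 0 <= 1 - th by rewrite subr_ge0.
have tht : 0 <= th * t by rewrite mulr_ge0// ltW.
have qn : enorm (q - x0) <= (1 - th) * (2 * T) + th * t.
  rewrite qE; apply: le_trans (enormD _ _) _; rewrite !enormZ om1 mulr1 normrN.
  by rewrite !ger0_norm// lerD2r ler_wpM2l.
have qd : enorm (q - x0) < d.
  apply: le_lt_trans qn _; have : dm <= d by rewrite ge_min lexx.
  by nra.
have := dP _ bq qd; rewrite {1}qE dotpDr !dotpZr -enorm2 om1 expr1n mulr1.
have h1 : (1 - th) * dotp om (p - x0) <= - ((1 - th) * (`|a| * T)).
  by rewrite -mulrN ler_wpM2l.
have h2 : `|a| / 4 * enorm (q - x0) <= `|a| / 4 * ((1 - th) * (2 * T) + th * t).
  by rewrite ler_pM2l.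
have aT : 0 < `|a| * T by rewrite mulr_gt0.
have h3 : 0 <= (1 - th) * (`|a| * T) by rewrite mulr_ge0// ltW.
have h4 : `|a| * (th * t) <= th * t by rewrite ler_piMl.
rewrite ler_norml => /andP[h5 _].
(* One of the two inward terms is strictly positive: the first in the first half of the segment, the
   second afterwards. *)
have [th12|th12] := lerP th (1 / 2).
  have : 1 / 2 * (`|a| * T) <= (1 - th) * (`|a| * T) by rewrite ler_pM2r//; lra.
  by move: h1 h2 h3 h4 h5; rewrite !mulrDr; lra.
have : 1 / 2 * t < th * t by rewrite ltr_pM2r.
by move: h1 h2 h3 h4 h5; rewrite !mulrDr; lra.
Qed.

Lemma support_is_outer_normal : is_outer_unit_normal D x0 om.
Proof.
split=> //; first exact: (support_tangent supp).
have [r r0 rP] := support_in; near=> t; split.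
  by apply: rP; near: t; [exact: nbhs_right_gt|exact: nbhs_right_lt].
by apply: (support_out om1 supp); near: t; exact: nbhs_right_gt.
Unshelve. all: by end_near. Qed.

(** Unit vectors orthogonal to the tangents are [om] and its opposite, and the latter as outer
    normal would place points x0 + t om in [D], beyond the supporting hyperplane. *)
Lemma outer_normal_support : outer_normal D x0 = om.
Proof.
apply: xget_unique; first exact: support_is_outer_normal.
move=> v [v1 vT vD].
have [U [Q [j [V [f [yU QQ oV fV gE]]]]]] := bD x0D.
have [//|E] := normal_unique x0D yU QQ oV fV gE om1 (support_tangent supp) v1 vT.
have [r r0 rP] := at_right0_ex vD.
have r2 : 0 < r / 2 by rewrite divr_gt0.
have [|+ _] := rP (r / 2) r2; first by rewrite ltr_pdivrMr// ltr_pMr// ltr1n.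
by rewrite E scalerN opprK => /(support_out om1 supp r2).
Qed.

End support_normal.

Lemma half_divfK (R : realType) (d c : R) : c != 0 -> d / (2 * c) * c = d / 2.
Proof. by move=> c0; field. Qed.

(** * The region near a support point that [D] must fill *)

Section support_region.
Context {R : realType} {m : nat}.
Variables (al : R) (D : set 'rV[R]_m.+1).
Hypothesis al0 : 0 < al.
Hypothesis oD : open D.
Hypothesis D0 : D !=set0.
Hypothesis bndD : bounded_set D.
Hypothesis cD : C1alpha_boundary al D.
Implicit Types x y : 'rV[R]_m.+1.

(** Since [xget] defaults to 0, a nonzero value certifies that an outer normal exists. At points
    other than support points, existence is obtained this way, from the Hoelder bound. *)
Lemma outer_normalP y : outer_normal D y <> 0 -> is_outer_unit_normal D y (outer_normal D y).
Proof. by rewrite /outer_normal; case: xgetP => [v -> //|_ []]. Qed.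

Lemma enorm_outer_normal y : enorm (outer_normal D y) <= 1.
Proof.
have [->|/eqP /outer_normalP[-> _ _]] := eqVneq (outer_normal D y) 0; last by [].
by rewrite enorm0.
Qed.

Lemma normal_holder : exists r C, [/\ 0 < r, 0 < C &
  forall x y, boundary D x -> boundary D y -> x != y -> enorm (x - y) < r ->
    enorm (outer_normal D x - outer_normal D y) <= C * enorm (x - y) `^ al].
Proof.
have [_ /eqO_exP[C C0 /at_right0_ex[r r0 rP]]] := cD.
exists r, C; split=> // x y bx by_ xy xyr.
have d0 : 0 < enorm (x - y).
  rewrite lt_neqAle enorm_ge0 andbT eq_sym; apply: contra_neq xy => /enorm_eq0.
  by move/eqP; rewrite subr_eq0 => /eqP.
have := rP _ d0 xyr; rewrite (ger0_norm (powR_ge0 _ _)); apply: le_trans.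
(* The supremum is a true upper bound only for a bounded set; here 2 bounds it, as all values of
   [outer_normal] have norm at most 1. *)
apply: le_trans (ler_norm _); apply: ub_le_sup.
  exists 2 => _ [[u v] _ <-] /=; apply: le_trans (enormD _ _) _; rewrite enormN.
  by have := enorm_outer_normal u; have := enorm_outer_normal v; lra.
by exists (x, y).
Qed.

Lemma exists_support (xi : 'rV[R]_m.+1) : xi != 0 ->
  exists2 x0, boundary D x0 & forall x, D x -> dotp xi (x - x0) <= 0.
Proof.
move=> xi0.
have bcD : bounded_set (closure D).
  have [M [Mr MD]] := bndD; exists M; split => // N MN x cx.
  have cB : closed [set x : 'rV[R]_m.+1 | `|x| <= N].
    apply: (@closed_comp _ _ (fun x : 'rV[R]_m.+1 => `|x|) [set s | s <= N]).
      by move=> z _; exact: norm_continuous.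
    exact: closed_le.
  have := @closure_subset _ D [set x : 'rV[R]_m.+1 | `|x| <= N] (MD N MN) x cx.
  by move: cB; rewrite closure_id => <-.
have clD : closed (closure D) by exact: closed_closure.
have ccD := bounded_closed_compact bcD clD.
have cD0 : closure D !=set0 by have [x Dx] := D0; exists x; exact: subset_closure.
have [x0 x0D x0M] := EVT_max_rV cD0 ccD (continuous_subspaceT (@continuous_dotp R _ xi)).
rewrite inE in x0D.
have sup x : D x -> dotp xi (x - x0) <= 0.
  move=> Dx; rewrite dotpBr subr_le0; apply: x0M.
  by rewrite inE; exact: subset_closure.
exists x0 => //; apply/(boundaryP oD); split=> // Dx0.
have [d d0 dP] := nbhs_enorm (open_nbhs_nbhs (conj oD Dx0)).
have n0 : 0 < enorm xi.
  by rewrite lt_neqAle enorm_ge0 andbT eq_sym; apply: contra_neq xi0; exact: enorm_eq0.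
have t0 : 0 < d / (2 * enorm xi) by rewrite divr_gt0// mulr_gt0.
have /sup : D (x0 + (d / (2 * enorm xi)) *: xi).
  apply: dP; rewrite addrAC subrr add0r enormZ gtr0_norm//.
  rewrite half_divfK ?gt_eqF//.
  by rewrite ltr_pdivrMr// ltr_pMr// ltr1n.
rewrite addrAC subrr add0r dotpZr -enorm2 leNgt => /negP; apply.
by rewrite mulr_gt0// exprn_gt0.
Qed.

(** Suppose [x] is that far below the supporting hyperplane but outside [D], and follow the segment
    from [x] to [x0], with direction [w]. It lies in [D] shortly before [x0], so it has a last point
    [y] outside [D], which is a boundary point. By the Hoelder bound the normal at [y] is so close
    to that at [x0] that its product with [w] is still positive; the segment therefore leaves [D] at
    [y], although it lies in [D] just after [y]. *)
Lemma support_region : exists r K, [/\ 0 < r, 0 < K & forall xi, xi != 0 ->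
  exists x0, (forall x, D x -> dotp xi (x - x0) <= 0) /\
    forall x, enorm (x - x0) < r ->
      dotp xi (x - x0) < - (K * enorm xi * (enorm (x - x0) `^ al * enorm (x - x0))) ->
      D x].
Proof.
have [r1 [C [r10 C0 holder]]] := normal_holder.
have [bD _] := cD.
(* Chosen so that C r2^al = 1/2, which keeps the normal at [y] away from the default value 0. *)
pose r2 := (2 * C)^-1 `^ al^-1.
have C20 : 0 < (2 * C)^-1 by rewrite invr_gt0 mulr_gt0.
have r20 : 0 < r2 by rewrite powR_gt0.
have r2E : C * r2 `^ al = 1 / 2.
  by rewrite /r2 -powRrM mulVf ?gt_eqF// powRr1 ?ltW//; field; rewrite gt_eqF.
exists (Num.min r1 r2), C; split=> //; first by rewrite lt_min r10.
move=> xi xi0; have n0 : 0 < enorm xi.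
  by rewrite lt_neqAle enorm_ge0 andbT eq_sym; apply: contra_neq xi0; exact: enorm_eq0.
have [x0 x0D sup] := exists_support xi0; exists x0; split=> // x.
pose om := (enorm xi)^-1 *: xi.
have om1 : enorm om = 1.
  by rewrite /om enormZ gtr0_norm ?invr_gt0// mulVf// gt_eqF.
have supp z : D z -> dotp om (z - x0) <= 0.
  by move=> /sup h; rewrite dotpZl pmulr_rle0 ?invr_gt0.
set rho := enorm (x - x0); rewrite lt_min => /andP[xr1 xr2] xlow.
apply: contrapT => nDx.
pose w := x0 - x.
have wn : enorm w = rho by rewrite /rho -enormN opprB.
have rho0 : 0 <= rho by exact: enorm_ge0.
have oml : C * rho `^ al * rho < dotp om w.
  have oE : enorm xi * dotp om w = - dotp xi (x - x0).
    by rewrite /w -opprB dotpNr dotpZl mulrN mulrA divff ?gt_eqF// mul1r.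
  rewrite -(ltr_pM2l n0) oE ltrNr.
  rewrite (_ : enorm xi * (C * _ * _) = C * enorm xi * (rho `^ al * rho)); last by ring.
  exact: xlow.
have rhoa : 0 <= C * rho `^ al * rho by rewrite !mulr_ge0 ?powR_ge0// ltW.
have rho1 : 0 < rho.
  rewrite lt_neqAle rho0 andbT; apply: contraTneq oml => r0.
  have -> : w = 0 by apply: enorm_eq0; rewrite wn -r0.
  by rewrite dotp0r -leNgt.
have [r3 r30 r3P] := transversal_line oD bD x0D
  (support_is_outer_normal oD bD om1 x0D supp) (le_lt_trans rhoa oml).
(* The end [x0] is itself outside [D], so the last point outside [D] is sought only up to parameter
   1 - s, where the segment is already in [D]. *)
pose s := Num.min (r3 / 2) (1 / 2).
have s0 : 0 < s by rewrite lt_min !divr_gt0.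
have s1 : s <= 1 / 2 by rewrite ge_min lexx orbT.
have s3 : s < r3.
  rewrite gt_min; apply/orP; left; by rewrite ltr_pdivrMr// ltr_pMr// ltr1n.
pose A := [set t : R | [/\ 0 <= t, t <= 1 - s & ~ D (x + t *: w)]].
have A0 : A 0 by split=> //; [lra|rewrite scale0r addr0].
have hA : has_sup A.
  by split; [exists 0|exists (1 - s) => t []].
pose t0 := reals.sup A.
have t00 : 0 <= t0 by apply: ub_le_sup A0; exact: hA.2.
have t01 : t0 <= 1 - s by apply: ge_sup; [exists 0|move=> t []].
pose y := x + t0 *: w.
have yE : y - x0 = - ((1 - t0) *: w) by apply/rowP => i; rewrite /y /w !mxE; ring.
have nDy : ~ D y.
  move=> Dy; have [d d0 dP] := nbhs_enorm (open_nbhs_nbhs (conj oD Dy)).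
  have e0 : 0 < d / (2 * rho) by rewrite divr_gt0// mulr_gt0.
  have [t [h0 h1 nDt] tt0] := sup_adherent e0 hA.
  have tl : t <= t0 by apply: ub_le_sup; [exact: hA.2|split].
  apply: nDt; apply: dP.
  have -> : x + t *: w - y = (t - t0) *: w.
    by apply/rowP => i; rewrite /y !mxE; ring.
  rewrite enormZ wn ler0_norm ?subr_le0// opprB.
  apply: le_lt_trans (_ : d / (2 * rho) * rho < d).
    by rewrite ler_wpM2r//; move: tt0; rewrite -/t0; lra.
  rewrite half_divfK ?gt_eqF//.
  by rewrite ltr_pdivrMr// ltr_pMr// ltr1n.
have after t : t0 < t -> t <= 1 - s -> D (x + t *: w).
  move=> t0t ts; apply: contrapT => nDt.
  have : t <= t0.
    apply: ub_le_sup; first exact: hA.2.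
    by split=> //; exact: le_trans (ltW t0t).
  by rewrite leNgt t0t.
have D1s : D (x + (1 - s) *: w).
  have [+ _] := r3P s s0 s3; rewrite (_ : x0 - s *: w = x + (1 - s) *: w)//.
  by apply/rowP => i; rewrite /w !mxE; ring.
have t0s : t0 < 1 - s.
  rewrite lt_neqAle t01 andbT; apply/eqP => E; apply: nDy.
  by rewrite /y E.
have yD : boundary D y.
  apply/(boundaryP oD); split=> // B /nbhs_enorm[d d0 dB].
  have e0 : 0 < d / (2 * rho) by rewrite divr_gt0// mulr_gt0.
  pose e := Num.min (d / (2 * rho)) (1 - s - t0).
  have ee0 : 0 < e by rewrite lt_min e0 subr_gt0.
  exists (x + (t0 + e) *: w); split.
    apply: after; first by rewrite ltrDl.
    by rewrite -lerBrDl ge_min lexx orbT.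
  apply: dB; have -> : x + (t0 + e) *: w - y = e *: w.
    by apply/rowP => i; rewrite /y !mxE; ring.
  rewrite enormZ wn gtr0_norm//.
  apply: le_lt_trans (_ : d / (2 * rho) * rho < d).
    by rewrite ler_wpM2r// ge_min lexx.
  rewrite half_divfK ?gt_eqF//.
  by rewrite ltr_pdivrMr// ltr_pMr// ltr1n.
have t1 : 0 < 1 - t0 by lra.
have yn : enorm (y - x0) = (1 - t0) * rho by rewrite yE enormN enormZ wn gtr0_norm.
have yn0 : 0 < enorm (y - x0) by rewrite yn mulr_gt0.
have ynr : enorm (y - x0) <= rho by rewrite yn ler_piMl// gerBl.
have yx0 : y != x0.
  by apply: contraTneq yn0 => ->; rewrite subrr enorm0 ltxx.
have := holder y x0 yD x0D yx0 (le_lt_trans ynr xr1).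
rewrite (outer_normal_support oD bD om1 x0D supp) => nuom.
have nu2 : enorm (outer_normal D y - om) <= C * rho `^ al.
  apply: le_trans nuom _; rewrite ler_pM2l//.
  by apply: ge0_ler_powR; rewrite ?nnegrE ?enorm_ge0// ltW.
(* The default value 0 is at distance 1 from [om], whereas the Hoelder bound allows at most 1/2. *)
have nu0 : outer_normal D y <> 0.
  move=> nu0; move: nu2; rewrite nu0 sub0r enormN om1.
  have : C * rho `^ al <= C * r2 `^ al.
    by rewrite ler_pM2l//; apply: ge0_ler_powR; rewrite ?nnegrE// ltW.
  by rewrite r2E; lra.
have nuw : 0 < dotp (outer_normal D y) w.
  rewrite -[outer_normal D y](subrK om) dotpDl.
  have := CauchySchwarz_dotp (outer_normal D y - om) w; rewrite wn ler_norml => /andP[h _].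
  have := ler_wpM2r rho0 nu2; lra.
have [r4 r40 r4P] := transversal_line oD bD yD (outer_normalP nu0) nuw.
pose e := Num.min (r4 / 2) (1 - s - t0).
have e0 : 0 < e by rewrite lt_min divr_gt0//= subr_gt0.
have er : e < r4.
  by rewrite gt_min; apply/orP; left; rewrite ltr_pdivrMr// ltr_pMr// ltr1n.
have [_] := r4P e e0 er; apply.
have -> : y + e *: w = x + (t0 + e) *: w by rewrite /y scalerDl addrA.
apply: after; first by rewrite ltrDl.
by rewrite -lerBrDl ge_min lexx orbT.
Qed.

End support_region.

(** * Gaussian lower bound for half-spaces *)

Section slice.
Context {R : realType}.
Local Notation mu := (@lebesgue_measure R).

(** What the half-space indicator times the sine becomes on a line parallel to the first axis: the
    half-space ends at [be], where the sine vanishes. *)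
Definition half_wave (k be t : R) : R := \1_`]-oo, be] t * sin (k * (be - t)).

Lemma measurable_half_wave k be : measurable_fun setT (half_wave k be).
Proof.
apply: measurable_funM; first exact: measurable_indic.
have mS : measurable_fun setT (@sin R).
  by apply: continuous_measurable_fun; exact: continuous_sin.
apply: (measurableT_comp mS); apply: measurable_funM => //.
exact: measurable_funB.
Qed.

Lemma normr_half_wave_le1 k be t : `|half_wave k be t| <= 1.
Proof.
rewrite normrM -[leRHS]mulr1; apply: ler_pM => //; last exact: normr_sin_le1.
by rewrite indicE; case: (_ \in _); rewrite ?normr1 ?normr0.
Qed.

Lemma integrable_gauss1_half_wave a c k be : 0 < a ->
  mu.-integrable setT (EFin \o (fun t => gauss1 a c t * half_wave k be t)).
Proof.
move=> a0; apply: (@integrable_gauss1_bound _ a c 1 (fun t => gauss1 a c t * half_wave k be t)) => //.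
  by apply: measurable_funM; [exact: measurable_gauss1|exact: measurable_half_wave].
by move=> t; apply: gauss1M_bound; exact: normr_half_wave_le1.
Qed.

Lemma integral_half_period k be : 0 < k ->
  (\int[mu]_(t in `[(be - pi / k)%R, be]) (sin (k * (be - t)))%:E)%E = (2 / k)%:E.
Proof.
move=> k0; have pk : 0 < pi / k by rewrite divr_gt0 ?pi_gt0.
have dl (t : R) : is_derive t (1 : R) (fun t => k * (be - t)) (- k).
  by apply: is_derive_eq; rewrite /GRing.scale/=; ring.
have dF (t : R) : is_derive t (1 : R) (fun t => k^-1 * cos (k * (be - t))) (sin (k * (be - t))).
  apply: is_derive_eq; rewrite /GRing.scale/=; field; by rewrite gt_eqF.
have cF (t : R) : {for t, continuous (fun t => k^-1 * cos (k * (be - t)))}.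
  by apply: differentiable_continuous; apply/derivable1_diffP; exact: ex_derive.
have cf : continuous (fun t => sin (k * (be - t))).
  move=> t; apply: (continuous_comp (f := fun t => k * (be - t))); last exact: continuous_sin.
  by apply: differentiable_continuous; apply/derivable1_diffP; exact: ex_derive.
rewrite (@continuous_FTC2 _ (fun t => sin (k * (be - t))) (fun t => k^-1 * cos (k * (be - t)))).
- have -> : k * (be - (be - pi / k)) = pi by field; rewrite gt_eqF.
  by rewrite -EFinB subrr mulr0 cos0 cospi; congr EFin; ring.
- by rewrite gtrBl.
- exact: continuous_subspaceT.
- split => [t _||]; first exact: ex_derive.
    by apply: cvg_at_right_filter; exact: cF.
  by apply: cvg_at_left_filter; exact: cF.
- by move=> t _; rewrite derive1E; apply: derive_val.
Qed.

(* Shifting the second gaussian back by half a period, the wave telescopes to a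
   single positive half period below [be]. *)
Lemma slice_lower b x0 be k : 0 < b -> 0 < k ->
  2 / k * expR (- (b * (2 * (be - x0) ^+ 2 + 2 * (pi / k) ^+ 2))) <=
  \int[mu]_t ((gauss1 b x0 t + gauss1 b (x0 + pi / k) t) * half_wave k be t).
Proof.
move=> b0 k0; set h := pi / k; have h0 : 0 < h by rewrite divr_gt0 ?pi_gt0.
have kh : k * h = pi by rewrite /h mulrCA divff ?gt_eqF// mulr1.
set c0 := expR _.
have i1 := integrable_gauss1_half_wave x0 k be b0.
have i2 := integrable_gauss1_half_wave (x0 + h) k be b0.
have sE t : gauss1 b (x0 + h) (t + h) * half_wave k be (t + h) =
    gauss1 b x0 t * half_wave k be (t + h).
  by rewrite /gauss1; congr (expR _ * _); ring.
have i2' : mu.-integrable setT (EFin \o (fun t => gauss1 b x0 t * half_wave k be (t + h))).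
  rewrite (_ : _ \o _ = fun t => (EFin \o (fun t => gauss1 b (x0 + h) t * half_wave k be t)) (t + h)).
    exact: integrable_shift.
  by apply/funext => t; rewrite /= sE.
have -> : \int[mu]_t ((gauss1 b x0 t + gauss1 b (x0 + h) t) * half_wave k be t) =
    \int[mu]_t (gauss1 b x0 t * half_wave k be t + gauss1 b x0 t * half_wave k be (t + h)).
  under eq_Rintegral do rewrite mulrDl.
  rewrite !RintegralD//; congr (_ + _).
  rewrite /Rintegral -(integral_shift h i2); congr fine.
  by apply: eq_integral => t _; rewrite /= sE.
pose I := `[be - h, be]%classic : set R.
pose L t := c0 * (\1_I t * sin (k * (be - t))).
have mI : measurable I by exact: measurable_itv.
have mL : measurable_fun setT L.
  apply: measurable_funM => //.
  apply: measurable_funM; first exact: measurable_indic.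
  have mS : measurable_fun setT (@sin R).
    by apply: continuous_measurable_fun; exact: continuous_sin.
  apply: (measurableT_comp mS); apply: measurable_funM => //.
  exact: measurable_funB.
have waveE t : half_wave k be t + half_wave k be (t + h) = \1_I t * sin (k * (be - t)).
  have kth : sin (k * (be - t)) = - sin (k * (be - (t + h))).
    by rewrite -sinDpi -kh; congr sin; ring.
  rewrite /half_wave !indicE !mem_setE !in_itv/=.
  have [tb|tb] := leP t be; last first.
    have -> : (t + h <= be) = false by apply/negbTE; rewrite -ltNge; lra.
    by rewrite andbF !mul0r addr0.
  have [tb'|tb'] := leP (t + h) be; last first.
    have -> : (be - h <= t) by rewrite lerBlDr ltW.
    by rewrite mul0r addr0.
  rewrite kth !mul1r addNr.
  have [e|ne] := eqVneq t (be - h).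
    by rewrite e subrK subrr mulr0 sin0 oppr0 mulr0.
  have -> : (be - h <= t) = false.
    by apply/negbTE; rewrite -ltNge lt_neqAle ne lerBrDr.
  by rewrite mul0r.
have wave_ge0 t : 0 <= \1_I t * sin (k * (be - t)).
  rewrite indicE mem_setE in_itv/=; case: (boolP (be - h <= t <= be)) => [/andP[t1 t2]|_]; last by rewrite mul0r.
  rewrite mul1r; apply: sin_ge0_pi.
  by rewrite mulr_ge0 ?subr_ge0 ?(ltW k0)//= -kh ler_pM2l//; lra.
have Lle t : L t <= gauss1 b x0 t * half_wave k be t + gauss1 b x0 t * half_wave k be (t + h).
  rewrite -mulrDr waveE /L; have := wave_ge0 t.
  rewrite indicE mem_setE in_itv/=; case: (boolP (be - h <= t <= be)) => [/andP[t1 t2]|_]; last by rewrite !mul0r !mulr0.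
  rewrite mul1r => s0; rewrite ler_wpM2r// /c0 /gauss1 ler_expR lerN2 ler_pM2l//.
  (* With 0 <= be - t <= h this gives (t - x0)^2 <= 2 (be - x0)^2 + 2 h^2, so [c0] is a lower bound
     for the Gaussian on the surviving half period. *)
  have p1 : 0 <= (be - t) * (h - (be - t)).
    by apply: mulr_ge0; rewrite subr_ge0//; lra.
  have p2 := sqr_ge0 (be - t); have p3 := sqr_ge0 (be - x0 + (be - t)).
  nra.
have L0 t : 0 <= L t by rewrite mulr_ge0 ?expR_ge0.
have iF : mu.-integrable setT (EFin \o (fun t =>
    gauss1 b x0 t * half_wave k be t + gauss1 b x0 t * half_wave k be (t + h))).
  exact: (integrableD measurableT i1 i2').
have iL : mu.-integrable setT (EFin \o L).
  apply: (le_integrable measurableT _ _ iF); first exact/measurable_EFinP.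
  move=> t _; rewrite /= lee_fin ger0_norm// ger0_norm ?Lle//.
  exact: le_trans (Lle t).
apply: (@le_trans _ _ (\int[mu]_t L t)); last exact: le_Rintegral.
have iw : mu.-integrable setT (EFin \o (fun t => \1_I t * sin (k * (be - t)))).
  rewrite (_ : (fun t => _) = fun t => c0^-1 * L t); first exact: integrableMl_EFin.
  by apply/funext => t; rewrite /L mulKf// gt_eqF// expR_gt0.
rewrite RintegralZl// mulrC ler_wpM2l ?expR_ge0//.
rewrite -[2 / k]/(fine (2 / k)%:E) -(integral_half_period be k0) integral_mkcond.
rewrite /Rintegral le_eqVlt; apply/orP; left; apply/eqP; congr fine.
apply: eq_integral => t _; rewrite patchE indicE; case: ifPn => _.
  by rewrite mul1r.
by rewrite mul0r.
Qed.

End slice.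

Section halfspace.
Context {R : realType} {m : nat}.
Local Notation mu := (@lebesgue_measure R).
Local Notation nu := (@lebesgue_rV R).
Local Notation E := ('rV[R]_m.+1).

Definition gauss_pair (b : R) (x0 : E) (h : R) (x : E) : R :=
  gauss b x0 x + gauss b (x0 + h *: delta_mx 0 ord0) x.

Lemma gauss_pair_ge0 b x0 h x : 0 <= gauss_pair b x0 h x.
Proof. by rewrite addr_ge0 ?gauss_ge0. Qed.

Lemma measurable_gauss_pair b x0 h : measurable_fun setT (gauss_pair b x0 h).
Proof. by apply: measurable_funD; exact: measurable_gauss. Qed.

Lemma integrable_gauss_pair b x0 h : 0 < b ->
  (nu m.+1).-integrable setT (EFin \o gauss_pair b x0 h).
Proof. by move=> b0; exact: (integrableD measurableT (integrable_gauss _ b0) (integrable_gauss _ b0)). Qed.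

Lemma gauss_pair_cons b x0 h t y : gauss_pair b x0 h (rV_cons (t, y)) =
  (gauss1 b (x0 0 ord0) t + gauss1 b (x0 0 ord0 + h) t) * gauss b (rtail x0) y.
Proof.
have E0 : rtail (x0 + h *: delta_mx 0 ord0) = rtail x0.
  apply/rowP => i; rewrite !rtailE !mxE.
  by rewrite (_ : (lift ord0 i == ord0) = false)// andbF mulr0 addr0.
by rewrite /gauss_pair !gauss_cons E0 mulrDl !mxE !eqxx mulr1.
Qed.

Definition below (xi x0 : E) : set E := [set x | dotp xi (x - x0) <= 0].

(** First coordinate of the point above [y] on the hyperplane through [x0] orthogonal to [xi]: the
    supporting hyperplane as a graph over the last m coordinates. *)
Definition level (xi x0 : E) (y : 'rV[R]_m) : R :=
  x0 0 ord0 - dotp (rtail xi) (y - rtail x0) / xi 0 ord0.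

Lemma dotp_level (xi x0 x : E) : xi 0 ord0 != 0 ->
  dotp xi (x0 - x) = xi 0 ord0 * (level xi x0 (rtail x) - x 0 ord0).
Proof.
move=> k0; rewrite dotp_rVS rtailB !mxE /level.
rewrite -[rtail x0 - rtail x]opprB dotpNr; field; exact: k0.
Qed.

Lemma measurable_below xi x0 : measurable (below xi x0).
Proof.
have mf : measurable_fun setT (fun x : E => dotp xi (x - x0)).
  rewrite (_ : (fun x => _) = fun x : E => dotp xi x - dotp xi x0).
    by apply: measurable_funB => //; exact: measurable_dotp.
  by apply/funext => x; rewrite dotpBr.
have := mf measurableT `]-oo, 0]%classic (measurable_itv _).
by rewrite setTI.
Qed.

Lemma measurable_sin_dotp xi x0 : measurable_fun setT (fun x : E => sin (dotp xi (x0 - x))).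
Proof.
have mS : measurable_fun setT (@sin R).
  by apply: continuous_measurable_fun; exact: continuous_sin.
apply: (measurableT_comp mS).
rewrite (_ : (fun x => _) = fun x : E => dotp xi x0 - dotp xi x).
  by apply: measurable_funB => //; exact: measurable_dotp.
by apply/funext => x; rewrite dotpBr.
Qed.

Lemma integrable_gauss_pair_bound b x0 h (A : set E) (g : E -> R) :
  0 < b -> measurable A -> measurable_fun setT g -> (forall x, `|g x| <= 1) ->
  (nu m.+1).-integrable setT (EFin \o (fun x => \1_A x * (gauss_pair b x0 h x * g x))).
Proof.
move=> b0 mA mg g1.
apply: (le_integrable measurableT _ _ (integrable_gauss_pair x0 h b0)).
  apply/measurable_EFinP; apply: measurable_funM; first exact: measurable_indic.
  by apply: measurable_funM => //; exact: measurable_gauss_pair.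
move=> x _; rewrite /= lee_fin !normrM (ger0_norm (gauss_pair_ge0 _ _ _ _)).
rewrite indicE; case: (x \in A); rewrite ?normr1 ?normr0 ?mul0r ?gauss_pair_ge0//.
by rewrite mul1r ler_piMr// gauss_pair_ge0.
Qed.

Lemma indic_below (xi x0 : E) t y : 0 < xi 0 ord0 ->
  \1_(below xi x0) (rV_cons (t, y)) = \1_`]-oo, (level xi x0 y)] t :> R.
Proof.
move=> k0; rewrite !indicE.
have -> : (t \in `]-oo, (level xi x0 y)]%classic) = (t <= level xi x0 y).
  by rewrite mem_setE in_itv.
rewrite (_ : (_ \in below xi x0) = (t <= level xi x0 y))//.
have E0 : (dotp xi (rV_cons (t, y) - x0) <= 0) = (t <= level xi x0 y).
  rewrite -opprB dotpNr oppr_le0 dotp_level ?gt_eqF// rtail_cons rV_cons0.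
  by rewrite pmulr_rge0// subr_ge0.
by apply/idP/idP; rewrite inE /below /= E0.
Qed.

Lemma level_bound (xi x0 : E) y : 0 < xi 0 ord0 ->
  (forall j, `|xi 0 (lift ord0 j)| <= xi 0 ord0) ->
  `|level xi x0 y - x0 0 ord0| <= m%:R * enorm (y - rtail x0).
Proof.
move=> k0 xik; rewrite /level addrAC subrr add0r normrN normrM normfV (gtr0_norm k0).
rewrite ler_pdivrMr//; apply: le_trans (ler_norm_sum _ _ _) _.
apply: (@le_trans _ _ (\sum_(i < m) (xi 0 ord0 * enorm (y - rtail x0)))).
  apply: ler_sum => i _; rewrite normrM; apply: ler_pM => //; last exact: enorm_coord.
  by rewrite rtailE.
by rewrite sumr_const card_ord -[leLHS]mulr_natl mulrCA mulrC.
Qed.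

(** Apply [slice_lower] on each line. Its loss e^(-2 b (level - x0)^2) is controlled by
    [level_bound], and together with the tangential Gaussian it becomes a Gaussian in y of exponent
    b (1 + 2 m^2), whose integral is explicit. *)
Lemma halfspace_lower b (xi x0 : E) : 0 < b -> 0 < xi 0 ord0 ->
  (forall j, `|xi 0 (lift ord0 j)| <= xi 0 ord0) ->
  2 / xi 0 ord0 * expR (- (2 * b * (pi / xi 0 ord0) ^+ 2)) *
    Num.sqrt (pi / (b * (1 + 2 * m%:R ^+ 2))) ^+ m <=
  \int[nu m.+1]_x (\1_(below xi x0) x *
    (gauss_pair b x0 (pi / xi 0 ord0) x * sin (dotp xi (x0 - x)))).
Proof.
move=> b0 k0 xik; set k := xi 0 ord0; set h := pi / k.
have b1 : 0 < b * (1 + 2 * m%:R ^+ 2).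
  by rewrite mulr_gt0// ltr_pwDl// mulr_ge0// sqr_ge0.
have fE t y : \1_(below xi x0) (rV_cons (t, y)) *
    (gauss_pair b x0 h (rV_cons (t, y)) * sin (dotp xi (x0 - rV_cons (t, y)))) =
    gauss b (rtail x0) y * ((gauss1 b (x0 0 ord0) t + gauss1 b (x0 0 ord0 + h) t) *
      half_wave k (level xi x0 y) t).
  rewrite indic_below// gauss_pair_cons dotp_level ?gt_eqF// rtail_cons rV_cons0.
  by rewrite /half_wave; ring.
have i1 y : mu.-integrable setT (EFin \o (fun t =>
    (gauss1 b (x0 0 ord0) t + gauss1 b (x0 0 ord0 + h) t) * half_wave k (level xi x0 y) t)).
  rewrite (_ : (fun t => _) = fun t => gauss1 b (x0 0 ord0) t * half_wave k (level xi x0 y) t +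
      gauss1 b (x0 0 ord0 + h) t * half_wave k (level xi x0 y) t); last first.
    by apply/funext => t; rewrite mulrDl.
  exact: (integrableD measurableT (integrable_gauss1_half_wave (x0 0 ord0) k (level xi x0 y) b0)
    (integrable_gauss1_half_wave (x0 0 ord0 + h) k (level xi x0 y) b0)).
have iy y : mu.-integrable setT (EFin \o (fun t => \1_(below xi x0) (rV_cons (t, y)) *
    (gauss_pair b x0 h (rV_cons (t, y)) * sin (dotp xi (x0 - rV_cons (t, y)))))).
  under eq_fun do rewrite fE; exact: integrableMl_EFin.
have iF : (nu m.+1).-integrable setT (EFin \o (fun x => \1_(below xi x0) x *
    (gauss_pair b x0 h x * sin (dotp xi (x0 - x))))).
  apply: integrable_gauss_pair_bound => //; first exact: measurable_below.
    exact: measurable_sin_dotp.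
  by move=> x; exact: normr_sin_le1.
rewrite Rintegral_rVS//.
have iG := integrable_gauss (rtail x0) b1.
pose C := 2 / k * expR (- (2 * b * h ^+ 2)).
have -> : 2 / k * expR (- (2 * b * h ^+ 2)) * Num.sqrt (pi / (b * (1 + 2 * m%:R ^+ 2))) ^+ m =
    \int[nu m]_y (C * gauss (b * (1 + 2 * m%:R ^+ 2)) (rtail x0) y).
  by rewrite RintegralZl// /Rintegral integral_gauss.
apply: le_Rintegral => //.
- exact: integrableMl_EFin.
- apply: (@integrable_gauss_bound _ _ b (rtail x0) (2 * Num.sqrt (pi / b))) => //.
    exact: (measurableT_comp (fine_measurable measurableT) (measurable_fubini_G (integrable_rV_cons iF))).
  move=> y; under eq_Rintegral do rewrite fE.
  rewrite RintegralZl// normrM (ger0_norm (gauss_ge0 _ _ _)) mulrC ler_wpM2r ?gauss_ge0//.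
  apply: le_trans (le_normr_Rintegral measurableT (i1 y)) _.
  have g1 c := integrable_gauss1 c b0.
  have -> : 2 * Num.sqrt (pi / b) =
      \int[mu]_t (gauss1 b (x0 0 ord0) t + gauss1 b (x0 0 ord0 + h) t).
    rewrite RintegralD//; try exact: g1.
    by rewrite /Rintegral !integral_gauss1//=; ring.
  apply: le_Rintegral => //.
  - exact: integrable_abse (i1 y).
  - exact: (integrableD measurableT (g1 (x0 0 ord0)) (g1 (x0 0 ord0 + h))).
  move=> t _; rewrite normrM ger0_norm ?addr_ge0 ?gauss1_ge0//.
  by rewrite ler_piMr ?normr_half_wave_le1// addr_ge0 ?gauss1_ge0.
move=> y _; under eq_Rintegral do rewrite fE.
rewrite RintegralZl//.
apply: le_trans (ler_wpM2l (gauss_ge0 _ _ _) (slice_lower (x0 0 ord0) (level xi x0 y) b0 k0)).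
rewrite /C [leRHS]mulrCA -mulrA ler_pM2l; last by rewrite divr_gt0.
rewrite /gauss -!expRD ler_expR -enorm2.
have := level_bound x0 y k0 xik; rewrite -ler_sqr ?nnegrE ?mulr_ge0 ?enorm_ge0//.
rewrite real_normK ?num_real// exprMn => hl.
have := ler_wpM2l (ltW b0) hl; rewrite -/h; lra.
Qed.

End halfspace.

(** * The gap between the domain and its tangent half-space *)

Section error_bound.
Context {R : realType} {m : nat}.
Local Notation nu := (@lebesgue_rV R).
Local Notation E := ('rV[R]_m.+1).

(** In units u = rho / de the Gaussian is e^(-u^2/4) squared; one factor absorbs the power, since
    u^(al+1) <= 1 + u^2 <= 4 e^(u^2/4). *)
Lemma powR_gauss_bound (al de rho : R) : 0 < al -> al <= 1 -> 0 < de -> 0 <= rho ->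
  rho `^ al * rho * expR (- ((2 * de ^+ 2)^-1 * rho ^+ 2)) <=
  4 * (de `^ al * de) * expR (- ((2 * de ^+ 2)^-1 / 2 * rho ^+ 2)).
Proof.
move=> al0 al1 de0 rho0; pose u := rho / de.
have u0 : 0 <= u by rewrite divr_ge0// ltW.
have -> : rho = u * de by rewrite /u divfK// gt_eqF.
have -> : (2 * de ^+ 2)^-1 * (u * de) ^+ 2 = u ^+ 2 / 4 + u ^+ 2 / 4.
  by field; rewrite gt_eqF.
have -> : (2 * de ^+ 2)^-1 / 2 * (u * de) ^+ 2 = u ^+ 2 / 4.
  by field; rewrite gt_eqF.
rewrite powRM ?(ltW de0)// opprD expRD.
set e := expR _.
have ul : u `^ al * u <= 1 + u ^+ 2.
  have [u1|u1] := leP u 1.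
    apply: (@le_trans _ _ 1); last by rewrite lerDl sqr_ge0.
    have p1 : u `^ al <= 1.
      have <- : (1 : R) `^ al = 1 by rewrite powR1.
      by apply: ge0_ler_powR; rewrite ?nnegrE// ltW.
    by rewrite mulr_ile1 ?powR_ge0.
  apply: (@le_trans _ _ (u ^+ 2)); last by rewrite lerDr.
  rewrite expr2 ler_wpM2r// -[leRHS]powRr1//.
  by apply: ler_powR => //; exact: ltW.
have key : u `^ al * u * e <= 4.
  rewrite /e expRN ler_pdivrMr ?expR_gt0//.
  have := expR_ge1Dx (u ^+ 2 / 4); lra.
rewrite [leLHS](_ : _ = de `^ al * de * e * (u `^ al * u * e)); last by ring.
rewrite [leRHS](_ : _ = de `^ al * de * e * 4); last by ring.
by rewrite ler_wpM2l// !mulr_ge0 ?powR_ge0 ?expR_ge0// ltW.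
Qed.

Lemma measurable_rtail : measurable_fun setT (@rtail R m).
Proof. exact: (measurableT_comp measurable_snd (@measurable_rV_uncons R m)). Qed.

Lemma measurable_level_sub (xi x0 : E) : xi 0 ord0 != 0 ->
  measurable_fun setT (fun x : E => level xi x0 (rtail x) - x 0 ord0).
Proof.
move=> k0; rewrite (_ : (fun x => _) = fun x : E => (xi 0 ord0)^-1 * (dotp xi x0 - dotp xi x)).
  apply: measurable_funM => //; apply: measurable_funB => //; exact: measurable_dotp.
by apply/funext => x; rewrite -dotpBr dotp_level// mulKf.
Qed.

Lemma measurable_ge0 (f : E -> R) : measurable_fun setT f ->
  measurable [set x | 0 <= f x].
Proof.
move=> mf; have := mf measurableT `[0, +oo[%classic (measurable_itv _).
rewrite setTI (_ : f @^-1` _ = [set x | 0 <= f x])//.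
by apply/seteqP; split=> x; rewrite /= in_itv/= andbT.
Qed.

(** As the second centre is moved by at most r / 2, both distances are at least rho / 2. Half of the
    exponent b rho^2 / 4 gives e^(-b r^2 / 8) <= 8 / (b r^2), the other half remains as an
    integrable Gaussian. *)
Lemma far_bound b (x0 : E) h r x : 0 < b -> 0 < r -> 0 <= h -> h <= r / 2 ->
  r <= enorm (x - x0) ->
  gauss_pair b x0 h x <= 16 / (b * r ^+ 2) * gauss (b / 8) x0 x.
Proof.
move=> b0 r0 h0 hr xr; set rho := enorm (x - x0) in xr.
have rho0 : 0 <= rho by exact: enorm_ge0.
have main s : rho / 2 <= s -> expR (- (b * s ^+ 2)) <= 8 / (b * r ^+ 2) * gauss (b / 8) x0 x.
  move=> sl.
  have s2 : rho ^+ 2 / 4 <= s ^+ 2.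
    rewrite (_ : _ / 4 = (rho / 2) ^+ 2); last by field.
    by rewrite lerXn2r// nnegrE ?divr_ge0// (le_trans _ sl)// divr_ge0.
  apply: (@le_trans _ _ (expR (- (b * r ^+ 2 / 8)) * gauss (b / 8) x0 x)).
    rewrite /gauss -expRD ler_expR -enorm2 -/rho.
    have r2 : r ^+ 2 <= rho ^+ 2 by rewrite lerXn2r// nnegrE ltW.
    have := ler_wpM2l (ltW b0) s2; have := ler_wpM2l (ltW b0) r2; lra.
  rewrite ler_wpM2r ?gauss_ge0// expRN -[leRHS]invrK lef_pV2 ?posrE ?expR_gt0 ?invr_gt0 ?divr_gt0 ?mulr_gt0 ?exprn_gt0//.
  rewrite invfM invrK; apply: le_trans (expR_ge1Dx _).
  by rewrite mulrC lerDr.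
rewrite /gauss_pair (_ : 16 / _ * _ = 8 / (b * r ^+ 2) * gauss (b / 8) x0 x +
  8 / (b * r ^+ 2) * gauss (b / 8) x0 x); last by rewrite -mulrDl; congr (_ * _); field; rewrite !gt_eqF.
apply: lerD.
  rewrite [gauss b]/gauss -enorm2 -/rho; apply: main.
  by rewrite ler_pdivrMr// ler_peMr// ler1n.
rewrite [gauss b]/gauss -enorm2; apply: main.
have e1 : enorm (h *: (delta_mx 0 ord0 : E)) = h.
  by rewrite enormZ ger0_norm// /enorm dotp_delta mxE !eqxx sqrtr1 mulr1.
have := enormD (x - (x0 + h *: delta_mx 0 ord0)) (h *: delta_mx 0 ord0).
rewrite (_ : x - _ + _ = x - x0); last by rewrite opprD addrA subrK.
rewrite e1 -/rho; lra.
Qed.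

Lemma measurable_gap (xi x0 : E) (w : 'rV[R]_m -> R) : 0 < xi 0 ord0 ->
  measurable_fun setT w ->
  measurable [set x : E | 0 <= level xi x0 (rtail x) - x 0 ord0 <= w (rtail x)].
Proof.
move=> k0 mw; set N := [set x | _].
have ml := measurable_level_sub x0 (lt0r_neq0 k0).
have mw' : measurable_fun setT (fun x : E => w (rtail x)).
  exact: (measurableT_comp mw measurable_rtail).
rewrite (_ : N = [set x | 0 <= level xi x0 (rtail x) - x 0 ord0] `&`
  [set x | 0 <= w (rtail x) - (level xi x0 (rtail x) - x 0 ord0)]); last first.
  apply/seteqP; split=> x.
    by move=> /andP[h1 h2]; split => //=; rewrite subr_ge0.
  by move=> [h1 h2]; apply/andP; split => //; rewrite -subr_ge0.
apply: measurableI; apply: measurable_ge0 => //.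
exact: measurable_funB.
Qed.

Lemma near_integral b (xi x0 : E) (w : 'rV[R]_m -> R) : 0 < b -> 0 < xi 0 ord0 ->
  measurable_fun setT w -> (forall y, 0 <= w y) ->
  (\int[nu m.+1]_x (\1_[set x | 0 <= level xi x0 (rtail x) - x 0 ord0 <= w (rtail x)] x *
     (2 * gauss b (rtail x0) (rtail x)))%:E =
   \int[nu m]_y (2 * gauss b (rtail x0) y * w y)%:E)%E.
Proof.
move=> b0 k0 mw w0; set N := [set x | _].
have mN : measurable N by exact: measurable_gap.
have mg : measurable_fun setT (fun x : E => gauss b (rtail x0) (rtail x)).
  exact: (measurableT_comp (measurable_gauss _ _) measurable_rtail).
rewrite ge0_integral_rVS; first last.
- by move=> x; rewrite lee_fin mulr_ge0// mulr_ge0// gauss_ge0.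
- apply/measurable_EFinP; apply: measurable_funM; first exact: measurable_indic.
  exact: measurable_funM.
apply: eq_integral => y _.
have NE t : \1_N (rV_cons (t, y)) =
    \1_`[(level xi x0 y - w y), (level xi x0 y)] t :> R.
  rewrite !indicE (_ : (t \in _) = (level xi x0 y - w y <= t <= level xi x0 y)); last first.
    by rewrite mem_setE in_itv.
  rewrite (_ : (_ \in N) = (level xi x0 y - w y <= t <= level xi x0 y))//.
  have E0 : (0 <= level xi x0 (rtail (rV_cons (t, y))) - (rV_cons (t, y)) 0 ord0 <=
      w (rtail (rV_cons (t, y)))) = (level xi x0 y - w y <= t <= level xi x0 y).
    rewrite rtail_cons rV_cons0.
    by apply/idP/idP => /andP[h1 h2]; apply/andP; split; lra.
  by apply/idP/idP; rewrite inE /N /= E0.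
under eq_integral do rewrite NE rtail_cons mulrC EFinM.
rewrite ge0_integralZl//=; first last.
- by rewrite lee_fin mulr_ge0 ?gauss_ge0.
- by apply/measurable_EFinP; exact: measurable_indic.
rewrite integral_indic//= setIT lebesgue_measure_itv/= lte_fin.
case: ifPn => [_|]; first by rewrite -EFinB -EFinM; congr (_ * _)%:E; ring.
rewrite ltrBlDr ltrDl -leNgt => w0'.
have -> : w y = 0 by apply/eqP; rewrite eq_le w0' w0.
by rewrite mulr0 mule0.
Qed.

End error_bound.

Section lower_bound.
Context {R : realType} {m : nat}.
Local Notation nu := (@lebesgue_rV R).
Local Notation E := ('rV[R]_m.+1).

(** The dominant first coordinate keeps all frequencies in a fixed cone, so the supporting
    hyperplanes are graphs over the same coordinates with slopes at most 1. As [L] grows the boxes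
    leave every bounded set. *)
Definition freq_box (L : R) : set E :=
  [set xi | L <= xi 0 ord0 <= 2 * L /\ forall j, `|xi 0 (lift ord0 j)| <= L].

Lemma enorm_box (L : R) (xi : E) : 0 < L -> freq_box L xi ->
  enorm xi <= (m%:R + 1) * xi 0 ord0.
Proof.
move=> L0 [/andP[l1 l2] xj]; have k0 : 0 < xi 0 ord0 by exact: lt_le_trans l1.
have M0 : 0 <= m%:R :> R by [].
rewrite -ler_sqr ?nnegrE ?enorm_ge0 ?mulr_ge0 ?addr_ge0 ?(ltW k0)//.
rewrite enorm2 dotp_rVS -expr2.
have h : dotp (rtail xi) (rtail xi) <= m%:R * xi 0 ord0 ^+ 2.
  apply: (@le_trans _ _ (\sum_(i < m) xi 0 ord0 ^+ 2)).
    apply: ler_sum => i _; rewrite -expr2 -(real_normK (num_real (rtail xi 0 i))).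
    rewrite lerXn2r// ?nnegrE ?(ltW k0)// rtailE; exact: le_trans (xj i) l1.
  by rewrite sumr_const card_ord -[leLHS]mulr_natl.
rewrite exprMn; apply: (@le_trans _ _ ((m%:R + 1) * xi 0 ord0 ^+ 2)); first by lra.
by rewrite ler_wpM2r ?sqr_ge0// expr2 ler_peMr// ?addr_ge0// lerDr.
Qed.

Lemma enorm_rtail_le (x : E) : enorm x <= `|x 0 ord0| + enorm (rtail x).
Proof.
rewrite -ler_sqr ?nnegrE ?enorm_ge0 ?addr_ge0 ?enorm_ge0//.
rewrite enorm2 dotp_rVS -expr2 sqrrD enorm2 real_normK ?num_real//.
by rewrite addrAC -addrA lerD2l lerDl mulrn_wge0// mulr_ge0 ?enorm_ge0.
Qed.

(* Near [x0] the gap between the half-space and [D] is thin in terms of the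
   tangential distance alone, because [K * (m + 1) * r^al <= 1/2]. *)
Lemma thin_gap (al K L r : R) (D : set E) (xi x0 x : E) :
  0 < al -> 0 < K -> 0 < L -> 0 < r -> freq_box L xi ->
  K * (m%:R + 1) * r `^ al <= 1 / 2 ->
  (dotp xi (x - x0) < - (K * enorm xi * (enorm (x - x0) `^ al * enorm (x - x0))) -> D x) ->
  below xi x0 x -> ~ D x -> enorm (x - x0) < r ->
  level xi x0 (rtail x) - x 0 ord0 <=
    K * (m%:R + 1) * ((2 * (1 + m%:R)) `^ al * (2 * (1 + m%:R))) *
    (enorm (rtail x - rtail x0) `^ al * enorm (rtail x - rtail x0)).
Proof.
move=> al0 K0 L0 r0 bx Kr reg blw nD xr.
have [/andP[l1 l2] xj] := bx; have k0 : 0 < xi 0 ord0 by exact: lt_le_trans l1.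
have xj' j : `|xi 0 (lift ord0 j)| <= xi 0 ord0 by exact: le_trans (xj j) l1.
have M0 : 0 <= m%:R :> R by [].
set rho := enorm (x - x0) in xr reg *; have rho0 : 0 <= rho by exact: enorm_ge0.
set rp := enorm (rtail x - rtail x0); have rp0 : 0 <= rp by exact: enorm_ge0.
set tau := level _ _ _ - _.
have tauE : dotp xi (x - x0) = - (xi 0 ord0 * tau).
  by rewrite -opprB dotpNr dotp_level ?gt_eqF.
have P0 : 0 <= rho `^ al * rho by rewrite mulr_ge0 ?powR_ge0.
have t1 : tau <= K * (m%:R + 1) * (rho `^ al * rho).
  rewrite -(ler_pM2l k0); have : ~~ (dotp xi (x - x0) < - (K * enorm xi * (rho `^ al * rho))).
    by apply/negP => /reg.
  rewrite -leNgt tauE lerN2 => h; apply: le_trans h _.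
  rewrite [leRHS](_ : _ = K * ((m%:R + 1) * xi 0 ord0) * (rho `^ al * rho)); last by ring.
  by rewrite ler_wpM2r// ler_wpM2l ?(ltW K0)//; exact: enorm_box bx.
have tau0 : 0 <= tau by move: blw; rewrite /below /= tauE oppr_le0 pmulr_rge0.
have r1 : rho `^ al * rho <= r `^ al * rho.
  by rewrite ler_wpM2r//; apply: ge0_ler_powR; rewrite ?nnegrE// ltW.
have lb := level_bound x0 (rtail x) k0 xj'.
have xc : `|(x - x0) 0 ord0| <= m%:R * rp + tau.
  rewrite !mxE (_ : x 0 ord0 - x0 0 ord0 = (level xi x0 (rtail x) - x0 0 ord0) - tau).
    by apply: le_trans (ler_normB _ _) _; rewrite (ger0_norm tau0) lerD2r.
  by rewrite /tau; ring.
(* The first coordinate of x - x0 is at most m rp + tau and tau <= rho / 2, so rho <= (1 + m) rp +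
   rho / 2. *)
have rr : rho <= 2 * (1 + m%:R) * rp.
  have := enorm_rtail_le (x - x0); rewrite rtailB -/rp -/rho.
  have : tau <= 1 / 2 * rho.
    apply: le_trans t1 _; apply: (@le_trans _ _ (K * (m%:R + 1) * (r `^ al * rho))).
      by rewrite ler_wpM2l// mulr_ge0 ?addr_ge0// ltW.
    by rewrite mulrA; exact: ler_wpM2r.
  lra.
apply: le_trans t1 _; rewrite -[leRHS]mulrA ler_wpM2l ?mulr_ge0 ?addr_ge0 ?(ltW K0)//.
have pE : (2 * (1 + m%:R) * rp) `^ al = (2 * (1 + m%:R)) `^ al * rp `^ al.
  by rewrite powRM// mulr_ge0 ?addr_ge0.
rewrite [leRHS](_ : _ = ((2 * (1 + m%:R)) * rp) `^ al * ((2 * (1 + m%:R)) * rp)); last first.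
  by rewrite pE; ring.
apply: ler_pM => //; first exact: powR_ge0.
by apply: ge0_ler_powR; rewrite ?nnegrE ?mulr_ge0 ?addr_ge0// ltW.
Qed.

(** Within distance [r] the missing part lies in a slab of thickness of order |y - y0|^(1+al) over
    tangential coordinates y, which gives de^(1+al) de^m; the Gaussian tail beyond [r] gives de^3
    de^m. The factor 1 takes the place of the sine, which is bounded by it. *)
Lemma gap_integral (al K2 de r h : R) (D : set E) (xi x0 : E) :
  open D -> 0 < al -> al <= 1 -> 0 <= K2 -> 0 < de -> 0 < r -> 0 <= h -> h <= r / 2 ->
  0 < xi 0 ord0 ->
  (forall x, below xi x0 x -> ~ D x -> enorm (x - x0) < r ->
    level xi x0 (rtail x) - x 0 ord0 <=
      K2 * (enorm (rtail x - rtail x0) `^ al * enorm (rtail x - rtail x0))) ->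
  \int[nu m.+1]_x (\1_(below xi x0 `\` D) x * (gauss_pair (2 * de ^+ 2)^-1 x0 h x * 1)) <=
  8 * K2 * (de `^ al * de) * (2 * Num.sqrt pi * de) ^+ m +
  32 / r ^+ 2 * de ^+ 2 * (4 * Num.sqrt pi * de) ^+ m.+1.
Proof.
move=> oD al0 al1 K20 de0 r0 h0 hr k0 gap.
set b := (2 * de ^+ 2)^-1; have b0 : 0 < b by rewrite invr_gt0 mulr_gt0// exprn_gt0.
have mB : measurable (below xi x0 `\` D).
  by apply: measurableD; [exact: measurable_below|exact: open_measurable_rV].
pose w (y : 'rV[R]_m) := K2 * (enorm (y - rtail x0) `^ al * enorm (y - rtail x0)).
have me : measurable_fun setT (fun y : 'rV[R]_m => enorm (y - rtail x0)).
  by apply: continuous_measurable_rV; exact: continuous_enorm_sub.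
have mw : measurable_fun setT w.
  apply: measurable_funM => //; apply: measurable_funM => //.
  exact: (measurableT_comp (measurable_powR al) me).
have w0 y : 0 <= w y by rewrite !mulr_ge0 ?powR_ge0 ?enorm_ge0.
pose N := [set x : E | 0 <= level xi x0 (rtail x) - x 0 ord0 <= w (rtail x)].
pose near_ x := \1_N x * (2 * gauss b (rtail x0) (rtail x)).
pose far x := 16 / (b * r ^+ 2) * gauss (b / 8) x0 x.
have near0 x : 0 <= near_ x by rewrite mulr_ge0// mulr_ge0// gauss_ge0.
have far0 x : 0 <= far x by rewrite mulr_ge0 ?gauss_ge0// divr_ge0// mulr_ge0 ?sqr_ge0 ?ltW.
have pw x : \1_(below xi x0 `\` D) x * (gauss_pair b x0 h x * 1) <= near_ x + far x.
  rewrite mulr1 indicE; case: (boolP (x \in _)) => [|_]; last by rewrite mul0r addr_ge0.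
  rewrite inE => -[Bx nDx]; rewrite mul1r.
  have [xr|xr] := ltP (enorm (x - x0)) r; last first.
    by apply: le_trans (far_bound b0 r0 h0 hr xr) _; rewrite lerDr.
  apply: (@le_trans _ _ (near_ x)); last by rewrite lerDl.
  have Nx : x \in N.
    rewrite inE /N /= gap// andbT -(pmulr_rge0 _ k0) -dotp_level ?gt_eqF//.
    by rewrite -opprB dotpNr oppr_ge0.
  rewrite /near_ indicE Nx mul1r /gauss_pair.
  (* The factor in the first coordinate is bounded by 1; both Gaussians of the pair have the same
     tangential factor, hence the 2 in [near_]. *)
  have g1 c : rtail c = rtail x0 -> gauss b c x <= gauss b (rtail x0) (rtail x).
    move=> ct; rewrite gauss_rVS ct ler_piMl ?gauss_ge0// /gauss1 -expR0 ler_expR oppr_le0.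
    by rewrite mulr_ge0 ?sqr_ge0// ltW.
  rewrite mulr_natl mulr2n; apply: lerD; apply: g1 => //.
  apply/rowP => i; rewrite !rtailE !mxE.
  by rewrite (_ : (lift ord0 i == ord0) = false)// andbF mulr0 addr0.
have mN : measurable_fun setT near_.
  apply: measurable_funM.
    by apply: measurable_indic; exact: measurable_gap.
  apply: measurable_funM => //.
  exact: (measurableT_comp (measurable_gauss _ _) measurable_rtail).
have mfar : measurable_fun setT far by apply: measurable_funM => //; exact: measurable_gauss.
have farE : (\int[nu m.+1]_x (far x)%:E =
    (32 / r ^+ 2 * de ^+ 2 * (4 * Num.sqrt pi * de) ^+ m.+1)%:E)%E.
  under eq_integral do rewrite EFinM.
  rewrite ge0_integralZl//=; first last.
  - by rewrite lee_fin divr_ge0// mulr_ge0 ?sqr_ge0 ?ltW.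
  - by move=> x _; exact: gauss_ge0.
  - by apply/measurable_EFinP; exact: measurable_gauss.
  rewrite integral_gauss ?divr_gt0// -EFinM; congr (_ * _ ^+ _)%:E.
    by rewrite /b; field; rewrite !gt_eqF.
  rewrite (_ : pi / (b / 8) = (4 * de) ^+ 2 * pi); last by rewrite /b; field; rewrite gt_eqF.
  by rewrite sqrtrM ?sqr_ge0// sqrtr_sqr gtr0_norm ?mulr_gt0//; ring.
have nearE : (\int[nu m.+1]_x (near_ x)%:E <=
    (8 * K2 * (de `^ al * de) * (2 * Num.sqrt pi * de) ^+ m)%:E)%E.
  rewrite near_integral//.
  have E1 : (8 * K2 * (de `^ al * de) * (2 * Num.sqrt pi * de) ^+ m)%:E =
      (\int[nu m]_y (8 * K2 * (de `^ al * de) * gauss (b / 2) (rtail x0) y)%:E)%E.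
    under eq_integral do rewrite EFinM.
    rewrite ge0_integralZl//=; first last.
    - by rewrite lee_fin !mulr_ge0 ?powR_ge0// ltW.
    - by move=> x _; exact: gauss_ge0.
    - by apply/measurable_EFinP; exact: measurable_gauss.
    rewrite integral_gauss ?divr_gt0// -EFinM; congr (_ * _ ^+ _)%:E.
    rewrite (_ : pi / (b / 2) = (2 * de) ^+ 2 * pi); last by rewrite /b; field; rewrite gt_eqF.
    by rewrite sqrtrM ?sqr_ge0// sqrtr_sqr gtr0_norm ?mulr_gt0//; ring.
  rewrite E1; apply: ge0_le_integral => //.
  - by move=> y _; rewrite lee_fin mulr_ge0// mulr_ge0// gauss_ge0.
  - apply/measurable_EFinP; apply: measurable_funM => //.
    by apply: measurable_funM => //; exact: measurable_gauss.
  - by apply/measurable_EFinP; apply: measurable_funM => //; exact: measurable_gauss.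
  move=> y _; rewrite lee_fin.
  have := powR_gauss_bound al0 al1 de0 (enorm_ge0 (y - rtail x0)).
  rewrite -/b enorm2 -/(gauss b (rtail x0) y) -/(gauss (b / 2) (rtail x0) y) => h1.
  have K22 : 0 <= 2 * K2 by rewrite mulr_ge0.
  have := ler_wpM2l K22 h1; rewrite /w; lra.
rewrite /Rintegral -lee_fin fineK; last first.
  apply: (@integrable_fin_num _ _ _ (nu m.+1)) => //.
  by apply: integrable_gauss_pair_bound => // x; rewrite normr1.
apply: (@le_trans _ _ (\int[nu m.+1]_x ((near_ x)%:E + (far x)%:E))%E).
  apply: ge0_le_integral => //.
  - move=> x _; rewrite lee_fin mulr_ge0// mulr1; exact: gauss_pair_ge0.
  - apply/measurable_EFinP; apply: measurable_funM; first exact: measurable_indic.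
    by apply: measurable_funM => //; exact: measurable_gauss_pair.
  - by apply/measurable_EFinP; exact: measurable_funD.
  by move=> x _; rewrite lee_fin.
rewrite ge0_integralD//; first last.
- exact/measurable_EFinP.
- by move=> x _; rewrite lee_fin.
- exact/measurable_EFinP.
- by move=> x _; rewrite lee_fin.
by rewrite farE EFinD leeD.
Qed.

End lower_bound.

(** * Lower bound for the localized indicator *)

Section wave_lower_bound.
Context {R : realType} {m : nat}.
Local Notation nu := (@lebesgue_rV R).
Local Notation E := ('rV[R]_m.+1).

Lemma powR_lt_ex (al e : R) : 0 < al -> 0 < e -> exists2 d, 0 < d &
  forall x, 0 <= x -> x <= d -> x `^ al <= e.
Proof.
move=> al0 e0; exists (e `^ al^-1); first by rewrite powR_gt0.
move=> x x0 xd; rewrite -[leRHS](powRr1 (ltW e0)) -[X in _ <= e `^ X](mulVf (lt0r_neq0 al0)) powRrM.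
by apply: ge0_ler_powR; rewrite ?nnegrE ?powR_ge0// ltW.
Qed.

(** Since [D] lies in the half-space, replacing one by the other costs only the integral over the
    missing part, where the sine is at most 1. *)
Lemma half_space_split (b h : R) (D : set E) (xi x0 : E) : 0 < b -> open D ->
  (forall x, D x -> dotp xi (x - x0) <= 0) ->
  \int[nu m.+1]_x (\1_(below xi x0) x * (gauss_pair b x0 h x * sin (dotp xi (x0 - x)))) -
  \int[nu m.+1]_x (\1_(below xi x0 `\` D) x * (gauss_pair b x0 h x * 1)) <=
  \int[nu m.+1]_x (\1_D x * (gauss_pair b x0 h x * sin (dotp xi (x0 - x)))).
Proof.
move=> b0 oD sup.
have mD : measurable D by exact: open_measurable_rV.
have mB := measurable_below xi x0.
have ms := measurable_sin_dotp xi x0.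
have i1 := integrable_gauss_pair_bound x0 h b0 mB ms (fun x => normr_sin_le1 _).
have i2 := integrable_gauss_pair_bound x0 h b0 mD ms (fun x => normr_sin_le1 _).
have i3 : (nu m.+1).-integrable setT (EFin \o (fun x : E => \1_(below xi x0 `\` D) x * (gauss_pair b x0 h x * 1))).
  apply: (@integrable_gauss_pair_bound _ _ _ _ _ _ (cst 1)) => //; first exact: measurableD.
  by move=> x; rewrite normr1.
rewrite -RintegralB//; apply: le_Rintegral => //.
  exact: (integrableB measurableT i1 i3).
move=> x _; have W0 := gauss_pair_ge0 b x0 h x.
have sl : sin (dotp xi (x0 - x)) <= 1 by exact: sin_le1.
rewrite !indicE in_setD; have [Dx|nDx] := boolP (x \in D).
  have -> : (x \in below xi x0) by rewrite inE; apply: sup; rewrite -inE.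
  by rewrite andbF mul0r subr0.
rewrite andbT mul0r; case: (_ \in _); last by rewrite !mul0r subr0.
by rewrite !mul1r -mulrBr mulr_ge0_le0// subr_le0.
Qed.

(** The half-space term is at least c1 de^m / L. The constants are arranged so that the slab error
    and the tail error are each at most a quarter of it, which leaves c1 / 2. *)
Lemma wave_lower_bound (al : R) (D : set E) : 0 < al -> al <= 1 ->
  open D -> D !=set0 -> bounded_set D -> C1alpha_boundary al D ->
  exists eps c d0, [/\ 0 < eps, 0 < c, 0 < d0 &
    forall de L, 0 < de -> de < d0 -> L = eps / (de `^ al * de) ->
    forall xi, freq_box L xi -> exists x0,
      c * de ^+ m / L <= \int[nu m.+1]_x (\1_D x *
        (gauss_pair (2 * de ^+ 2)^-1 x0 (pi / xi 0 ord0) x * sin (dotp xi (x0 - x))))].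
Proof.
move=> al0 al1 oD D0 bD cD.
have [r' [K [r'0 K0 reg]]] := support_region al0 oD D0 bD cD.
have M0 : 0 <= m%:R :> R by [].
have KM0 : 0 < K * (m%:R + 1) by rewrite mulr_gt0// ltr_wpDl.
have e20 : 0 < (2 * (K * (m%:R + 1)))^-1 by rewrite invr_gt0 mulr_gt0.
have [r2 r20 r2P] := powR_lt_ex al0 e20.
pose r := Num.min r' r2; have r0 : 0 < r by rewrite lt_min r'0.
have Kr : K * (m%:R + 1) * r `^ al <= 1 / 2.
  have := r2P r (ltW r0); rewrite ge_min lexx orbT => /(_ isT) h.
  apply: le_trans (ler_wpM2l (ltW KM0) h) _.
  by rewrite le_eqVlt; apply/orP; left; apply/eqP; field; rewrite !gt_eqF// ltr_wpDl.
pose A := 2 * (1 + m%:R) : R.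
have A0 : 0 < A by rewrite mulr_gt0// ltr_pwDl.
pose K2 := K * (m%:R + 1) * (A `^ al * A).
have K20 : 0 < K2 by rewrite !mulr_gt0 ?powR_gt0// ltr_wpDl.
have sp0 : 0 < Num.sqrt pi :> R by rewrite sqrtr_gt0 pi_gt0.
have q0 : 0 < 1 + 2 * m%:R ^+ 2 :> R by rewrite ltr_pwDl// mulr_ge0 ?sqr_ge0.
(* The factor e^(-1) is the loss from the half-period shift, once that shift is at most [de]. *)
pose c1 : R := expR (-1) * Num.sqrt (2 * pi / (1 + 2 * m%:R ^+ 2)) ^+ m.
have c10 : 0 < c1.
  apply: mulr_gt0; first exact: expR_gt0.
  by rewrite exprn_gt0// sqrtr_gt0; apply: divr_gt0 => //; rewrite mulr_gt0 ?pi_gt0.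
pose C2 : R := 8 * K2 * (2 * Num.sqrt pi) ^+ m.
have C20 : 0 < C2 by apply: mulr_gt0; [rewrite mulr_gt0|rewrite exprn_gt0// mulr_gt0].
pose C3 : R := 32 / r ^+ 2 * (4 * Num.sqrt pi) ^+ m.+1.
have C30 : 0 < C3.
  by apply: mulr_gt0; [rewrite divr_gt0// exprn_gt0|rewrite exprn_gt0// mulr_gt0].
(* As de^(1+al) = eps / L, the slab error C2 de^(1+al) de^m is then exactly a quarter of c1 de^m /
   L. *)
pose eps := c1 / (4 * C2).
have eps0 : 0 < eps by rewrite divr_gt0// mulr_gt0.
have epi : 0 < eps / pi by rewrite divr_gt0 ?pi_gt0.
(* Below [d1] one has pi / L <= de, so the half-period shift does not exceed the Gaussian width. *)
have [d1 d10 d1P] := powR_lt_ex al0 epi.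
(* Below [d2] the tail error C3 de^3 de^m is at most a quarter of c1 de^m / L, given de^2 L <=
   eps. *)
pose d2 := c1 / (4 * (C3 * eps)).
have d20 : 0 < d2 by apply: divr_gt0 => //; rewrite mulr_gt0// mulr_gt0.
exists eps, (c1 / 2), (Num.min (Num.min d1 d2) (Num.min (r / 2) 1)); split=> //.
- by rewrite divr_gt0.
- by rewrite !lt_min d10 d20 ltr01 andbT /= divr_gt0.
move=> de L de0; rewrite !lt_min => /andP[/andP[ded1 ded2] /andP[der de1]] LE xi bx.
have P0 : 0 < de `^ al * de by rewrite mulr_gt0 ?powR_gt0.
have L0 : 0 < L by rewrite LE divr_gt0.
have [/andP[l1 l2] xj] := bx; have k0 : 0 < xi 0 ord0 by exact: lt_le_trans l1.
have xi0 : xi != 0 by apply: contraTneq k0 => ->; rewrite mxE ltxx.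
have [x0 [sup regx]] := reg xi xi0; exists x0.
set b := (2 * de ^+ 2)^-1; set h := pi / xi 0 ord0.
have b0 : 0 < b by rewrite invr_gt0 mulr_gt0// exprn_gt0.
have h0 : 0 < h by rewrite divr_gt0 ?pi_gt0.
have hd : h <= de.
  rewrite /h ler_pdivrMr//; apply: (@le_trans _ _ (de * L)); last by rewrite ler_pM2l.
  have := d1P de (ltW de0) (ltW ded1); rewrite ler_pdivlMr ?pi_gt0// => hp.
  rewrite LE (_ : de * (eps / (de `^ al * de)) = eps / de `^ al); last first.
    by field; rewrite !gt_eqF// powR_gt0.
  by rewrite ler_pdivlMr ?powR_gt0// mulrC.
have hr : h <= r / 2 by apply: le_trans hd (ltW der).
apply: le_trans (half_space_split h b0 oD sup).
have gap x : below xi x0 x -> ~ D x -> enorm (x - x0) < r ->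
    level xi x0 (rtail x) - x 0 ord0 <=
    K2 * (enorm (rtail x - rtail x0) `^ al * enorm (rtail x - rtail x0)).
  move=> Bx nDx xr; apply: (thin_gap al0 K0 L0 r0 bx Kr _ Bx nDx xr).
  by apply: regx; apply: lt_le_trans xr _; rewrite ge_min lexx.
have gI := gap_integral oD al0 al1 (ltW K20) de0 r0 (ltW h0) hr k0 gap.
have xj' j : `|xi 0 (lift ord0 j)| <= xi 0 ord0 by exact: le_trans (xj j) l1.
have hL := halfspace_lower x0 b0 k0 xj'.
rewrite -/h in hL.
apply: (@le_trans _ _ (c1 * de ^+ m / L - (C2 * (de `^ al * de) * de ^+ m +
    C3 * de ^+ 3 * de ^+ m))); last first.
  apply: lerB.
    apply: le_trans hL.
    have e1 : expR (-1) <= expR (- (2 * b * h ^+ 2)).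
      rewrite ler_expR lerN2 /b.
      rewrite (_ : 2 * _ * _ = h ^+ 2 / de ^+ 2); last by field; rewrite gt_eqF.
      by rewrite ler_pdivrMr ?exprn_gt0// mul1r lerXn2r// nnegrE ltW.
    have s1 : Num.sqrt (pi / (b * (1 + 2 * m%:R ^+ 2))) = Num.sqrt (2 * pi / (1 + 2 * m%:R ^+ 2)) * de.
      rewrite (_ : pi / _ = 2 * pi / (1 + 2 * m%:R ^+ 2) * de ^+ 2); last first.
        by rewrite /b; field; rewrite !gt_eqF.
      rewrite sqrtrM; first by rewrite sqrtr_sqr gtr0_norm.
      by rewrite divr_ge0 ?(ltW q0)// mulr_ge0// pi_ge0.
    rewrite s1 [(_ * de) ^+ m]exprMn /c1.
    have L2 : L^-1 <= 2 / xi 0 ord0.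
      by rewrite ler_pdivlMr// mulrC ler_pdivrMr.
    rewrite [leLHS](_ : _ = L^-1 * expR (-1) * (Num.sqrt (2 * pi / (1 + 2 * m%:R ^+ 2)) ^+ m * de ^+ m)); last by ring.
    rewrite ler_wpM2r ?mulr_ge0 ?exprn_ge0 ?sqrtr_ge0// ?(ltW de0)//.
    by apply: ler_pM; rewrite ?expR_ge0// invr_ge0 ltW.
  apply: le_trans gI _; rewrite /C2 /C3 !exprMn (exprS de m).
  by rewrite le_eqVlt; apply/orP; left; apply/eqP; ring.
have dm0 : 0 <= de ^+ m by rewrite exprn_ge0// ltW.
have E1 : de `^ al * de = eps / L by rewrite LE; field; rewrite !gt_eqF// powR_gt0.
have E2 : C2 * (de `^ al * de) = c1 / 4 / L.
  by rewrite E1 /eps; field; rewrite !gt_eqF.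
(* This uses al <= 1, and makes de^2 L = eps de^(1-al) at most [eps]. *)
have dea : de <= de `^ al.
  rewrite -[leLHS](powRr1 (ltW de0)); apply: ger_powR => //.
  by rewrite de0 ltW.
have E3 : C3 * de ^+ 3 <= c1 / 4 / L.
  rewrite ler_pdivlMr//.
  have hL3 : de ^+ 2 * L <= eps.
    rewrite LE (_ : de ^+ 2 * (eps / (de `^ al * de)) = eps * (de / de `^ al)); last first.
      by field; rewrite !gt_eqF// powR_gt0.
    by rewrite ler_piMr ?(ltW eps0)// ler_pdivrMr ?powR_gt0// mul1r.
  apply: (@le_trans _ _ (C3 * eps * d2)).
    rewrite [leLHS](_ : _ = C3 * (de ^+ 2 * L * de)); last by ring.
    rewrite -[leRHS]mulrA ler_pM2l//; apply: ler_pM => //; last exact: ltW.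
      by rewrite mulr_ge0 ?sqr_ge0// ltW.
    exact: ltW.
  by rewrite le_eqVlt; apply/orP; left; apply/eqP; rewrite /d2; field; rewrite !gt_eqF.
rewrite -mulrDl [c1 * _ / L](_ : _ = c1 / L * de ^+ m); last by ring.
rewrite [c1 / 2 * _ / L](_ : _ = c1 / 2 / L * de ^+ m); last by ring.
rewrite -mulrBl ler_wpM2r// E2.
have : 0 < c1 / L by rewrite divr_gt0.
lra.
Qed.

End wave_lower_bound.

(** * Frequency boxes *)

Section frequency_box.
Context {R : realType}.
Local Notation nu := (@lebesgue_rV R).

Definition cube m (L : R) : set 'rV[R]_m := [set y | forall j, `|y 0 j| <= L].

Lemma measurable_cube m L : measurable (@cube m L).
Proof.
rewrite (_ : cube L = \bigcap_(j in [set: 'I_m]) (rV_coord j @^-1` `[(- L), L])); last first.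
  apply/seteqP; split=> y.
    by move=> yL j _; rewrite /rV_coord /= in_itv/= -ler_norml.
  by move=> yL j; have := yL j I; rewrite /rV_coord /= in_itv/= -ler_norml.
apply: fin_bigcap_measurable => // j _.
by rewrite -[X in measurable X]setTI; apply: measurable_rV_coord.
Qed.

Lemma cube_rVS m L t (y : 'rV[R]_m) :
  \1_(cube L) (rV_cons (t, y)) = \1_`[(- L), L] t * \1_(cube L) y :> R.
Proof.
rewrite !indicE -natrM mulnb; congr (_%:R); congr nat_of_bool.
rewrite (_ : (t \in _) = (`|t| <= L)); last by rewrite mem_setE in_itv/= -ler_norml.
apply/idP/idP.
  rewrite inE => h; apply/andP; split.
    by have := h ord0; rewrite rV_cons0.
  by rewrite inE => j; have := h (lift ord0 j); rewrite -rtailE rtail_cons.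
move=> /andP[tL]; rewrite !inE => yL j.
case: (unliftP ord0 j) => [j' ->|->]; last by rewrite rV_cons0.
by rewrite -rtailE rtail_cons.
Qed.

Lemma measure_cube m L : 0 < L -> nu m (cube L) = ((2 * L) ^+ m)%:E.
Proof.
move=> L0; rewrite -[LHS]mule1 -[X in (X * _)%E]/(nu m (cube L)).
have E n : (nu n (cube L) = \int[nu n]_x (\1_(cube L) x)%:E)%E.
  by rewrite integral_indic// ?setIT//; exact: measurable_cube.
rewrite mule1 E; elim: m => [|m IH].
  rewrite integral_rV0; last by apply/measurable_EFinP; apply: measurable_indic; exact: measurable_cube.
  by rewrite indicE mem_set// => -[].
rewrite ge0_integral_rVS; first last.
- by move=> x; rewrite lee_fin.
- by apply/measurable_EFinP; apply: measurable_indic; exact: measurable_cube.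
transitivity (\int[nu m]_y ((2 * L)%:E * (\1_(cube L) y)%:E))%E.
  apply: eq_integral => y _; under eq_integral do rewrite cube_rVS mulrC EFinM.
  rewrite ge0_integralZl//=; first last.
  - by apply/measurable_EFinP; exact: measurable_indic.
  rewrite integral_indic//= setIT lebesgue_measure_itv/= lte_fin gtrN// muleC.
  by rewrite -EFinB; congr (_%:E * _)%E; ring.
rewrite ge0_integralZl//=; first last.
- by rewrite lee_fin mulr_ge0// ltW.
- by apply/measurable_EFinP; apply: measurable_indic; exact: measurable_cube.
by rewrite IH -EFinM exprS.
Qed.

Lemma indic_freq_box m L t (y : 'rV[R]_m) :
  \1_(freq_box L) (rV_cons (t, y)) = \1_`[L, (2 * L)] t * \1_(cube L) y :> R.
Proof.
rewrite !indicE -natrM mulnb; congr (_%:R); congr nat_of_bool.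
rewrite (_ : (t \in _) = (L <= t <= 2 * L)); last by rewrite mem_setE in_itv.
apply/idP/idP.
  rewrite inE => -[h1 h2]; apply/andP; split; first by move: h1; rewrite rV_cons0.
  by rewrite inE => j; have := h2 j; rewrite -rtailE rtail_cons.
move=> /andP[tL]; rewrite !inE => yL; split; first by rewrite rV_cons0.
by move=> j; rewrite -rtailE rtail_cons.
Qed.

Lemma measurable_freq_box m L : measurable (@freq_box R m L).
Proof.
rewrite (_ : freq_box L = (rV_coord ord0 @^-1` `[L, (2 * L)]) `&` (@rtail R m @^-1` cube L)); last first.
  apply/seteqP; split=> x.
    by move=> [h1 h2]; split=> //= j; rewrite rtailE.
  by move=> [h1 h2]; split=> // j; rewrite -rtailE.
apply: measurableI.
  by rewrite -[X in measurable X]setTI; apply: measurable_rV_coord.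
rewrite -[X in measurable X]setTI; apply: measurable_rtail => //.
exact: measurable_cube.
Qed.

Lemma measure_freq_box m L : 0 < L -> nu m.+1 (freq_box L) = (L * (2 * L) ^+ m)%:E.
Proof.
move=> L0; have mF := @measurable_freq_box m L.
have -> : (nu m.+1 (freq_box L) = \int[nu m.+1]_x (\1_(freq_box L) x)%:E)%E.
  by rewrite integral_indic// setIT.
rewrite ge0_integral_rVS; first last.
- by move=> x; rewrite lee_fin.
- by apply/measurable_EFinP; exact: measurable_indic.
transitivity (\int[nu m]_y (L%:E * (\1_(cube L) y)%:E))%E.
  apply: eq_integral => y _; under eq_integral do rewrite indic_freq_box mulrC EFinM.
  rewrite ge0_integralZl//=; first last.
  - by apply/measurable_EFinP; exact: measurable_indic.
  rewrite integral_indic//= setIT lebesgue_measure_itv/= lte_fin ltr_pMl ?ltr1n// muleC.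
  by rewrite -EFinB; congr (_%:E * _)%E; ring.
have mC := @measurable_cube m L.
rewrite ge0_integralZl//=; first last.
- by rewrite lee_fin ltW.
- by apply/measurable_EFinP; exact: measurable_indic.
rewrite integral_indic// setIT EFinM; congr (_ * _)%E; exact: measure_cube.
Qed.

End frequency_box.

(** * Pairing with the Fourier transform of the domain *)

Section pairing.
Context {R : realType} {n : nat}.
Local Notation nu := (@lebesgue_rV R).
Local Notation E := ('rV[R]_n).
Local Notation normc := (@ComplexField.Normc.normc R).

Lemma normc_ge0 (z : R[i]) : 0 <= normc z.
Proof. by case: z => u v; exact: sqrtr_ge0. Qed.

Lemma measurable_normc (g : E -> R[i]) :
  measurable_fun setT (@complex.Re R \o g) -> measurable_fun setT (@complex.Im R \o g) ->
  measurable_fun setT (fun x => normc (g x)).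
Proof.
move=> mr mi.
have ms : measurable_fun setT (@Num.sqrt R).
  by apply: continuous_measurable_fun; exact: sqrt_continuous.
rewrite (_ : (fun x => _) = Num.sqrt \o
    (fun x => (@complex.Re R \o g) x ^+ 2 + (@complex.Im R \o g) x ^+ 2)); last first.
  by apply/funext => x /=; case: (g x).
apply: (measurableT_comp ms); apply: measurable_funD.
  exact: (measurable_funX 2 mr).
exact: (measurable_funX 2 mi).
Qed.

(** The imaginary part is what matters, because for the transform of a wave packet it carries the
    sine, which vanishes on the supporting hyperplane when [c] is the support point. *)
Lemma Im_pairing_le (a : R) (xi c : E) (g : E -> R[i]) :
  measurable_fun setT (@complex.Re R \o g) -> measurable_fun setT (@complex.Im R \o g) ->
  (`|complex.Im (distribution_of g (gauss_wave a xi c))|%:E <=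
   \int[nu n]_x (normc (g x) * gauss a xi x)%:E)%E.
Proof.
move=> mr mi.
pose f x := complex.Im (g x * gauss_wave a xi c x).
have fE x : f x = gauss a xi x *
    (complex.Re (g x) * sin (dotp c x) + complex.Im (g x) * cos (dotp c x)).
  by rewrite /f /gauss_wave; case: (g x) => u v /=; ring.
have mc : measurable_fun setT (fun x => cos (dotp c x)).
  exact: (measurableT_comp measurable_cosT (measurable_dotp c)).
have ms : measurable_fun setT (fun x => sin (dotp c x)).
  apply: (measurableT_comp _ (measurable_dotp c)).
  by apply: continuous_measurable_fun; exact: continuous_sin.
have mf : measurable_fun setT (EFin \o f).
  apply/measurable_EFinP; rewrite (_ : f = fun x => gauss a xi x *
    (complex.Re (g x) * sin (dotp c x) + complex.Im (g x) * cos (dotp c x))); last exact/funext.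
  apply: measurable_funM; first exact: measurable_gauss.
  by apply: measurable_funD; apply: measurable_funM.
(* [fine] sends infinite values to 0, so the bound does not presuppose integrability of the
   pairing. *)
have fin (X : \bar R) : (`|fine X|%:E <= `|X|)%E by case: X => [r||] //=; rewrite normr0 leey.
have -> : complex.Im (distribution_of g (gauss_wave a xi c)) = fine (\int[nu n]_x (f x)%:E)%E by [].
apply: le_trans (fin _) _.
apply: le_trans (le_abse_integral _ _ _) _ => //.
apply: ge0_le_integral => //.
- exact: measurableT_comp.
- apply/measurable_EFinP; apply: measurable_funM; last exact: measurable_gauss.
  exact: measurable_normc.
move=> x _; rewrite /= lee_fin fE normrM (ger0_norm (gauss_ge0 _ _ _)) mulrC.
rewrite ler_wpM2r ?gauss_ge0//; case: (g x) => u v /=.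
rewrite -sqrtr_sqr ler_wsqrtr//.
have cs := cos2Dsin2 (dotp c x).
set C := cos _ in cs *; set S := sin _ in cs *.
have -> : u ^+ 2 + v ^+ 2 = (u ^+ 2 + v ^+ 2) * (C ^+ 2 + S ^+ 2) by rewrite cs mulr1.
rewrite -subr_ge0 (_ : _ - _ = (u * C - v * S) ^+ 2) ?sqr_ge0//; ring.
Qed.

Lemma Im_dfourier_indic (a : R) (xi c : E) (D : set E) : 0 < a ->
  complex.Im (dfourier (distribution_of (fun x : E => (\1_D x)%:C)) (gauss_wave a xi c)) =
  \int[nu n]_x (\1_D x * (Num.sqrt (pi / a) ^+ n *
    (gauss (4 * a)^-1 c x * sin (dotp xi (c - x))))).
Proof.
move=> a0; rewrite -[LHS]/(\int[nu n]_x complex.Im ((\1_D x)%:C * fourier (gauss_wave a xi c) x)).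
apply: eq_Rintegral => x _; rewrite fourier_gauss_wave//=; ring.
Qed.

(** For t > M write t = t^p t^(1-p) and use 1 - p <= 0. It does the work of Hoelder's inequality:
    [M] will be the expected size of g, and the first summand is absorbed on the left. *)
Lemma ler_pow_split (p M t : R) : 1 <= p -> 0 < M -> 0 <= t ->
  t <= M + M `^ (1 - p) * t `^ p.
Proof.
move=> p1 M0 t0; have P0 : 0 <= M `^ (1 - p) * t `^ p by rewrite mulr_ge0 ?powR_ge0.
have [tM|Mt] := leP t M; first by rewrite (le_trans tM)// lerDl.
apply: (@le_trans _ _ (M `^ (1 - p) * t `^ p)); last by rewrite lerDr ltW.
have t1 : 0 < t by exact: lt_trans Mt.
rewrite (_ : 1 - p = - (p - 1)); last by ring.
rewrite powRN mulrC ler_pdivlMr ?powR_gt0//.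
rewrite (_ : t `^ p = t * t `^ (p - 1)); last first.
  by rewrite -[X in X * _](powRr1 (ltW t1)) -powRD ?(gt_eqF t1) ?implybT//; congr powR; ring.
by rewrite ler_pM2l//; apply: ge0_ler_powR; rewrite ?nnegrE ?subr_ge0 ?(ltW M0) ?(ltW t1) ?(ltW Mt).
Qed.

End pairing.

Section pairing_lower_bound.
Context {R : realType} {m : nat}.
Local Notation nu := (@lebesgue_rV R).
Local Notation E := ('rV[R]_m.+1).
Local Notation normc := (@ComplexField.Normc.normc R).
Variables (D : set E) (g : E -> R[i]).
Hypothesis mRe : measurable_fun setT (@complex.Re R \o g).
Hypothesis mIm : measurable_fun setT (@complex.Im R \o g).
Hypothesis oD : open D.
Hypothesis gP : forall phi, schwartz phi ->
  dfourier (distribution_of (fun x : E => (\1_D x)%:C)) phi = distribution_of g phi.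

(* Moving the centre of the wave by half a period in the first coordinate flips
   the sign of the sine, so the difference of two pairings is the gaussian pair. *)
Lemma pairing_lower (a I0 : R) (xi x0 : E) : 0 < a -> xi 0 ord0 != 0 ->
  I0 <= \int[nu m.+1]_x (\1_D x * (gauss_pair (4 * a)^-1 x0 (pi / xi 0 ord0) x *
    sin (dotp xi (x0 - x)))) ->
  ((Num.sqrt (pi / a) ^+ m.+1 * I0)%:E <=
   2%:E * \int[nu m.+1]_x (normc (g x) * gauss a xi x)%:E)%E.
Proof.
move=> a0 k0 hI; set h := pi / xi 0 ord0; set K := _ ^+ m.+1.
set b := (4 * a)^-1 in hI; have b0 : 0 < b by rewrite invr_gt0 mulr_gt0.
have [x1 x1E] : exists x1, x1 = x0 + h *: (delta_mx 0 ord0 : E) by exists (x0 + h *: delta_mx 0 ord0).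
have K0 : 0 <= K by rewrite exprn_ge0// sqrtr_ge0.
have mD : measurable D by exact: open_measurable_rV.
have s1 x : sin (dotp xi (x1 - x)) = - sin (dotp xi (x0 - x)).
  have -> : x1 - x = (x0 - x) + h *: (delta_mx 0 ord0 : E) by rewrite x1E addrAC.
  rewrite dotpDr dotpZr (dotpC xi (delta_mx _ _)) dotp_delta.
  by rewrite /h divfK// sinDpi.
have i0 c y : (nu m.+1).-integrable setT (EFin \o (fun x => \1_D x * (K *
    (gauss b c x * sin (dotp xi (y - x)))))).
  apply: (@integrable_gauss_bound _ _ b c K) => //.
    apply: measurable_funM; first exact: measurable_indic.
    apply: measurable_funM => //; apply: measurable_funM; first exact: measurable_gauss.
    exact: measurable_sin_dotp.
  move=> x; rewrite normrM -[leRHS]mul1r; apply: ler_pM => //.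
    by rewrite indicE; case: (_ \in _); rewrite ?normr1 ?normr0.
  rewrite normrM (ger0_norm K0) ler_wpM2l// normrM (ger0_norm (gauss_ge0 _ _ _)).
  by rewrite ler_piMr ?gauss_ge0 ?normr_sin_le1.
have e c := Im_dfourier_indic xi c D a0.
pose F c x := \1_D x * (K * (gauss b c x * sin (dotp xi (c - x)))).
have B1 : \int[nu m.+1]_x (F x0 x - F x1 x) =
    \int[nu m.+1]_x F x0 x - \int[nu m.+1]_x F x1 x.
  exact: (RintegralB measurableT (i0 x0 x0) (i0 x1 x1)).
have iW : (nu m.+1).-integrable setT (EFin \o (fun x : E =>
    \1_D x * (gauss_pair b x0 h x * sin (dotp xi (x0 - x))))).
  apply: integrable_gauss_pair_bound => //; first exact: measurable_sin_dotp.
  by move=> x; exact: normr_sin_le1.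
have E0 : K * \int[nu m.+1]_x (\1_D x * (gauss_pair b x0 h x * sin (dotp xi (x0 - x)))) =
    complex.Im (distribution_of g (gauss_wave a xi x0)) -
    complex.Im (distribution_of g (gauss_wave a xi x1)).
  have sw c := etrans (congr1 (@complex.Im R) (esym (gP (schwartz_gauss_wave xi c a0)))) (e c).
  rewrite (sw x0) (sw x1) -(RintegralZl _ measurableT iW).
  apply: etrans B1; apply: eq_Rintegral => x _.
  by rewrite /F s1 /gauss_pair -x1E; ring.
apply: (@le_trans _ _ ((`|complex.Im (distribution_of g (gauss_wave a xi x0))|%:E +
    `|complex.Im (distribution_of g (gauss_wave a xi x1))|%:E)%E)).
  rewrite -EFinD lee_fin; apply: le_trans (ler_wpM2l K0 hI) _.
  rewrite -/h E0; apply: le_trans (ler_norm _) _; exact: ler_normB.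
rewrite -[2]/(1 + 1) EFinD ge0_muleDl ?lee_fin// mul1e.
by apply: leeD; exact: Im_pairing_le.
Qed.

(** Let [K] be the mass of the Gaussian and B the right-hand side. The pairing and [ler_pow_split]
    give 4 K M <= 2 (K M + M^(1-p) B), hence K M <= M^(1-p) B; the factor 4 in the hypothesis pays
    for the 2 and for absorbing K M. *)
Lemma pairing_pow_lower (a p M : R) (xi x0 : E) : 0 < a -> xi 0 ord0 != 0 -> 1 <= p -> 0 < M ->
  4 * M <= \int[nu m.+1]_x (\1_D x * (gauss_pair (4 * a)^-1 x0 (pi / xi 0 ord0) x *
    sin (dotp xi (x0 - x)))) ->
  ((Num.sqrt (pi / a) ^+ m.+1 * M `^ p)%:E <=
   \int[nu m.+1]_x (normc (g x) `^ p * gauss a xi x)%:E)%E.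
Proof.
move=> a0 k0 p1 M0 /(pairing_lower a0 k0); set K := _ ^+ m.+1 => hA.
have K0 : 0 < K by rewrite exprn_gt0// sqrtr_gt0 divr_gt0// pi_gt0.
have mn := measurable_normc mRe mIm.
have mp : measurable_fun setT (fun x => normc (g x) `^ p).
  exact: (measurableT_comp (measurable_powR p) mn).
have mg := measurable_gauss a xi.
set B := (\int[nu m.+1]_x (normc (g x) `^ p * gauss a xi x)%:E)%E.
have AB : (\int[nu m.+1]_x (normc (g x) * gauss a xi x)%:E <=
    (K * M)%:E + (M `^ (1 - p))%:E * B)%E.
  apply: (@le_trans _ _ (\int[nu m.+1]_x ((M * gauss a xi x)%:E +
      (M `^ (1 - p) * (normc (g x) `^ p * gauss a xi x))%:E))%E).
    apply: ge0_le_integral => //.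
    - by move=> x _; rewrite lee_fin mulr_ge0 ?gauss_ge0 ?normc_ge0.
    - by apply/measurable_EFinP; exact: measurable_funM.
    - apply: emeasurable_funD; apply/measurable_EFinP; first exact: measurable_funM.
      by apply: measurable_funM => //; exact: measurable_funM.
    move=> x _; rewrite -EFinD lee_fin mulrA -mulrDl ler_wpM2r ?gauss_ge0//.
    by apply: ler_pow_split => //; exact: normc_ge0.
  rewrite ge0_integralD//; first last.
  - by apply/measurable_EFinP; do 2 apply: measurable_funM => //.
  - by move=> x _; rewrite lee_fin !mulr_ge0 ?powR_ge0 ?gauss_ge0.
  - by apply/measurable_EFinP; exact: measurable_funM.
  - by move=> x _; rewrite lee_fin mulr_ge0 ?gauss_ge0// ltW.
  apply: leeD.
    under eq_integral do rewrite EFinM.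
    rewrite ge0_integralZl//=; first last.
    - by rewrite lee_fin ltW.
    - by move=> x _; exact: gauss_ge0.
    - exact/measurable_EFinP.
    by rewrite integral_gauss// -EFinM mulrC.
  under eq_integral do rewrite EFinM.
  rewrite ge0_integralZl//=.
  - by apply/measurable_EFinP; exact: measurable_funM.
  - by move=> x _; rewrite lee_fin mulr_ge0 ?powR_ge0 ?gauss_ge0.
  - by rewrite lee_fin powR_ge0.
have B0 : (0 <= B)%E.
  by apply: integral_ge0 => x _; rewrite lee_fin mulr_ge0 ?powR_ge0 ?gauss_ge0.
have : ((K * (4 * M))%:E <= 2%:E * ((K * M)%:E + (M `^ (1 - p))%:E * B))%E.
  by apply: le_trans hA _; rewrite lee_wpmul2l ?lee_fin.
move: B0; case: (B) => [B'| |]; [|by move=> *; rewrite leey|by []].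
rewrite !lee_fin => B'0 hB.
have KM : K * M <= M `^ (1 - p) * B' by move: hB; nra.
rewrite (_ : M `^ p = M * M `^ (p - 1)); last first.
  by rewrite -[X in X * _](powRr1 (ltW M0)) -powRD ?(gt_eqF M0) ?implybT//; congr powR; ring.
by rewrite mulrA -ler_pdivlMr ?powR_gt0// -powRN opprB [leRHS]mulrC.
Qed.

End pairing_lower_bound.

(** * Averaging over frequency boxes *)

Section box_average.
Context {R : realType} {m : nat}.
Local Notation nu := (@lebesgue_rV R).
Local Notation E := ('rV[R]_m.+1).

Lemma measurable_gauss2 (a : R) :
  measurable_fun setT (fun z : E * E => gauss a z.1 z.2).
Proof.
have mh : measurable_fun setT (fun z : E * E => dotp (z.2 - z.1) (z.2 - z.1)).
  rewrite (_ : (fun z => _) = fun z : E * E =>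
      \sum_(i < m.+1) (rV_coord i z.2 - rV_coord i z.1) ^+ 2); last first.
    by apply/funext => z; apply: eq_bigr => i _; rewrite !mxE expr2.
  apply: measurable_sum => i; apply: measurable_funX; apply: measurable_funB.
    exact: (measurableT_comp (measurable_rV_coord i) measurable_snd).
  exact: (measurableT_comp (measurable_rV_coord i) measurable_fst).
rewrite /gauss; apply: measurableT_comp => //.
by apply: measurableT_comp => //; exact: measurable_funM.
Qed.

(** The box indicator convolved with the Gaussian density of mass 1. Its values lie in [0, 1], which
    provides the domination in the limit. *)
Definition box_kernel (a L : R) (eta : E) : R :=
  (Num.sqrt (pi / a) ^+ m.+1)^-1 *
  \int[nu m.+1]_xi (\1_(freq_box L) xi * gauss a xi eta).

Lemma integrable_box_gauss a L (eta : E) : 0 < a ->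
  (nu m.+1).-integrable setT (EFin \o (fun xi => \1_(freq_box L) xi * gauss a xi eta)).
Proof.
move=> a0; apply: (@integrable_gauss_bound _ _ a eta 1) => //.
  apply: measurable_funM; first by apply: measurable_indic; exact: measurable_freq_box.
  rewrite (_ : gauss a ^~ eta = gauss a eta); first exact: measurable_gauss.
  by apply/funext => x; rewrite gaussC.
move=> x; rewrite normrM (ger0_norm (gauss_ge0 _ _ _)) gaussC ler_wpM2r ?gauss_ge0//.
by rewrite indicE; case: (_ \in _); rewrite ?normr1 ?normr0.
Qed.

Lemma box_kernel_ge0 a L eta : 0 <= box_kernel a L eta.
Proof.
rewrite mulr_ge0 ?invr_ge0 ?exprn_ge0 ?sqrtr_ge0//.
by apply: Rintegral_ge0 => x _; rewrite mulr_ge0 ?gauss_ge0.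
Qed.

Lemma measurable_box_kernel a L : measurable_fun setT (box_kernel a L).
Proof.
apply: measurable_funM => //.
have mF : measurable_fun setT (fun z : E * E => (\1_(freq_box L) z.1 * gauss a z.1 z.2)%:E).
  apply/measurable_EFinP; apply: measurable_funM; last exact: measurable_gauss2.
  have mI : measurable_fun setT (\1_(freq_box L) : E -> R).
    by apply: measurable_indic; exact: measurable_freq_box.
  exact: (measurableT_comp mI measurable_fst).
have F0 (z : E * E) : (0 <= (\1_(freq_box L) z.1 * gauss a z.1 z.2)%:E :> \bar R)%E.
  by rewrite lee_fin mulr_ge0 ?gauss_ge0.
have h := measurable_fun_fubini_tonelli_G (m1 := nu m.+1) _ mF F0.
exact: (measurableT_comp (fine_measurable measurableT) h).
Qed.

Lemma box_kernel_le C a a' L (eta : E) : 0 < a -> 0 < a' -> 0 <= C ->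
  (forall xi, freq_box L xi -> gauss a xi eta <= C * gauss a' eta xi) ->
  box_kernel a L eta <= C * (Num.sqrt (pi / a') / Num.sqrt (pi / a)) ^+ m.+1.
Proof.
move=> a0 a'0 C0 le.
have K0 : 0 < Num.sqrt (pi / a) ^+ m.+1 by rewrite exprn_gt0// sqrtr_gt0 divr_gt0// pi_gt0.
rewrite /box_kernel mulrC ler_pdivrMr// exprMn exprVn -mulrA divfK ?gt_eqF//.
have -> : C * Num.sqrt (pi / a') ^+ m.+1 = \int[nu m.+1]_xi (C * gauss a' eta xi).
  by rewrite RintegralZl ?/Rintegral ?integral_gauss//; exact: integrable_gauss.
apply: le_Rintegral => //; first exact: integrable_box_gauss.
  by apply: integrableMl_EFin; exact: integrable_gauss.
move=> xi _; rewrite indicE; case: (boolP (xi \in freq_box L)) => [|_].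
  by rewrite inE mul1r; exact: le.
by rewrite mul0r mulr_ge0 ?gauss_ge0.
Qed.

Lemma box_kernel_le1 a L eta : 0 < a -> box_kernel a L eta <= 1.
Proof.
move=> a0; have K0 : 0 < Num.sqrt (pi / a) by rewrite sqrtr_gt0 divr_gt0// pi_gt0.
apply: le_trans (@box_kernel_le 1 a a L eta a0 a0 ler01 _) _.
  by move=> xi _; rewrite mul1r gaussC.
by rewrite divff ?gt_eqF// expr1n mulr1.
Qed.

(** Such a point is at distance at least L / 2 from the box. Half of the exponent yields e^(-a L^2 /
    8) <= 8 / (a L^2); the other half keeps a Gaussian of exponent a / 2, whose mass explains the
    powers of the square root of 2. *)
Lemma box_kernel_far a L (eta : E) : 0 < a -> 0 < L -> 2 * `|eta 0 ord0| <= L ->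
  box_kernel a L eta <= 8 / (a * L ^+ 2) * Num.sqrt 2 ^+ m.+1.
Proof.
move=> a0 L0 eL; have a2 : 0 < a / 2 by rewrite divr_gt0.
have C0 : 0 <= 8 / (a * L ^+ 2) by rewrite divr_ge0// mulr_ge0 ?sqr_ge0// ltW.
apply: le_trans (@box_kernel_le (8 / (a * L ^+ 2)) a (a / 2) L eta a0 a2 C0 _) _.
  move=> xi [/andP[l1 _] _]; rewrite (gaussC a).
  have d1 : L / 2 <= enorm (xi - eta).
    apply: le_trans (enorm_coord _ ord0); rewrite !mxE.
    have := ler_norm (eta 0 ord0); have := ler_norm (xi 0 ord0 - eta 0 ord0); lra.
  have d2 : L ^+ 2 / 4 <= dotp (xi - eta) (xi - eta).
    rewrite -enorm2 (_ : L ^+ 2 / 4 = (L / 2) ^+ 2); last by field.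
    by rewrite lerXn2r// nnegrE ?enorm_ge0// divr_ge0// ltW.
  apply: (@le_trans _ _ (expR (- (a * L ^+ 2 / 8)) * gauss (a / 2) eta xi)).
    rewrite /gauss -expRD ler_expR; have := ler_wpM2l (ltW a0) d2; lra.
  rewrite ler_wpM2r ?gauss_ge0// expRN -[leRHS]invrK lef_pV2 ?posrE ?expR_gt0 ?invr_gt0 ?divr_gt0 ?mulr_gt0 ?exprn_gt0//.
  rewrite invfM invrK; apply: le_trans (expR_ge1Dx _).
  by rewrite mulrC lerDr.
have -> : Num.sqrt (pi / (a / 2)) / Num.sqrt (pi / a) = Num.sqrt 2.
  rewrite (_ : pi / (a / 2) = 2 * (pi / a)); last by field; rewrite gt_eqF.
  by rewrite sqrtrM// mulfK// gt_eqF// sqrtr_gt0 divr_gt0// pi_gt0.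
by [].
Qed.

(** Integrate the bound over the box and exchange the integrals by Tonelli; the inner integral in
    [xi] is then the kernel, up to the mass of the Gaussian. *)
Lemma box_average (G : E -> R) (a L M : R) : 0 < a -> 0 < L -> 0 <= M ->
  measurable_fun setT G -> (forall x, 0 <= G x) ->
  (forall xi, freq_box L xi -> ((Num.sqrt (pi / a) ^+ m.+1 * M)%:E <=
     \int[nu m.+1]_x (G x * gauss a xi x)%:E)%E) ->
  ((L * (2 * L) ^+ m * M)%:E <= \int[nu m.+1]_x (G x * box_kernel a L x)%:E)%E.
Proof.
move=> a0 L0 M0 mG G0 hB; set K := _ ^+ m.+1 in hB.
have K0 : 0 < K by rewrite exprn_gt0// sqrtr_gt0 divr_gt0// pi_gt0.
pose F (z : E * E) := (G z.2 * (\1_(freq_box L) z.1 * gauss a z.1 z.2))%:E.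
have mI : measurable_fun setT (\1_(freq_box L) : E -> R).
  by apply: measurable_indic; exact: measurable_freq_box.
have mF : measurable_fun setT F.
  apply/measurable_EFinP; apply: measurable_funM.
    exact: (measurableT_comp mG measurable_snd).
  apply: measurable_funM; last exact: measurable_gauss2.
  exact: (measurableT_comp mI measurable_fst).
have F0 z : (0 <= F z)%E by rewrite lee_fin !mulr_ge0 ?gauss_ge0.
have E1 : (\int[nu m.+1]_x (G x * box_kernel a L x)%:E =
    (K^-1)%:E * \int[nu m.+1]_x \int[nu m.+1]_xi F (xi, x))%E.
  rewrite -ge0_integralZl//=.
  - apply: eq_integral => x _; rewrite /F /=.
    under [in RHS]eq_integral do rewrite EFinM.
    rewrite ge0_integralZl//=.
    + rewrite /box_kernel -/K mulrCA EFinM EFinM; congr (_ * (_ * _))%E.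
      rewrite /Rintegral fineK//; exact: integrable_fin_num (integrable_box_gauss L x a0).
    + apply/measurable_EFinP; apply: measurable_funM => //.
      rewrite (_ : gauss a ^~ x = gauss a x); first exact: measurable_gauss.
      by apply/funext => y; rewrite gaussC.
    + by move=> y _; rewrite lee_fin mulr_ge0 ?gauss_ge0.
    + by rewrite lee_fin.
  - exact: (measurable_fun_fubini_tonelli_G (m1 := nu m.+1) F).
  - by move=> x _; exact: integral_ge0.
  - by rewrite lee_fin invr_ge0 ltW.
rewrite E1 -(fubini_tonelli F mF F0).
have lower : (\int[nu m.+1]_xi ((K * M)%:E * (\1_(freq_box L) xi)%:E) <=
    \int[nu m.+1]_xi \int[nu m.+1]_x F (xi, x))%E.
  apply: ge0_le_integral => //.
  - by move=> xi _; rewrite -EFinM lee_fin !mulr_ge0// ltW.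
  - by apply/measurable_EFinP; exact: measurable_funM.
  - exact: (measurable_fun_fubini_tonelli_F (m2 := nu m.+1) F).
  move=> xi _; rewrite /F /= indicE; case: (boolP (xi \in freq_box L)) => [|_].
    rewrite inE => /hB; rewrite mule1 => h; apply: le_trans h _.
    by under [leRHS]eq_integral do rewrite mul1r.
  by rewrite mule0 integral_ge0// => x _; rewrite mul0r mulr0.
rewrite ge0_integralZl//= in lower; first last.
- by rewrite lee_fin mulr_ge0// ltW.
- exact/measurable_EFinP.
have mb := @measurable_freq_box R m L.
rewrite integral_indic// setIT in lower.
have -> : (L * (2 * L) ^+ m * M)%:E = ((K^-1)%:E * ((K * M)%:E * (L * (2 * L) ^+ m)%:E))%E.
  by rewrite -!EFinM; congr EFin; field; rewrite gt_eqF.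
rewrite lee_wpmul2l ?lee_fin ?invr_ge0 ?(ltW K0)//.
by apply: le_trans lower; rewrite lee_wpmul2l ?lee_fin ?mulr_ge0 ?(ltW K0)// -measure_freq_box.
Qed.

End box_average.

(** * The theorem *)

Lemma Lp_integrable_powR (R : realType) n (p : R) (g : 'rV[R]_n -> R[i]) : 1 <= p ->
  Lp p%:E g ->
  (@lebesgue_rV R n).-integrable setT
    (EFin \o (fun x => ComplexField.Normc.normc (g x) `^ p)).
Proof.
move=> p1 [mr mi Ng]; have mn := measurable_normc mr mi.
have p0 : p != 0 by rewrite gt_eqF// (lt_le_trans ltr01).
apply/integrableP; split.
  by apply/measurable_EFinP; exact: (measurableT_comp (measurable_powR p) mn).
have := poweR_lty p Ng; rewrite poweR_Lnorm//.
congr (_ < _)%E; apply: eq_integral => x _ /=.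
by rewrite (ger0_norm (normc_ge0 _)) ger0_norm ?powR_ge0// poweR_EFin.
Qed.

(** With n = m + 1, the lower bound c de^m / L equals (c / eps) de^(n+al), so L^n times its p-th
    power is eps^n (c / eps)^p times de to the power (n + al) p - n (1 + al). That exponent is at
    most 0 and de <= 1. *)
Lemma scale_exponent (R : realType) (al p c eps de L : R) m : 0 < al -> 0 < de -> de <= 1 ->
  0 < eps -> 0 < c -> 0 <= p -> p * (m.+1%:R + al) <= m.+1%:R * (1 + al) ->
  L = eps / (de `^ al * de) ->
  eps ^+ m.+1 * (c / eps) `^ p <= L * (2 * L) ^+ m * (c * de ^+ m / L) `^ p.
Proof.
move=> al0 de0 de1 eps0 c0 p0 hp LE0.
have q0 : 0 < de `^ (1 + al) by exact: powR_gt0.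
have qE : de `^ al * de = de `^ (1 + al).
  by rewrite powRD ?(gt_eqF de0) ?implybT// powRr1 ?ltW// mulrC.
have LE : L = eps / de `^ (1 + al) by rewrite LE0 qE.
have L0 : 0 < L by rewrite LE divr_gt0.
apply: (@le_trans _ _ (L ^+ m.+1 * (c * de ^+ m / L) `^ p)); last first.
  rewrite ler_wpM2r ?powR_ge0// exprS ler_pM2l// lerXn2r ?nnegrE ?(ltW L0) ?mulr_ge0 ?(ltW L0)//.
  by rewrite ler_peMl ?ler1n// ltW.
have ME : c * de ^+ m / L = c / eps * de `^ (m.+1%:R + al).
  rewrite LE -(powR_mulrn m (ltW de0)) (_ : m.+1%:R + al = m%:R + (1 + al)); last by rewrite -natr1; ring.
  rewrite [in RHS]powRD ?(gt_eqF de0) ?implybT//; field.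
  by rewrite !gt_eqF.
have E1 : (c / eps * de `^ (m.+1%:R + al)) `^ p = (c / eps) `^ p * de `^ ((m.+1%:R + al) * p).
  by rewrite powRM ?powR_ge0 ?divr_ge0 ?(ltW c0) ?(ltW eps0)// powRrM.
have E2 : L ^+ m.+1 = eps ^+ m.+1 / de `^ ((1 + al) * m.+1%:R).
  by rewrite LE exprMn exprVn -(powR_mulrn m.+1 (powR_ge0 _ _)) powRrM.
rewrite ME E1 E2.
rewrite [leRHS](_ : _ = eps ^+ m.+1 * (c / eps) `^ p *
  (de `^ ((m.+1%:R + al) * p) / de `^ ((1 + al) * m.+1%:R))); last by ring.
rewrite ler_peMr ?mulr_ge0 ?powR_ge0 ?exprn_ge0 ?(ltW eps0)//.
rewrite ler_pdivlMr ?powR_gt0// mul1r; apply: ger_powR; first by rewrite de0.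
by rewrite mulrC [leRHS]mulrC.
Qed.

Theorem corollary1 (R : realType) (alpha : R) (n : nat) (D : set 'rV[R]_n)
    (p : R) :
  0 < alpha -> alpha <= 1 -> (2 <= n)%N ->
  is_domain D -> bounded_set D -> C1alpha_boundary alpha D ->
  1 <= p -> p <= 1 + (n%:R - 1) * alpha / (n%:R + alpha) ->
  ~ Ap p%:E (distribution_of (fun x : 'rV[R]_n => (\1_D x)%:C)).
Proof.
case: n D => [//|m] D al0 al1 _ [D0 oD _] bD cD p1 hp [_ [g [Lg gP]]].
have p0 : 0 < p by exact: lt_le_trans p1.
have hp' : p * (m.+1%:R + alpha) <= m.+1%:R * (1 + alpha).
  have n0 : 0 < m.+1%:R + alpha by rewrite addr_gt0.
  apply: le_trans (ler_wpM2r (ltW n0) hp) _.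
  rewrite le_eqVlt; apply/orP; left; apply/eqP; move: (lt0r_neq0 n0).
  by move: (m.+1%:R : R) => u u0; field.
have [mr mi _] := Lg.
have iG := Lp_integrable_powR p1 Lg.
pose G x := ComplexField.Normc.normc (g x) `^ p.
have mG : measurable_fun setT G.
  exact: (measurableT_comp (measurable_powR p) (measurable_normc mr mi)).
have G0 x : 0 <= G x by exact: powR_ge0.
have [eps [c [d0 [eps0 c0 d00 low]]]] := wave_lower_bound al0 al1 oD D0 bD cD.
have c40 : 0 < c / 4 by rewrite divr_gt0.
pose dm := Num.min d0 1; have dm0 : 0 < dm by rewrite lt_min d00 ltr01.
(* [i.+2] makes every width strictly smaller than [dm]. *)
pose de (i : nat) := dm / i.+2%:R.
have de0 i : 0 < de i by rewrite divr_gt0.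
have dedm i : de i < dm by rewrite ltr_pdivrMr// ltr_pMr// ltr1n.
have ded0 i : de i < d0 by apply: lt_le_trans (dedm i) _; rewrite ge_min lexx.
have de1 i : de i <= 1 by apply: le_trans (ltW (dedm i)) _; rewrite ge_min lexx orbT.
pose L i := eps / (de i `^ alpha * de i).
have P0 i : 0 < de i `^ alpha * de i by rewrite mulr_gt0 ?powR_gt0.
have L0 i : 0 < L i by rewrite divr_gt0.
(* A wave packet of parameter a has a transform of Gaussian parameter 1 / (4 a), which here is 1 /
   (2 de^2): width of order [de] in space and 1 / de in frequency. *)
pose a i := de i ^+ 2 / 2.
have a0 i : 0 < a i by rewrite divr_gt0// exprn_gt0.
(* The quarter matches the factor 4 required by [pairing_pow_lower]. *)
pose M i := c / 4 * de i ^+ m / L i.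
have M0 i : 0 < M i by rewrite divr_gt0// mulr_gt0// exprn_gt0.
pose C0 := eps ^+ m.+1 * (c / 4 / eps) `^ p.
have C00 : 0 < C0 by rewrite mulr_gt0 ?exprn_gt0// powR_gt0// divr_gt0.
pose f i x := (G x * box_kernel (a i) (L i) x)%:E.
have f_lower i : (C0%:E <= \int[@lebesgue_rV R m.+1]_x f i x)%E.
  have h := scale_exponent al0 (de0 i) (de1 i) eps0 c40 (ltW p0) hp' (erefl (L i)).
  apply: (@le_trans _ _ (L i * (2 * L i) ^+ m * M i `^ p)%:E); first by rewrite lee_fin.
  apply: box_average => //; first exact: powR_ge0.
  move=> xi bx; have [x0 hx0] := low (de i) (L i) (de0 i) (ded0 i) erefl xi bx.
  have k0 : xi 0 ord0 != 0.
    by have [/andP[l1 _] _] := bx; rewrite gt_eqF// (lt_le_trans (L0 i)).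
  apply: (pairing_pow_lower mr mi oD gP (a0 i) k0 p1 (M0 i) (x0 := x0)).
  have -> : (4 * a i)^-1 = (2 * de i ^+ 2)^-1 by rewrite /a; congr (_^-1); field.
  apply: le_trans hx0; rewrite le_eqVlt; apply/orP; left; apply/eqP.
  by rewrite /M; field; rewrite gt_eqF.
have f_cvg x : f i x @[i --> \oo] --> 0%E.
  apply: cvg_EFin; first exact: nearW.
  rewrite -(mulr0 (G x)); apply: cvgMl_tmp; apply/cvgrPdist_le => e e0.
  pose C1 := 16 / eps ^+ 2 * Num.sqrt 2 ^+ m.+1 : R.
  have C10 : 0 < C1 by rewrite mulr_gt0 ?exprn_gt0 ?sqrtr_gt0// divr_gt0 ?exprn_gt0.
  (* Since a L^2 = eps^2 / (2 de^(2 alpha)), the kernel at a fixed point is at most C1 (de^alpha)^2.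
     The bound by 1 reduces the square to a single factor, and the other bound makes that factor
     small. *)
  have e1 : 0 < Num.min 1 (e / C1) by rewrite lt_min ltr01 divr_gt0.
  have [d d0' dP] := powR_lt_ex al0 e1.
  pose d' := Num.min d (eps / (2 * `|x 0 ord0| + 1)).
  have x0 : 0 < 2 * `|x 0 ord0| + 1 by rewrite ltr_wpDl// mulr_ge0.
  have d'0 : 0 < d' by rewrite lt_min d0' divr_gt0.
  near=> i.
  have dei : de i <= d'.
    rewrite /de ler_pdivrMr// mulrC -ler_pdivrMr//; near: i.
    exists (Num.truncn (dm / d')) => // i /= Ni.
    by apply/ltW/(lt_le_trans (truncnS_gt _)); rewrite ler_nat ltnW.
  have ded : de i <= d by apply: le_trans dei _; rewrite ge_min lexx.
  have dex : de i <= eps / (2 * `|x 0 ord0| + 1) by apply: le_trans dei _; rewrite ge_min lexx orbT.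
  have pal : de i `^ alpha <= 1.
    by apply: le_trans (dP _ (ltW (de0 i)) ded) _; rewrite ge_min lexx.
  have pal2 : de i `^ alpha <= e / C1.
    by apply: le_trans (dP _ (ltW (de0 i)) ded) _; rewrite ge_min lexx orbT.
  have far : 2 * `|x 0 ord0| <= L i.
    apply: (@le_trans _ _ (2 * `|x 0 ord0| + 1)); first by rewrite lerDl.
    rewrite /L ler_pdivlMr//; move: dex; rewrite ler_pdivlMr// => h.
    apply: le_trans h; rewrite mulrC ler_wpM2r ?(ltW x0)//.
    by rewrite ler_piMl// ltW.
  rewrite sub0r normrN ger0_norm ?box_kernel_ge0//.
  apply: le_trans (box_kernel_far (a0 i) (L0 i) far) _.
  have -> : 8 / (a i * L i ^+ 2) * Num.sqrt 2 ^+ m.+1 = C1 * (de i `^ alpha) ^+ 2.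
    rewrite /C1 /a /L; field; by rewrite !gt_eqF// powR_gt0.
  rewrite mulrC -ler_pdivlMr//; apply: le_trans pal2.
  by rewrite expr2 ler_piMl ?powR_ge0.
have : (\int[@lebesgue_rV R m.+1]_x f i x)%E @[i --> \oo] --> (\int[@lebesgue_rV R m.+1]_(x in setT) 0)%E.
  apply: (@dominated_cvg _ _ _ (@lebesgue_rV R m.+1) setT measurableT f (fun=> 0%E) (EFin \o G)) => //.
  - move=> i; apply/measurable_EFinP; apply: measurable_funM => //.
    exact: measurable_box_kernel.
  - move=> i x _; have h0 : 0 <= G x * box_kernel (a i) (L i) x.
      by rewrite (mulr_ge0 (G0 x) (box_kernel_ge0 _ _ _)).
    by rewrite /f /= lee_fin ger0_norm// ler_piMr ?box_kernel_le1.
(* The integrals tend to 0 but never drop below the positive constant [C0]. *)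
move=> cvI; have lim := cvg_lim (@ereal_hausdorff R) cvI.
have := lime_ge (cvgP _ cvI) (nearW _ f_lower).
rewrite lim integral0 lee_fin => C0le.
by move: C00; rewrite ltNge C0le.
Unshelve. all: by end_near. Qed.
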